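(* Let $B$ be an $n$-dimensional $C^\infty$ manifold with corners equipped with an integral affine structure $\{(U^B_\alpha,\varphi^B_\alpha)\}$, and let $(P,\mathcal L)$ be the characteristic pair associated with $\{(U^B_\alpha,\varphi^B_\alpha)\}$. Then the canonical model $X_{(P,\mathcal L)}$ is a $C^\infty$ manifold and admits a symplectic structure $\omega_{X_{(P,\mathcal L)}}$ such that $\mu_{X_{(P,\mathcal L)}}\colon(X_{(P,\mathcal L)},\omega_{X_{(P,\mathcal L)}})\to B$ is a locally toric Lagrangian fibration.
   Context: $T^n=(S^1)^n$; the lattice $\Lambda=\{t\in\mathfrak t:\exp t=1\}$ is identified with $\mathbb Z^n$ and $\mathrm{Aut}(T^n)\cong\mathrm{GL}(\Lambda)$ with $\mathrm{GL}_n(\mathbb Z)$. $\mathbb R^n_{\ge0}=\{\xi:\xi_i\ge0\}$, stratified by the number $k$ of nonzero coordinates; for a manifold $B$ with corners modeled on $\mathbb R^n_{\ge0}$, $\mathcal S^{(k)}B$ is the $k$-dimensional stratum. An integral affine structure on $B$ is an atlas $\{(U^B_\alpha,\varphi^B_\alpha)\}$ modeled on open subsets of $\mathbb R^n_{\ge0}$ whose overlap maps are of the form $\varphi^B_\alpha\circ(\varphi^B_\beta)^{-1}(\xi)=A_{\alpha\beta}\xi+c_{\alpha\beta}$ with $A_{\alpha\beta}\in\mathrm{GL}_n(\mathbb Z)$, $c_{\alpha\beta}\in\mathbb R^n$. Associated characteristic pair: $P$ is the frame bundle, with structure group $\mathrm{GL}_n(\mathbb Z)$, of $T^*B$ (transition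 functions $A_{\alpha\beta}^{-T}$, the transpose inverse); $\Lambda_P$ and $\pi_T\colon T_P\to B$ are the associated $\Lambda$- and $T^n$-bundles, fibers of $T_P$ being groups. $\mathcal L\to\mathcal S^{(n-1)}B$ is the rank one subbundle of $\Lambda_P|_{\mathcal S^{(n-1)}B}$ generated, over each component of $U^B_\alpha\cap\mathcal S^{(n-1)}B$ in the trivialization over $U^B_\alpha$, by the unique primitive vector $u_\alpha\in\Lambda$ such that $\varphi^B_\alpha(U^B_\alpha)\subset\{\xi:\langle\xi,u_\alpha\rangle\ge0\}$ and the image of the component lies in $\{\xi:\langle\xi,u_\alpha\rangle=0\}$. Canonical model: for $b\in\mathcal S^{(k)}B$, the $n-k$ local components of $\mathcal S^{(n-1)}B$ near $b$ give rank one sublattices $L_1,\dots,L_{n-k}$ generating an $(n-k)$-dimensional subtorus $Z_b$ of $\pi_T^{-1}(b)$ (trivial for $k=n$). $X_{(P,\mathcal L)}$ is the quotient of $T_P$ by $t\sim t'$ iff $\pi_T(t)=\pi_T(t')=:b$ and $t't^{-1}\in Z_b$; $\mu_{X_{(P,\mathcal L)}}\colon X_{(P,\mathcal L)}\to B$ is induced by $\pi_T$. With $\omega_{\mathbb C^n}=\frac1{2\pi\sqrt{-1}}\sum_kdz_k\wedge d\overline z_k$ and $\mu_{\mathbb C^n}(z)=(|z_1|^2,\dots,|z_n|^2)$, a $C^\infty$ map $\mu\colon(X,\omega)\to B$ from a $2n$-dimensional symplectic manifold is a locally toric Lagrangian fibration if $B$ has coordinate neighborhoods $(U_\alpha,\varphi_\alpha)$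 modeled on $\mathbb R^n_{\ge0}$ covering $B$ and symplectomorphisms $\varphi^X_\alpha\colon(\mu^{-1}(U_\alpha),\omega)\to(\mu_{\mathbb C^n}^{-1}(\varphi_\alpha(U_\alpha)),\omega_{\mathbb C^n})$ with $\mu_{\mathbb C^n}\circ\varphi^X_\alpha=\varphi_\alpha\circ\mu$. *)

(* Defs.v *)
From HB Require Import structures.
From Stdlib Require Import Relation_Operators.
From mathcomp Require Import all_boot all_order all_algebra generic_quotient.
From mathcomp Require Import complex.
From mathcomp Require Import all_classical all_reals all_analysis.

Set Implicit Arguments.
Unset Strict Implicit.
Unset Printing Implicit Defensive.

Import Order.TTheory GRing.Theory Num.Theory.
Import numFieldNormedType.Exports.

Local Open Scope classical_set_scope.
Local Open Scope ring_scope.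

(** * Smooth manifolds, with or without corners *)

Section Smooth.
Context {R : realType} {m : nat} {W : normedModType R}.
Implicit Types (f g : 'rV[R]_m -> W) (D U : set 'rV[R]_m).

Definition iterated_partial (s : seq 'I_m) f : 'rV[R]_m -> W :=
  foldr (fun i g x => 'D_(delta_mx 0 i) g x) f s.

(** All partial derivatives of all orders exist and are continuous on [U]; this
    is the usual notion when [U] is open. *)
Definition smooth_open U f : Prop :=
  forall s x, U x ->
    {for x, continuous (iterated_partial s f)} /\
    forall i, derivable (iterated_partial s f) x (delta_mx 0 i).

(** Smoothness on an arbitrary subset of R^m, such as a relatively open subset
    of the orthant: local existence of smooth extensions. *)
Definition smooth_on D f : Prop :=
  forall x, D x -> exists U g,
    [/\ open U, U x, smooth_open U g & forall y, U y -> D y -> g y = f y].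
End Smooth.

Definition orthant (R : realType) (n : nat) : set 'rV[R]_n :=
  [set xi | forall i, 0 <= xi 0 i].
Arguments orthant : clear implicits.

(** [chart_inv] is only meaningful on the image of [dom]. *)
Record chart (R : realType) (T : topologicalType) (m : nat) := Chart {
  dom : set T;
  coord :> T -> 'rV[R]_m;
  chart_inv : 'rV[R]_m -> T }.

Section Manifolds.
Context {R : realType}.

Section OneManifold.
Context {T : topologicalType} {m : nat}.
(** The local model: the orthant for manifolds with corners, the whole space
    for manifolds without boundary. *)
Variable M : set 'rV[R]_m.
Implicit Types (c d : chart R T m) (A : set (chart R T m)).

Definition is_chart c : Prop :=
  [/\ open (dom c),
      {in dom c, cancel c (chart_inv c)},
      {within dom c, continuous c},
      {within c @` dom c, continuous (chart_inv c)}
    & exists2 W, open W & c @` dom c = W `&` M].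

Definition smooth_transition c d : Prop :=
  smooth_on (c @` (dom c `&` dom d)) (d \o chart_inv c).

Definition is_atlas A : Prop :=
  [/\ forall c, A c -> is_chart c,
      \bigcup_(c in A) dom c = setT
    & forall c d, A c -> A d -> smooth_transition c d].

(** The charts of the maximal atlas containing [A]. *)
Definition coordinate_chart A c : Prop :=
  is_chart c /\
  forall d, A d -> smooth_transition c d /\ smooth_transition d c.

Definition is_manifold A : Prop :=
  [/\ hausdorff_space T, @second_countable T & is_atlas A].
End OneManifold.

Definition smooth_map (T T' : topologicalType) (m m' : nat)
    (A : set (chart R T m)) (A' : set (chart R T' m')) (f : T -> T') : Prop :=
  continuous f /\
  forall c d, A c -> A' d ->
    smooth_on (c @` (dom c `&` f @^-1` dom d)) (d \o f \o chart_inv c).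

(** b lies in S^(k)B when k of its coordinates in some chart are nonzero. *)
Definition stratum (T : topologicalType) (n : nat) (A : set (chart R T n))
    (k : nat) : set T :=
  [set b | exists2 c, A c & dom c b /\ #|[set i | c b 0 i != 0]%SET| = k].

(** S^(n-1)B, empty when n = 0. *)
Definition facets (T : topologicalType) (n : nat) (A : set (chart R T n)) :
    set T :=
  \bigcup_(k in [set k | k.+1 = n]) stratum A k.

Definition is_component (T : topologicalType) (A C : set T) : Prop :=
  exists2 x, A x & C = connected_component A x.
End Manifolds.

(** * Symplectic forms *)

Section Symplectic.
Context {R : realType} {T : topologicalType} {m : nat}.

(** The matrix, at [x], of the pullback along [f] of a bilinear form with
    matrix [Om] at [f x]; a matrix [Om] stands for the form
    (v, w) |-> v *m Om *m w^T on row vectors. *)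
Definition pullback (f : 'rV[R]_m -> 'rV[R]_m) (x : 'rV[R]_m) (Om : 'M[R]_m) :
    'M[R]_m :=
  'J f x *m Om *m ('J f x)^T.

(** A two-form on a manifold is the family of its matrices in the charts of the
    atlas. *)
Definition symplectic_form (A : set (chart R T m))
    (om : chart R T m -> 'rV[R]_m -> 'M[R]_m) : Prop :=
  (forall c, A c ->
     smooth_on (c @` dom c) (om c) /\
     forall x, (c @` dom c) x ->
       [/\ (om c x)^T = - om c x,
           om c x \in unitmx
         & forall i j k,
             'D_(delta_mx 0 i) (fun y => om c y j k) x
             + 'D_(delta_mx 0 j) (fun y => om c y k i) x
             + 'D_(delta_mx 0 k) (fun y => om c y i j) x = 0]) /\
  (forall c d, A c -> A d -> forall x, (c @` (dom c `&` dom d)) x ->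
     om c x = pullback (d \o chart_inv c) x (om d ((d \o chart_inv c) x))).
End Symplectic.

(** * The standard model C^n = R^2n, with coordinates (x_1, .., x_n, y_1, .., y_n) *)

Section ComplexSpace.
Context {R : realType} {n : nat}.

Definition zcoord (z : 'rV[R]_(n + n)) (k : 'I_n) : R[i] :=
  Complex (z 0 (lshift n k)) (z 0 (rshift n k)).

Definition of_zcoord (f : 'I_n -> R[i]) : 'rV[R]_(n + n) :=
  row_mx (\row_k complex.Re (f k)) (\row_k complex.Im (f k)).

Lemma of_zcoordK f k : zcoord (of_zcoord f) k = f k.
Proof. by rewrite /zcoord row_mxEl row_mxEr !mxE; case: (f k). Qed.

Definition mu_C (z : 'rV[R]_(n + n)) : 'rV[R]_n :=
  \row_k Normc.normc (zcoord z k) ^+ 2.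

(** (1 / (2 pi sqrt(-1))) \sum_k dz_k /\ d(conj z_k), evaluated on (v, w). *)
Definition omega_C_form (v w : 'rV[R]_(n + n)) : R[i] :=
  (Complex 0 (2 * pi))^-1 *
  \sum_(k < n) (zcoord v k * (zcoord w k)^*%C - zcoord w k * (zcoord v k)^*%C).

(** The values of [omega_C_form] are real. *)
Definition omega_C : 'M[R]_(n + n) :=
  \matrix_(i, j) complex.Re (omega_C_form (delta_mx 0 i) (delta_mx 0 j)).
End ComplexSpace.

(** * The torus T^n and GL_n(Z) *)

Definition GLZ (n : nat) := {g : 'M[int]_n | g \in unitmx}.

Section GLZ.
Context {n : nat}.
Implicit Types g h : GLZ n.

Definition GL1 : GLZ n := exist _ 1%:M (unitmx1 _ _).

Definition GLmul g h : GLZ n :=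
  exist _ (sval g *m sval h)
    (etrans (unitmx_mul _ _) (introT andP (conj (svalP g) (svalP h)))).

Definition GLcontra g : GLZ n :=
  exist _ (invmx (sval g))^T
    (etrans (unitmx_tr _) (etrans (unitmx_inv _) (svalP g))).

Definition lattice_act g (l : 'rV[int]_n) : 'rV[int]_n := l *m (sval g)^T.
End GLZ.

Definition torus_set (R : realType) (n : nat) : set 'rV[R]_(n + n) :=
  [set z | forall k, Normc.normc (zcoord z k) = 1].
Arguments torus_set : clear implicits.

(** (S^1)^n inside C^n, with the subspace topology. *)
Definition torus (R : realType) (n : nat) : topologicalType :=
  set_type (torus_set R n).
Arguments torus : clear implicits.

Section Torus.
Context {R : realType} {n : nat}.
Implicit Types s t : torus R n.

Lemma torus_subproof (f : 'I_n -> R[i]) :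
  (forall k, Normc.normc (f k) = 1) ->
  of_zcoord f \in torus_set R n.
Proof. by move=> f1; apply/mem_set => k; rewrite of_zcoordK. Qed.

Definition mk_torus f (f1 : forall k, Normc.normc (f k) = 1) :
  torus R n := exist _ (of_zcoord f) (torus_subproof f1).

Definition tcoord t : 'I_n -> R[i] := zcoord (set_val t).

Lemma normc1E (z : R[i]) : (Normc.normc z = 1) <-> (`|z| = 1).
Proof.
have -> : `|z| = (Normc.normc z)%:C%C by [].
by split => [->//|[]].
Qed.

Lemma tcoord_norm t k : `|tcoord t k| = 1.
Proof.
by apply/normc1E; have /set_mem := svalP t; apply.
Qed.

Lemma torus_act_subproof (g : GLZ n) t i :
  Normc.normc (\prod_j tcoord t j ^ sval g i j) = 1.
Proof.
apply/normc1E; rewrite normr_prod big1// => j _.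
by case: (sval g i j) => N; rewrite /exprz ?normfV normrX tcoord_norm expr1n ?invr1.
Qed.

Definition torus_act (g : GLZ n) t : torus R n :=
  mk_torus (torus_act_subproof g t).

Lemma torus_div_subproof s t k :
  Normc.normc (tcoord s k / tcoord t k) = 1.
Proof. by apply/normc1E; rewrite normf_div !tcoord_norm divr1. Qed.

Definition torus_div s t : torus R n := mk_torus (torus_div_subproof s t).

Lemma torus_exp_subproof (v : 'rV[R]_n) k :
  Normc.normc
    (Complex (cos (2 * pi * v 0 k)) (sin (2 * pi * v 0 k))) = 1.
Proof. by rewrite /= cos2Dsin2 sqrtr1. Qed.

(** Normalized so that the kernel is the lattice Z^n. *)
Definition torus_exp (v : 'rV[R]_n) : torus R n :=
  mk_torus (torus_exp_subproof v).
End Torus.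

(** * Topological quotients *)

Section Quotient.
Local Open Scope quotient_scope.
Context {T : topologicalType}.
Variable r : T -> T -> Prop.

Definition generated_rel : rel T :=
  fun x y => `[< clos_refl_sym_trans T r x y >].

Lemma generated_rel_refl : reflexive generated_rel.
Proof. by move=> x; apply/asboolP; exact: rst_refl. Qed.

Lemma generated_rel_sym : symmetric generated_rel.
Proof.
by move=> x y; apply/asboolP/asboolP => h; exact: rst_sym.
Qed.

Lemma generated_rel_trans : transitive generated_rel.
Proof.
move=> y x z /asboolP xy /asboolP yz; apply/asboolP.
exact: (rst_trans _ _ _ _ _ xy yz).
Qed.

Definition generated_equiv : equiv_rel T :=
  EquivRel generated_rel
    generated_rel_refl generated_rel_sym generated_rel_trans.

(** The quotient by the equivalence relation generated by [r].  Each relation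
    used below is already an equivalence relation, by the cocycle condition for
    the linear parts of an integral affine structure; taking the generated
    relation only avoids having to prove this here. *)
Definition quot : topologicalType :=
  quotient_topology {eq_quot generated_equiv}.

Definition cls (x : T) : quot :=
  \pi_(quotient_topology {eq_quot generated_equiv}) x.

Definition rep (x : quot) : T :=
  repr (x : quotient_topology {eq_quot generated_equiv}).
End Quotient.

(** * Integral affine structures *)

(** [choiceType] is only a technicality: every type carries such a structure
    classically. *)
Record integral_affine (R : realType) (n : nat) (B : topologicalType)
    (AB : set (chart R B n)) (I : choiceType) := IntegralAffine {
  ia_chart : I -> chart R B n;
  ia_lin : I -> I -> GLZ n;
  ia_shift : I -> I -> 'rV[R]_n;
  ia_chartP : forall a, coordinate_chart (orthant R n) AB (ia_chart a);
  ia_cover : \bigcup_a dom (ia_chart a) = setT;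
  ia_overlap : forall a b xi,
    (ia_chart b @` (dom (ia_chart a) `&` dom (ia_chart b))) xi ->
    (ia_chart a \o chart_inv (ia_chart b)) xi =
      xi *m (map_mx intr (sval (ia_lin a b)))^T + ia_shift a b }.

Section CanonicalModel.
Context {R : realType} {n : nat} {B : topologicalType}.
Context {AB : set (chart R B n)} {I : choiceType}.
Variable S : integral_affine AB I.

Local Notation U a := (dom (ia_chart S a)).

(** The point (b, h) over U_a is the frame of T^*_b B whose j-th covector is
    \sum_i h i j d(phi_a)_i; the overlaps are glued by A_ab^-T. *)
Definition frame_pieces : topologicalType :=
  {a : I & (set_type (U a) * discrete_topology (GLZ n))%type}.

Definition frame_glue (x y : frame_pieces) : Prop :=
  set_val (projT2 x).1 = set_val (projT2 y).1 /\
  (projT2 x).2 =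
    GLmul (GLcontra (ia_lin S (projT1 x) (projT1 y))) (projT2 y).2.

Definition frame_bundle : topologicalType := quot frame_glue.

Definition mkP (a : I) (b : set_type (U a)) (h : GLZ n) : frame_bundle :=
  cls frame_glue (existT _ a (b, h : discrete_topology (GLZ n))).

(** The maps below that are defined through [rep] do not depend on the
    representative. *)
Definition P_act (p : frame_bundle) (g : GLZ n) : frame_bundle :=
  mkP (projT2 (rep p)).1 (GLmul (projT2 (rep p)).2 g).

Definition pi_P (p : frame_bundle) : B := set_val (projT2 (rep p)).1.

Section Associated.
Variables (F : topologicalType) (act : GLZ n -> F -> F).

(** The bundle with fibre F associated with P: the pairs (p g, f) and (p, g f)
    are identified. *)
Definition associated_rel (x y : (frame_bundle * F)%type) : Prop :=
  exists g, x.1 = P_act y.1 g /\ y.2 = act g x.2.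

Definition associated : topologicalType := quot associated_rel.

Definition mkA (p : frame_bundle) (f : F) : associated :=
  cls associated_rel (p, f).

Definition pi_A (x : associated) : B :=
  pi_P (rep x : (frame_bundle * F)%type).1.
End Associated.

Definition lattice_act_discrete (g : GLZ n)
    (l : discrete_topology 'rV[int]_n) : discrete_topology 'rV[int]_n :=
  lattice_act g l.

Definition Lambda_P : topologicalType := associated lattice_act_discrete.
Definition mkLambda (p : frame_bundle) (l : 'rV[int]_n) : Lambda_P :=
  mkA lattice_act_discrete p (l : discrete_topology 'rV[int]_n).
Definition pi_Lambda (x : Lambda_P) : B := pi_A x.

Definition T_P : topologicalType := associated (@torus_act R n).
Definition mkT (p : frame_bundle) (t : torus R n) : T_P :=
  mkA (@torus_act R n) p t.
Definition pi_T (x : T_P) : B := pi_A x.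

Definition pairing (xi : 'rV[R]_n) (u : 'rV[int]_n) : R :=
  \sum_i xi 0 i * (u 0 i)%:~R.

Definition primitive (u : 'rV[int]_n) : Prop :=
  forall (k : int) (v : 'rV[int]_n), u = k *: v -> k \is a GRing.unit.

(** [u] is the vector u_a attached to the component [C] of U_a and S^(n-1)B. *)
Definition facet_vector (a : I) (C : set B) (u : 'rV[int]_n) : Prop :=
  [/\ primitive u,
      forall x, U a x -> 0 <= pairing (ia_chart S a x) u
    & forall x, C x -> pairing (ia_chart S a x) u = 0].

Definition char_L : set Lambda_P :=
  [set l | exists (a : I) (C : set B) (u : 'rV[int]_n)
             (b : set_type (U a)) (k : int),
     [/\ is_component (U a `&` facets AB) C, facet_vector a C u,
         C (set_val b) & l = mkLambda (mkP b GL1) (k *: u)]].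

(** The sublattices L_1, ..., L_(n-k) of the fibre of Lambda_P over a point [b]
    of S^(k)B.  The local components of S^(n-1)B near [b] are the components [C]
    of U_a and S^(n-1)B that have [b] in their closure; since Lambda_P is a
    covering of B, the fibre over [b] of the closure of the restriction of L to
    [C] is the limit of this restriction at [b]. *)
Definition local_sublattice (b : B) (L : set Lambda_P) : Prop :=
  exists (a : I) (C : set B),
    [/\ U a b, is_component (U a `&` facets AB) C, closure C b
      & L = closure (char_L `&` pi_Lambda @^-1` C) `&` pi_Lambda @^-1` [set b]].

(** The subtorus Z_b: the image under the exponential map of the real span of
    the local sublattices. *)
Definition subtorus (b : B) : set T_P :=
  [set t | exists (p : frame_bundle) (N : nat)
             (s : 'I_N -> R) (l : 'I_N -> 'rV[int]_n),
     [/\ pi_P p = b,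
         forall i, exists2 L, local_sublattice b L & L (mkLambda p (l i))
       & t = mkT p (torus_exp (\sum_i s i *: map_mx intr (l i)))]].

Definition X_rel (t t' : T_P) : Prop :=
  exists p s s',
    [/\ t = mkT p s, t' = mkT p s'
      & subtorus (pi_P p) (mkT p (torus_div s' s))].

Definition X_PL : topologicalType := quot X_rel.

Definition mu_X (x : X_PL) : B := pi_T (rep x).
End CanonicalModel.

(** * Locally toric Lagrangian fibrations *)

(** A symplectomorphism from the preimage of U onto the open subset
    mu_C^-1(phi(U)) of C^n is a chart [F] of X in which the form is omega_C. *)
Definition locally_toric_Lagrangian_fibration (R : realType) (n : nat)
    (B X : topologicalType) (AB : set (chart R B n))
    (AX : set (chart R X (n + n)))
    (om : chart R X (n + n) -> 'rV[R]_(n + n) -> 'M[R]_(n + n))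
    (mu : X -> B) : Prop :=
  smooth_map AX AB mu /\
  forall b, exists (phi : chart R B n) (F : chart R X (n + n)),
    [/\ coordinate_chart (orthant R n) AB phi /\ dom phi b,
        coordinate_chart setT AX F,
        dom F = mu @^-1` dom phi /\
        F @` dom F = mu_C @^-1` (phi @` dom phi),
        forall d x, AX d -> (d @` (dom d `&` dom F)) x ->
          om d x = pullback (F \o chart_inv d) x omega_C
      & forall x, dom F x -> mu_C (F x) = phi (mu x)].

(* Main.v *)
Require Import Defs.
From HB Require Import structures.
From Stdlib Require Import Relation_Operators.
From mathcomp Require Import all_boot all_order all_algebra.
From mathcomp Require Import generic_quotient complex ring lra.
From mathcomp Require Import all_classical all_reals all_analysis.

Set Implicit Arguments.
Unset Strict Implicit.
Unset Printing Implicit Defensive.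

Import Order.TTheory GRing.Theory Num.Theory.
Import numFieldNormedType.Exports.

Local Open Scope classical_set_scope.
Local Open Scope ring_scope.

(** Over an affine chart [phi_a] the bundle T_P is the product of U_a and the
    torus, and the map (b, t) |-> z with z_k = sqrt (phi_a(b)_k) * t_k
    identifies the points that differ by a rotation of the coordinates t_k with
    phi_a(b)_k = 0. These rotations are exactly the collapsing torus Z_b
    ([subtorusP]), so z descends to an injective map [X_coord] from the part of
    X over U_a to C^n, with mu_C o z = phi_a o mu. All these maps are taken as
    charts of X, and in each of them the symplectic form is the constant omega_C.
    The local model of a locally toric Lagrangian fibration is then built in, and
    four things remain.

    The collapsing torus. It is defined by limits of the covectors conormal to
    the facets of B, where the facets are those of the smooth structure, and
    these covectors come from arbitrary affine charts. The number of vanishing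
    coordinates of a point does not depend on the chart, since the derivatives of
    transition maps match the tangent cones of the orthant
    ([transition_zeros]). Hence the facets can be read off in any affine chart
    ([facetsP]). A covector that is constant on a piece of the i-th facet is a
    multiple of the i-th basis vector ([constant_on_cell]), and conversely each
    such basis vector arises ([facet_vector_delta]).

    Topology. [X_coord] is continuous for the quotient topology because local
    trivializations are. Its inverse is continuous because the torus is compact:
    if the values z converge, then the base points converge, and every limit of
    the angles represents the same point of X ([X_coord_inverse_near]).

    Smoothness. A coordinate change multiplies the actions by an integral matrix
    A, up to a translation, and the angles by the contragredient of A. Near a
    point x, the tangent cones force A to match the coordinates that vanish at x
    in one chart with those that vanish in the other ([transition_facets]). So a
    coordinate that vanishes at x is carried to the matching one, times a
    monomial in the phases of the coordinates that do not vanish at x; the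
    others are square roots of positive functions, times such monomials
    ([X_coord_change_near]).

    The form. In the polar coordinates (xi, theta) the form is a multiple of the
    sum of the d xi_k /\ d theta_k, which A and its contragredient preserve
    ([symplectic_of_action_angle]). Polar coordinates only exist where no
    coordinate vanishes, but these points are dense and the pullback of the form
    is continuous ([symplectic_of_dense]). *)

(** * Differential calculus of smooth functions on R^m *)

Lemma mean_value_line {R : realType} {m} (f : 'rV[R]_m -> R) p v (a : R) :
  (forall t : R, `|t| <= `|a| -> derivable f (t *: v + p) v) ->
  exists2 t : R, `|t| <= `|a| &
    f (a *: v + p) - f p = a * 'D_v f (t *: v + p).
Proof.
move=> df; pose g (t : R) := f (t *: v + p).
have quotE t : (fun h : R => h^-1 *: ((g \o shift t) (h *: (1 : R)) - g t)) =
    (fun h : R => h^-1 *: ((f \o shift (t *: v + p)) (h *: v) - f (t *: v + p))).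
  by apply/funext => h; rewrite /g /= [h *: 1]mulr1 scalerDl addrA.
have dg (t : R) : `|t| <= `|a| -> is_derive (t : R) (1 : R) g ('D_v f (t *: v + p)).
  move=> /df; rewrite /derivable => dft.
  by apply: DeriveDef; rewrite /derivable /derive quotE.
have cg (b c : R) : `|b| <= `|a| -> `|c| <= `|a| -> {within `[b, c], continuous g}.
  move=> ba ca; apply: derivable_within_continuous => t.
  rewrite in_itv /= => /andP[bt tc]; have [|//] := dg t.
  by move: ba ca; rewrite !ler_norml => /andP[? ?] /andP[? ?]; lra.
have [a0|a0] := leP 0 a.
  have [| |t] := @MVT_segment R g (fun t => 'D_v f (t *: v + p)) 0 a a0.
  - move=> t; rewrite in_itv /= => /andP[t0 ta]; apply: dg.
    by rewrite !ger0_norm// ltW.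
  - by apply: cg; rewrite ?normr0.
  rewrite in_itv /= => /andP[t0 ta] e; exists t; first by rewrite !ger0_norm.
  by move: e; rewrite /g scale0r add0r subr0 mulrC.
have [| |t] := @MVT_segment R g (fun t => 'D_v f (t *: v + p)) a 0 (ltW a0).
- move=> t; rewrite in_itv /= => /andP[t0 ta]; apply: dg.
  by rewrite !ler0_norm ?lerN2// ltW.
- by apply: cg; rewrite ?normr0.
rewrite in_itv /= => /andP[t0 ta] e.
exists t; first by rewrite !ler0_norm ?lerN2 // ltW.
by apply: oppr_inj; rewrite opprB; move: e; rewrite /g scale0r add0r sub0r mulrN mulrC => ->.
Qed.

Lemma coord_le_norm {R : realType} {m} (x : 'rV[R]_m) i : `|x 0 i| <= `|x|.
Proof.
rewrite [leRHS]/Num.Def.normr/= mx_normrE.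
by apply: le_trans; last exact: (le_bigmax _ _ (0, i)).
Qed.

Lemma norm_le_coord {R : realType} {m} (x : 'rV[R]_m) (e : R) : 0 <= e ->
  (forall i, `|x 0 i| <= e) -> `|x| <= e.
Proof.
move=> e0 xe; rewrite [leLHS]/Num.Def.normr/= mx_normrE.
by apply/bigmax_leP; split => // -[i j] _; rewrite (ord1 i).
Qed.

(** Moving from [x] to [x + h] one coordinate at a time, the mean value theorem
    bounds each increment; the partial derivatives at the intermediate points are
    close to those at [x]. *)
Lemma differentiable_C1 {R : realType} {m} (f : 'rV[R]_m -> R) x :
  (forall i, \forall y \near x, derivable f y (delta_mx 0 i)) ->
  (forall i, {for x, continuous ('D_(delta_mx 0 i) f)}) ->
  differentiable f x.
Proof.
move=> df cf.
pose L (h : 'rV[R]_m) : R := \sum_k h 0 k * 'D_(delta_mx 0 k) f x.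
have linL : linear L.
  move=> a u v; rewrite /L scaler_sumr -big_split /=; apply: eq_bigr => k _.
  by rewrite !mxE mulrDl -mulrA.
pose LM := GRing.isLinear.Build _ _ _ _ _ linL.
pose LL : {linear _ -> _} := HB.pack L LM.
have cL : continuous LL.
  move=> /= y; apply: (@differentiable_continuous _ _ _ y L).
  have -> : L = \sum_k (fun h : 'rV[R]_m => h 0 k * 'D_(delta_mx 0 k) f x).
    by apply/funext => h; rewrite /L fct_sumE.
  apply: differentiable_sum => k.
  apply: differentiableM => //; exact: differentiable_coord.
suff fL : f \o shift x = cst (f x) + LL +o_ (0 : 'rV[R]_m) id.
  have dL := diff_unique cL fL.
  by apply/diff_locallyP; rewrite dL.
apply/eqaddoP => _/posnumP[e].
pose e' := e%:num / m.+1%:R.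
have e'0 : 0 < e' by rewrite divr_gt0.
have /nbhs_ballP[d d0 dP] : nbhs x [set y | forall i,
    derivable f y (delta_mx 0 i) /\
    `|'D_(delta_mx 0 i) f x - 'D_(delta_mx 0 i) f y| < e'].
  have Q i : nbhs x [set y | derivable f y (delta_mx 0 i) /\
      `|'D_(delta_mx 0 i) f x - 'D_(delta_mx 0 i) f y| < e'].
    apply: filterI; first exact: df.
    by move/cvgrPdist_lt : (cf i); apply.
  exact: (filter_forall (nbhs_filter x) Q).
near=> h.
have hd : `|h| < d.
  by near: h; apply/nbhs_ballP; exists d => //= y; rewrite -ball_normE /= sub0r normrN.
rewrite /= -![(_ + _ : _ -> _) _]/(_ + _) -![(- _ : _ -> _) _]/(- _) /=.
(* The point reached after the first [j] coordinates have been moved. *)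
pose pt j : 'rV[R]_m := x + \row_i (if (i < j)%N then h 0 i else 0).
have ptS (j : 'I_m) : pt j.+1 = h 0 j *: delta_mx 0 j + pt j.
  apply/rowP => i; rewrite /pt !mxE addrCA; congr (_ + _).
  rewrite eqxx /= ltnS leq_eqVlt -val_eqE /=; case: eqVneq => [ij|ij] /=.
    by rewrite ij ltnn addr0 mulr1; congr (h _ _); exact: val_inj.
  by rewrite mulr0 add0r.
have ptm : pt m = h + x.
  by apply/rowP => i; rewrite /pt !mxE ltn_ord addrC.
have pt0 : pt 0%N = x by apply/rowP => i; rewrite /pt !mxE addr0.
have ptb (j : 'I_m) (t : R) : `|t| <= `|h 0 j| -> ball x d (t *: delta_mx 0 j + pt j).
  move=> tj; rewrite -ball_normE /=; apply: le_lt_trans hd.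
  apply: norm_le_coord => // i; rewrite /pt !mxE eqxx /=.
  apply: le_trans (coord_le_norm _ i).
  case: eqVneq => [->|ij]; first by rewrite ltnn addr0 mulr1 opprD addrCA subrr addr0 normrN.
  rewrite mulr0 add0r opprD addrA subrr sub0r normrN; case: ifP => // _.
  by rewrite normr0.
have step (j : 'I_m) : `|f (pt j.+1) - f (pt j) - h 0 j * 'D_(delta_mx 0 j) f x|
    <= `|h| * e'.
  rewrite ptS.
  have [|t th ->] := @mean_value_line R m f (pt j) (delta_mx 0 j) (h 0 j).
    by move=> t tj; exact: (dP _ (ptb j t tj) j).1.
  rewrite -mulrBr normrM; apply: ler_pM => //; first exact: coord_le_norm.
  by rewrite distrC ltW//; exact: (dP _ (ptb j t th) j).2.
have -> : f (h + x) - (f x + L h) =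
    \sum_(j < m) (f (pt j.+1) - f (pt j) - h 0 j * 'D_(delta_mx 0 j) f x).
  rewrite sumrB; rewrite opprD addrA; congr (_ - _).
  rewrite -(big_mkord xpredT (fun j => f (pt j.+1) - f (pt j))).
  by rewrite telescope_sumr// ptm pt0.
apply: le_trans (ler_norm_sum _ _ _) _.
apply: le_trans (ler_sum _ (fun j _ => step j)) _.
rewrite sumr_const card_ord -[_ *+ m]mulr_natr -mulrA mulrC ler_wpM2r//.
rewrite /e' -mulrA -[leRHS]mulr1 ler_wpM2l//.
by rewrite mulrC ler_pdivrMr // mul1r ler_nat.
Unshelve. all: by end_near. Qed.

(** The recursion peels off the innermost derivative, so that closure properties
    can be proved by induction on [r]: a rule such as Leibniz's expresses the
    first derivative through functions of class [r]. [smooth_openP] transfers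
    them to smooth functions. *)
Fixpoint Cr {R : realType} {m} {W : normedModType R} (r : nat)
    (U : set 'rV[R]_m) (f : 'rV[R]_m -> W) : Prop :=
  (forall x, U x -> {for x, continuous f}) /\
  if r is r'.+1 then
    forall i, (forall x, U x -> derivable f x (delta_mx 0 i)) /\
              Cr r' U ('D_(delta_mx 0 i) f)
  else True.

Section CrBasic.
Context {R : realType} {m : nat} {W : normedModType R}.
Implicit Types (U V : set 'rV[R]_m) (f g : 'rV[R]_m -> W).

Lemma Cr_continuous r U f x : Cr r U f -> U x -> {for x, continuous f}.
Proof. by case: r => [|r] /= [cf _]; apply: cf. Qed.

Lemma smooth_openP U f : smooth_open U f <-> forall r, Cr r U f.
Proof.
have rconsE s i g : iterated_partial (rcons s i) g =
    iterated_partial s ('D_(delta_mx 0 i) g).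
  by rewrite /iterated_partial foldr_rcons.
split=> [+ r|].
  elim: r f => [|r IH] f sf /=; first by split => // x Ux; exact: (sf [::] x Ux).1.
  split => [x Ux|i]; first exact: (sf [::] x Ux).1.
  split => [x Ux|]; first by have [_] := sf [::] x Ux; apply.
  by apply: IH => s x Ux; rewrite -rconsE; exact: sf.
move=> + s; elim/last_ind: s f => [|s i IH] f Cf x Ux.
  split; first exact: Cr_continuous (Cf 0%N) Ux.
  by move=> i; have [_ /(_ i)[+ _]] := Cf 1%N; apply.
by rewrite rconsE; apply: IH => // r; have [_ /(_ i)[]] := Cf r.+1.
Qed.

Lemma CrW r U f : Cr r.+1 U f -> Cr r U f.
Proof.
elim: r f => [|r IH] f [cf df]; first by split.
by split => // i; split; [exact: (df i).1|apply: IH; exact: (df i).2].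
Qed.

Lemma Cr_sub r U V f : V `<=` U -> Cr r U f -> Cr r V f.
Proof.
move=> VU; elim: r f => [|r IH] f [cf df].
  by split => // x /VU; exact: cf.
split => [x /VU|i]; first exact: cf.
by split => [x /VU|]; [exact: (df i).1|apply: IH; exact: (df i).2].
Qed.

Lemma Cr_ext r U f g : open U -> {in U, f =1 g} -> Cr r U f -> Cr r U g.
Proof.
move=> oU; have nearU x h k : U x -> {in U, h =1 k :> ('rV[R]_m -> W)} ->
    \forall y \near x, h y = k y.
  move=> Ux hk; have : nbhs x U by exact: open_nbhs_nbhs.
  by apply: filterS => y Uy; apply: hk; rewrite inE.
have ext0 (h k : 'rV[R]_m -> W) : {in U, h =1 k} -> (forall x, U x -> {for x, continuous h}) ->
    forall x, U x -> {for x, continuous k}.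
  move=> hk ch x Ux; rewrite /prop_for /continuous_at -(hk x) ?inE//.
  have kh : {in U, k =1 h} by move=> y Uy; rewrite hk.
  exact: cvg_trans (near_eq_cvg (nearU x h k Ux hk)) (ch x Ux).
elim: r f g => [|r IH] f g fg [cf df].
  by split => //; exact: ext0 fg cf.
split; first exact: ext0 fg cf.
move=> i; split => [x Ux|].
  by apply: near_eq_derivable ((df i).1 x Ux); exact: (nearU x).
apply: IH (df i).2 => x /set_mem Ux; apply: near_eq_derive; exact: nearU.
Qed.

Lemma Cr_cst r U (w : W) : Cr r U (cst w).
Proof.
have cw (v : W) x : U x -> {for x, continuous (cst v : 'rV[R]_m -> W)}.
  by move=> _; exact: cst_continuous.
elim: r w => [|r IH] w; split => //; [exact: cw|exact: cw|].
move=> i; split => [x _|]; first exact: derivable_cst.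
have -> : 'D_(delta_mx 0 i) (cst w : 'rV[R]_m -> W) = cst 0.
  by apply/funext => x; rewrite derive_cst.
exact: IH.
Qed.

Lemma Cr_add r U f g : open U -> Cr r U f -> Cr r U g ->
  Cr r U (fun x => f x + g x).
Proof.
move=> oU; elim: r f g => [|r IH] f g [cf df] [cg dg].
  by split => // x Ux; exact: (cvgD (cf x Ux) (cg x Ux)).
split => [x Ux|i]; first exact: (cvgD (cf x Ux) (cg x Ux)).
split => [x Ux|].
  by apply: (derivableD ((df i).1 x Ux) ((dg i).1 x Ux)).
apply: Cr_ext (IH _ _ (df i).2 (dg i).2) => // x /set_mem Ux.
by rewrite (deriveD ((df i).1 x Ux) ((dg i).1 x Ux)).
Qed.

End CrBasic.

Section CrScalar.
Context {R : realType} {m : nat}.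
Implicit Types (U V : set 'rV[R]_m) (f g : 'rV[R]_m -> R).

Lemma Cr_coord r U i : Cr r U (fun x : 'rV[R]_m => x 0 i).
Proof.
have cc x : {for x, continuous (fun x : 'rV[R]_m => x 0 i)} by exact: coord_continuous.
case: r => [|r]; split => // j.
have D x : is_derive x (delta_mx 0 j) (fun x : 'rV[R]_m => x 0 i)
    ((delta_mx 0 j : 'rV[R]_m) 0 i).
  have df : differentiable (fun x : 'rV[R]_m => x 0 i) x.
    exact: differentiable_coord.
  apply: DeriveDef; first exact: diff_derivable.
  pose L (y : 'rV[R]_m) : R := y 0 i.
  have linL : linear L by move=> a u v; rewrite /L !mxE.
  pose LM := GRing.isLinear.Build _ _ _ _ _ linL.
  pose LL : {linear _ -> _} := HB.pack L LM.
  rewrite deriveE// (_ : (fun x : 'rV[R]_m => x 0 i) = LL)//.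
  by rewrite diff_lin // => y; exact: coord_continuous.
split => [x _|]; first by have [] := D x.
have -> : 'D_(delta_mx 0 j) (fun x : 'rV[R]_m => x 0 i) =
    cst ((delta_mx 0 j : 'rV[R]_m) 0 i).
  by apply/funext => x; have [_ ->] := D x.
exact: Cr_cst.
Qed.

Lemma Cr_mul r U f g : open U -> Cr r U f -> Cr r U g ->
  Cr r U (fun x => f x * g x).
Proof.
move=> oU; elim: r f g => [|r IH] f g Cf Cg.
  split => // x Ux.
  exact: (cvgM (Cr_continuous Cf Ux) (Cr_continuous Cg Ux)).
split => [x Ux|i].
  exact: (cvgM (Cr_continuous Cf Ux) (Cr_continuous Cg Ux)).
have [_ /(_ i)[df Cdf]] := Cf; have [_ /(_ i)[dg Cdg]] := Cg.
split => [x Ux|]; first exact: (derivableM (df x Ux) (dg x Ux)).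
have Cs := Cr_add oU (IH _ _ (CrW Cf) Cdg) (IH _ _ (CrW Cg) Cdf).
apply: Cr_ext Cs => // x /set_mem Ux.
by rewrite (deriveM (df x Ux) (dg x Ux)).
Qed.

Lemma Cr_sum r U n (f : 'I_n -> 'rV[R]_m -> R) : open U ->
  (forall i, Cr r U (f i)) -> Cr r U (fun x => \sum_i f i x).
Proof.
move=> oU; elim: n f => [|n IH] f Cf.
  by apply: Cr_ext (Cr_cst r U 0) => // x _; rewrite big_ord0.
apply: Cr_ext (Cr_add oU (Cf ord0) (IH _ (fun i => Cf (lift ord0 i)))) => // x _.
by rewrite big_ord_recl.
Qed.

Lemma Cr_differentiable r U f x : open U -> Cr r.+1 U f -> U x ->
  differentiable f x.
Proof.
move=> oU [cf df] Ux; apply: differentiable_C1 => i.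
  have : nbhs x U by exact: open_nbhs_nbhs.
  by apply: filterS => y Uy; exact: (df i).1.
exact: Cr_continuous (df i).2 Ux.
Qed.

Lemma Cr_inv r U f : open U -> (forall x, U x -> f x != 0) -> Cr r U f ->
  Cr r U (fun x => (f x)^-1).
Proof.
move=> oU f0; elim: r => [|r IH] Cf.
  by split => // x Ux; exact: (cvgV (f0 x Ux) (Cr_continuous Cf Ux)).
split => [x Ux|i]; first exact: (cvgV (f0 x Ux) (Cr_continuous Cf Ux)).
have [_ /(_ i)[df Cdf]] := Cf; have CV := IH (CrW Cf).
split => [x Ux|]; first exact: (derivableV (f0 x Ux) (df x Ux)).
have := Cr_mul oU (Cr_mul oU (Cr_cst r U (- 1 : R)) (Cr_mul oU CV CV)) Cdf.
apply: Cr_ext => // x /set_mem Ux.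
rewrite (deriveV (f0 x Ux) (df x Ux)) /= mulN1r.
by rewrite -[in RHS]exprVn expr2.
Qed.

End CrScalar.

Lemma continuous_rV {R : realType} {T : topologicalType} {k} (g : T -> 'rV[R]_k) x :
  (forall j, {for x, continuous (fun y => g y 0 j)}) -> {for x, continuous g}.
Proof.
move=> cg; apply/cvgrPdist_le => e e0.
have Q j : nbhs x [set y | `|g x 0 j - g y 0 j| <= e].
  by move/cvgrPdist_le : (cg j); apply.
have := filter_forall (nbhs_filter x) Q; apply: filterS => y ge.
by apply: norm_le_coord => [|i]; [exact: ltW|rewrite !mxE; exact: ge].
Qed.

Lemma derive_rowE {R : realType} {k} (f : 'rV[R]_k -> R) y w :
  differentiable f y -> 'D_w f y = \sum_j w 0 j * 'D_(delta_mx 0 j) f y.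
Proof.
move=> df; rewrite deriveE // [in LHS](row_sum_delta w) linear_sum.
by apply: eq_bigr => j _; rewrite linearZ deriveE.
Qed.

Lemma differentiable_rV {R : realType} {V : normedModType R} {k} (g : V -> 'rV[R]_k) x :
  (forall j, differentiable (fun y => g y 0 j) x) -> differentiable g x.
Proof.
move=> dg; have -> : g = \sum_(j < k) (fun y => g y 0 j *: delta_mx 0 j).
  by apply/funext => y; rewrite fct_sumE [LHS]row_sum_delta.
by apply: differentiable_sum => j; exact: differentiableZl.
Qed.

Lemma derive_coord {R : realType} {V : normedModType R} {k} (g : V -> 'rV[R]_k) x v j :
  derivable g x v -> ('D_v g x) 0 j = 'D_v (fun y => g y 0 j) x.
Proof. by move=> dg; rewrite derive_mx // mxE. Qed.

Lemma derive_compE {R : realType} {V : normedModType R} {k} (f : 'rV[R]_k -> R)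
    (g : V -> 'rV[R]_k) x v :
  (forall j, differentiable (fun y => g y 0 j) x) -> differentiable f (g x) ->
  'D_v (fun y => f (g y)) x =
    \sum_j 'D_v (fun y => g y 0 j) x * 'D_(delta_mx 0 j) f (g x).
Proof.
move=> dg df; have dg' := differentiable_rV dg.
have dfg : differentiable (f \o g) x by exact: differentiable_comp.
have -> : (fun y => f (g y)) = f \o g by [].
rewrite deriveE // diff_comp //= -deriveE // -deriveE // derive_rowE //.
by apply: eq_bigr => j _; rewrite derive_coord //; exact: diff_derivable.
Qed.

Lemma Cr_comp {R : realType} {m k} r (U : set 'rV[R]_m) (V : set 'rV[R]_k)
    (f : 'rV[R]_k -> R) (g : 'rV[R]_m -> 'rV[R]_k) :
  open U -> open V -> (forall x, U x -> V (g x)) ->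
  Cr r V f -> (forall j, Cr r U (fun x => g x 0 j)) ->
  Cr r U (fun x => f (g x)).
Proof.
move=> oU oV gUV.
have C0 q (h : 'rV[R]_k -> R) : Cr q V h -> (forall j, Cr q U (fun x => g x 0 j)) ->
    forall x, U x -> {for x, continuous (fun x => h (g x))}.
  move=> Ch Cg x Ux; apply: (@continuous_comp _ _ _ g h).
    by apply: continuous_rV => j; exact: Cr_continuous (Cg j) Ux.
  exact: Cr_continuous Ch (gUV _ Ux).
elim: r f => [|r IH] f Cf Cg; first by split => // x Ux; exact: (C0 0%N f Cf Cg x Ux).
split => [x Ux|i]; first exact: (C0 r.+1 f Cf Cg x Ux).
have dg j x : U x -> differentiable (fun y => g y 0 j) x.
  by move=> Ux; exact: Cr_differentiable (Cg j) Ux.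
have df x : U x -> differentiable f (g x).
  by move=> Ux; apply: Cr_differentiable Cf (gUV _ Ux).
split => [x Ux|].
  apply: diff_derivable; apply: (@differentiable_comp _ _ _ _ g f).
    by apply: differentiable_rV => j; exact: dg.
  exact: df.
have Cs : Cr r U (fun x => \sum_j 'D_(delta_mx 0 i) (fun y => g y 0 j) x *
    'D_(delta_mx 0 j) f (g x)).
  apply: Cr_sum => // j; apply: Cr_mul => //.
    by have [_ /(_ i)[]] := Cg j.
  have [_ /(_ j)[_ Cdf]] := Cf.
  by apply: (IH _ Cdf) => j'; exact: CrW (Cg j').
apply: Cr_ext Cs => // x /set_mem Ux.
by rewrite derive_compE //; [move=> j; exact: dg|exact: df].
Qed.

Lemma Cr_sqrt {R : realType} {m} r (U : set 'rV[R]_m) (f : 'rV[R]_m -> R) :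
  open U -> (forall x, U x -> 0 < f x) -> Cr r U f ->
  Cr r U (fun x => Num.sqrt (f x)).
Proof.
move=> oU f0; have C0 q : Cr q U f -> forall x, U x ->
    {for x, continuous (fun x => Num.sqrt (f x))}.
  move=> Cf x Ux; apply: (@continuous_comp _ _ _ f Num.sqrt).
    exact: Cr_continuous Cf Ux.
  exact: sqrt_continuous.
elim: r => [|r IH] Cf; first by split => // x Ux; exact: (C0 0%N Cf x Ux).
split => [x Ux|i]; first exact: (C0 r.+1 Cf x Ux).
have df x : U x -> differentiable f x by move=> Ux; exact: Cr_differentiable Cf Ux.
have ds x : U x -> differentiable (@Num.sqrt R) (f x).
  by move=> Ux; apply/derivable1_diffP; have [] := is_derive1_sqrt (f0 x Ux).
have dsf x : U x -> differentiable (Num.sqrt \o f) x.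
  by move=> Ux; apply: differentiable_comp; [exact: df|exact: ds].
split => [x Ux|]; first exact: diff_derivable (dsf x Ux).
have Cs := IH (CrW Cf).
have C2s := Cr_mul oU (Cr_cst r U (2 : R)) Cs.
have n0 x : U x -> (2 : R) * Num.sqrt (f x) != 0.
  by move=> Ux; rewrite mulf_neq0// gt_eqF// sqrtr_gt0 f0.
have [_ /(_ i)[_ Cdf]] := Cf.
apply: Cr_ext (Cr_mul oU Cdf (Cr_inv oU n0 C2s)) => // x /set_mem Ux.
rewrite /= [RHS](_ : _ = 'D_(delta_mx 0 i) (Num.sqrt \o f) x)//.
rewrite [RHS]deriveE; last exact: dsf.
rewrite diff_comp; [|exact: df|exact: ds].
rewrite /= diff1E; last exact: ds.
by rewrite derive1E derive_sqrt ?f0// -deriveE //; exact: df.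
Qed.

Lemma Cr_rVP {R : realType} {m k} r (U : set 'rV[R]_m) (g : 'rV[R]_m -> 'rV[R]_k) :
  open U -> Cr r U g <-> forall j, Cr r U (fun x => g x 0 j).
Proof.
move=> oU; elim: r g => [|r IH] g; split.
- move=> [cg _] j; split => // x Ux.
  exact: (@continuous_comp _ _ _ g (fun y => y 0 j) _ (cg x Ux) (@coord_continuous _ _ _ _ _ _)).
- move=> Cg; split => // x Ux; apply: continuous_rV => j.
  exact: Cr_continuous (Cg j) Ux.
- move=> [cg dg] j; split => [x Ux|i].
    exact: (@continuous_comp _ _ _ g (fun y => y 0 j) _ (cg x Ux) (@coord_continuous _ _ _ _ _ _)).
  have [dgi Cdg] := dg i; split => [x Ux|]; first exact: (derivable_mxP _ _ _).1 (dgi x Ux) _ _.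
  apply: Cr_ext ((IH _).1 Cdg j) => // x /set_mem Ux.
  by rewrite derive_coord //; exact: dgi.
- move=> Cg; split => [x Ux|i].
    by apply: continuous_rV => j; exact: Cr_continuous (Cg j) Ux.
  have dgi x : U x -> derivable g x (delta_mx 0 i).
    move=> Ux; apply/derivable_mxP => a j; rewrite (ord1 a).
    by have [_ /(_ i)[]] := Cg j => + _; apply.
  split=> //; apply/IH => j; have [_ /(_ i)[_]] := Cg j.
  by apply: Cr_ext => // x /set_mem Ux; rewrite derive_coord //; exact: dgi.
Qed.

Lemma smooth_open_rVP {R : realType} {m k} (U : set 'rV[R]_m)
    (g : 'rV[R]_m -> 'rV[R]_k) : open U ->
  smooth_open U g <-> forall j, smooth_open U (fun x => g x 0 j).
Proof.
move=> oU; split => [/smooth_openP sg j|sg].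
  by apply/smooth_openP => r; exact: (Cr_rVP _ _ oU).1.
by apply/smooth_openP => r; apply/(Cr_rVP _ _ oU) => j; have /smooth_openP := sg j.
Qed.

Lemma smooth_open_differentiable {R : realType} {m k} (U : set 'rV[R]_m)
    (g : 'rV[R]_m -> 'rV[R]_k) x j : open U -> smooth_open U g -> U x ->
  differentiable (fun x => g x 0 j) x.
Proof.
move=> oU /(smooth_open_rVP _ oU) /(_ j) /smooth_openP sg Ux.
exact: Cr_differentiable oU (sg 1%N) Ux.
Qed.

Lemma smooth_open_comp {R : realType} {m k l} (U : set 'rV[R]_m)
    (V : set 'rV[R]_k) (f : 'rV[R]_k -> 'rV[R]_l) (g : 'rV[R]_m -> 'rV[R]_k) :
  open U -> open V -> (forall x, U x -> V (g x)) ->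
  smooth_open V f -> smooth_open U g -> smooth_open U (f \o g).
Proof.
move=> oU oV gUV /(smooth_open_rVP _ oV) sf /(smooth_open_rVP _ oU) sg.
apply/(smooth_open_rVP _ oU) => j; apply/smooth_openP => r.
have /smooth_openP sfj := sf j.
by apply: (Cr_comp oU oV gUV (sfj r)) => i; have /smooth_openP := sg i.
Qed.

Lemma smooth_open_continuous {R : realType} {m} {W : normedModType R}
    (U : set 'rV[R]_m) (g : 'rV[R]_m -> W) x :
  smooth_open U g -> U x -> {for x, continuous g}.
Proof. by move=> sg Ux; have [] := sg [::] x Ux. Qed.

Lemma smooth_open_sub {R : realType} {m} {W : normedModType R}
    (U V : set 'rV[R]_m) (g : 'rV[R]_m -> W) :
  V `<=` U -> smooth_open U g -> smooth_open V g.
Proof. by move=> VU sg s x /VU; exact: sg. Qed.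

Lemma smooth_on_comp {R : realType} {m k l} (D : set 'rV[R]_m)
    (E : set 'rV[R]_k) (f : 'rV[R]_k -> 'rV[R]_l) (g : 'rV[R]_m -> 'rV[R]_k)
    (h : 'rV[R]_m -> 'rV[R]_l) :
  smooth_open setT g -> smooth_on E f -> (forall x, D x -> E (g x)) ->
  (forall x, D x -> h x = f (g x)) -> smooth_on D h.
Proof.
move=> sg sf DE hfg x Dx; have [V [f' [oV Vx sf' f'f]]] := sf _ (DE _ Dx).
have oU : open (g @^-1` V).
  apply: open_comp => // y _; exact: (@smooth_open_continuous R m _ setT g).
exists (g @^-1` V), (f' \o g); split => //.
  by apply: smooth_open_comp sf' _ => //; exact: smooth_open_sub sg.
by move=> y Vy Dy; rewrite /= f'f ?hfg//; exact: DE.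
Qed.

(** * Tangent cones of the orthant and the invariance of the strata *)

(** A sum of nonnegative terms vanishes only termwise; so a pair of mutually
    inverse matrices that are both nonnegative on the relevant rows is monomial
    there. *)
Lemma nonneg_inverse_monomial {R : realDomainType} {n} (M N : 'M[R]_n)
    (Z Z' : pred 'I_n) :
  M *m N = 1%:M -> N *m M = 1%:M ->
  (forall i k, Z' i -> 0 <= M i k) -> (forall i k, Z' i -> ~~ Z k -> M i k = 0) ->
  (forall j k, Z j -> 0 <= N j k) ->
  forall i, Z' i -> exists j,
    [/\ Z j, forall k, k != j -> M i k = 0, forall k, k != i -> N j k = 0
      & M i j * N j i = 1].
Proof.
move=> MN NM M0 MZ N0 i Zi.
have MNE a b : \sum_l M a l * N l b = (a == b)%:R.
  by have /matrixP/(_ a b) := MN; rewrite !mxE.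
have NME a b : \sum_l N a l * M l b = (a == b)%:R.
  by have /matrixP/(_ a b) := NM; rewrite !mxE.
have [j Mij] : exists j, M i j * N j i != 0.
  apply/existsP; apply: contraT; rewrite negb_exists => /forallP h0.
  have := MNE i i; rewrite eqxx big1 => [/esym/eqP|j _]; first by rewrite oner_eq0.
  by have := h0 j; rewrite negbK => /eqP.
have Zj : Z j.
  by apply: contraNT Mij => /(MZ i j Zi) ->; rewrite mul0r.
have Mij0 : M i j != 0 by apply: contraNneq Mij => ->; rewrite mul0r.
have Nji0 : N j i != 0 by apply: contraNneq Mij => ->; rewrite mulr0.
have term0 k l : 0 <= M i l * N l k.
  have [Zl|/(MZ i l Zi) ->] := boolP (Z l); last by rewrite mul0r.
  by rewrite mulr_ge0// ?M0// N0.
have Njk k : k != i -> N j k = 0.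
  move=> ki; have /eqP := MNE i k; rewrite [i == k]eq_sym (negbTE ki).
  rewrite psumr_eq0 => [/allP/(_ j)|l _]; last exact: term0.
  rewrite mem_index_enum => /(_ isT) /=.
  by rewrite mulf_eq0 (negbTE Mij0) => /eqP.
have Mik k : k != j -> M i k = 0.
  move=> kj; have := NME j k; rewrite eq_sym (negbTE kj) (bigD1 i)//= big1.
    by rewrite addr0 => /eqP; rewrite mulf_eq0 (negbTE Nji0) => /eqP.
  by move=> l li; rewrite Njk// mul0r.
exists j; split => //.
have := MNE i i; rewrite eqxx (bigD1 j)//= big1 ?addr0// => l lj.
by rewrite Mik// mul0r.
Qed.

Lemma nonneg_inverse_card {R : realDomainType} {n} (M N : 'M[R]_n)
    (Z Z' : pred 'I_n) :
  M *m N = 1%:M -> N *m M = 1%:M ->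
  (forall i k, Z' i -> 0 <= M i k) -> (forall i k, Z' i -> ~~ Z k -> M i k = 0) ->
  (forall j k, Z j -> 0 <= N j k) -> (#|Z'| <= #|Z|)%N.
Proof.
move=> MN NM M0 MZ N0.
have /choice[s sP] : forall i, exists j, Z' i ->
    [/\ Z j, forall k, k != i -> N j k = 0 & M i j * N j i = 1].
  move=> i; have [Zi|//] := boolP (Z' i); last by exists i.
  by have [j [? _ ? ?]] := nonneg_inverse_monomial MN NM M0 MZ N0 Zi; exists j.
have sinj : {in Z' &, injective s}.
  move=> i i' /= Zi Zi' e; apply/eqP; apply: contraT => ii'.
  have [_ _ h1] := sP i Zi; have [_ h2 _] := sP i' Zi'.
  by move: h1; rewrite e h2// mulr0 => /esym/eqP; rewrite oner_eq0.
rewrite -(card_in_image sinj); apply: subset_leq_card.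
apply/fintype.subsetP => j /fintype.imageP[i Zi ->].
by have [] := sP i Zi.
Qed.

Lemma near_ray {R : realType} {V : normedModType R} (x v : V) (P : set V) :
  (\forall y \near x, P y) -> \forall t \near (0 : R), P (t *: v + x).
Proof.
move=> Px; have : continuous_at (0 : R) (fun t : R => t *: v + x).
  apply: cvgD; last exact: cvg_cst.
  exact: (@scalel_continuous _ _ v 0).
by move=> /(_ P); apply; rewrite scale0r add0r.
Qed.

Lemma derive_line {R : realType} {V W : normedModType R} (f : V -> W) x v w :
  (forall t, f (t *: v + x) - f x = t *: w) -> is_derive x v f w.
Proof.
move=> h; have cv : (fun t : R => t^-1 *: ((f \o shift x) (t *: v) - f x)) @ 0^' --> w.
  apply: cvg_near_cst; near=> t.
  by rewrite /= h scalerA mulVf ?scale1r//; near: t; exact: nbhs_dnbhs_neq.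
apply: DeriveDef; first exact: (cvgP _ cv).
exact: cvg_lim cv.
Unshelve. all: by end_near. Qed.

Lemma derive_right_ge0 {R : realType} {V : normedModType R} (f : V -> R) x v :
  derivable f x v -> (\forall t \near (0:R)^'+, f x <= f (t *: v + x)) ->
  0 <= 'D_v f x.
Proof.
move=> df fge; rewrite /derive cvg_at_rightE//.
apply: limr_ge; first exact: (cvgP _ (cvg_dnbhs_at_right df)).
near=> t; rewrite /= -[_ *: _]/(_ * _) mulr_ge0// ?subr_ge0.
  by rewrite invr_ge0 ltW.
by near: t.
Unshelve. all: by end_near. Qed.

(** The direction e_k is admissible at every point of the orthant, and - e_k at
    the points with positive k-th coordinate. *)
Lemma derive_orthant_min {R : realType} {n} (f : 'rV[R]_n -> R) x k :
  differentiable f x -> orthant R n x ->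
  (\forall y \near x, orthant R n y -> f x <= f y) ->
  0 <= 'D_(delta_mx 0 k) f x /\ (x 0 k != 0 -> 'D_(delta_mx 0 k) f x = 0).
Proof.
move=> df x0 fmin.
have ray v (P : set 'rV[R]_n) : (\forall y \near x, P y) ->
    \forall t \near (0 : R)^'+, P (t *: v + x).
  by move=> Px; apply: cvg_within; exact: near_ray.
have ge0 : 0 <= 'D_(delta_mx 0 k) f x.
  apply: derive_right_ge0; first exact: diff_derivable.
  near=> t; have t0 : 0 < t by [].
  have : orthant R n (t *: delta_mx 0 k + x).
    move=> i; rewrite !mxE addr_ge0// ?mulr_ge0// ltW//; exact: t0.
  by near: t; exact: (ray _ _ fmin).
split => // xk0.
have xk : 0 < x 0 k by rewrite lt_def xk0 x0.
apply/eqP; rewrite eq_le ge0 andbT -oppr_ge0.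
have -> : - 'D_(delta_mx 0 k) f x = 'D_(- delta_mx 0 k) f x.
  by rewrite !deriveE // linearN.
apply: derive_right_ge0; first exact: diff_derivable.
near=> t; have t0 : 0 < t by [].
have tx : t < x 0 k.
  by near: t; exact: nbhs_right_lt.
have : orthant R n (t *: (- delta_mx 0 k) + x).
  move=> i; rewrite !mxE eqxx /=; case: eqVneq => [->|_].
    by rewrite mulrN mulr1 addrC subr_ge0 ltW.
  by rewrite oppr0 mulr0 add0r.
by near: t; exact: (ray _ _ fmin).
Unshelve. all: by end_near. Qed.

Section Charts.
Context {R : realType} {T : topologicalType} {m : nat} (M : set 'rV[R]_m).
Implicit Types c d : chart R T m.

Lemma chart_continuous_at c b : is_chart M c -> dom c b -> {for b, continuous c}.
Proof.
move=> [oc _ /subspace_continuousP cc _ _] cb.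
move=> A /(cc _ cb) cA; have nb : nbhs b (dom c) by exact: open_nbhs_nbhs.
have {}cA : nbhs b [set y | dom c y -> A (c y)] by exact: cA.
by apply: filterS2 nb cA => y cy; apply.
Qed.

Lemma chart_inj c b b' : is_chart M c -> dom c b -> dom c b' -> c b = c b' -> b = b'.
Proof.
move=> [_ cK _ _ _] cb cb' e; rewrite -(cK b) ?inE// -(cK b') ?inE//.
by rewrite e.
Qed.

Lemma chart_invK c b : is_chart M c -> dom c b -> chart_inv c (c b) = b.
Proof. by move=> [_ cK _ _ _] cb; rewrite cK ?inE. Qed.

Lemma chart_model c b : is_chart M c -> dom c b -> M (c b).
Proof.
move=> [_ _ _ _ [W _ cW]] cb.
have : (W `&` M) (c b) by rewrite -cW; exists b.
by case.
Qed.

Lemma chart_nbhs c b (O : set T) : is_chart M c -> dom c b -> nbhs b O ->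
  \forall xi \near c b, M xi -> exists b', [/\ dom c b', O b' & xi = c b'].
Proof.
move=> Mc cb Ob; have [oc cK _ /subspace_continuousP icc [W oW cW]] := Mc.
have icb : (c @` dom c) (c b) by exists b.
have Wcb : W (c b) by have : (W `&` M) (c b); [rewrite -cW|case].
have Ob' : nbhs (chart_inv c (c b)) O by rewrite (chart_invK Mc cb).
have nW : nbhs (c b) W by exact: open_nbhs_nbhs.
have nO := icc _ icb _ Ob'.
have {}nO : nbhs (c b) [set xi | (c @` dom c) xi -> O (chart_inv c xi)] by exact: nO.
apply: filterS2 nW nO => xi Wxi xiO Mxi.
have ixi : (c @` dom c) xi by rewrite cW.
have := xiO ixi; case: ixi => b' cb' <-; rewrite (chart_invK Mc cb') => Ob''.
by exists b'.
Qed.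

(** Transition maps are smooth in the sense of extensions; the extension [g] is
    only known to be the transition map on the model [M]. *)
Lemma transition_extension c d b (O : set T) :
  is_chart M c -> is_chart M d -> smooth_transition c d ->
  dom c b -> dom d b -> nbhs b O ->
  exists U g, [/\ open U, U (c b), smooth_open U g, g (c b) = d b
    & \forall xi \near c b, M xi ->
        exists b', [/\ dom c b', dom d b', O b', xi = c b' & g xi = d b']].
Proof.
move=> Mc Md scd cb db Ob.
have icb : (c @` (dom c `&` dom d)) (c b) by exists b.
have [U [g [oU Ub sg gE]]] := scd _ icb.
exists U, g; split => //; first by rewrite gE//= (chart_invK Mc cb).
have nO : nbhs b (O `&` dom d).
  by apply: filterI => //; apply: open_nbhs_nbhs; split => //; case: Md.
have nU : nbhs (c b) U by exact: open_nbhs_nbhs.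
apply: filterS2 nU (chart_nbhs Mc cb nO) => xi Uxi h /h[b' [cb' [Ob' db'] e]].
exists b'; split => //.
by rewrite gE ?e//= ?(chart_invK Mc cb')// -?e//; exists b'.
Qed.

End Charts.

(** A coordinate of [d] that vanishes at [b] is minimal there, so its partial
    derivatives in the chart [c] are those of [derive_orthant_min]. Together with
    the same remark for the inverse transition, this gives the hypotheses of
    [nonneg_inverse_card] for the Jacobian matrices. *)
Lemma transition_zeros_card {R : realType} {T : topologicalType} {n}
    (c d : chart R T n) b :
  is_chart (orthant R n) c -> is_chart (orthant R n) d ->
  smooth_transition c d -> smooth_transition d c -> dom c b -> dom d b ->
  (#|[pred i | d b 0%R i == 0%R]| <= #|[pred i | c b 0%R i == 0%R]|)%N.
Proof.
move=> Mc Md scd sdc cb db.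
have [U [g [oU Ub sg gb gE]]] := transition_extension Mc Md scd cb db filterT.
have [V [h [oV Vb sh hb hE]]] := transition_extension Md Mc sdc db cb filterT.
have dg j : differentiable (fun x => g x 0 j) (c b).
  exact: smooth_open_differentiable sg Ub.
have dh j : differentiable (fun x => h x 0 j) (d b).
  exact: smooth_open_differentiable sh Vb.
have cg := smooth_open_continuous sg Ub.
have ch := smooth_open_continuous sh Vb.
have hg : \forall xi \near c b, orthant R n xi -> h (g xi) = xi.
  have := cg _; rewrite gb => /(_ _ hE) hE'.
  apply: filterS2 gE hE' => xi h1 h2 /h1[b' [cb' db' _ e0 gb']].
  have [|b'' [db'' cb'' _ e1 hb'']] := h2; first by rewrite gb'; exact: chart_model Md db'.
  by rewrite hb'' e0 (chart_inj Md db' db'')// -gb'.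
have gh : \forall xi \near d b, orthant R n xi -> g (h xi) = xi.
  have := ch _; rewrite hb => /(_ _ gE) gE'.
  apply: filterS2 hE gE' => xi h1 h2 /h1[b' [db' cb' _ e0 hb']].
  have [|b'' [cb'' db'' _ e1 gb'']] := h2; first by rewrite hb'; exact: chart_model Mc cb'.
  by rewrite gb'' e0 (chart_inj Mc cb' cb'')// -hb'.
(* The composite of the two extensions is the identity on the orthant only,
   possibly at a corner. The difference with the identity is therefore both
   minimal and maximal there, which suffices for its derivatives to vanish. *)
have inv1 (x y : 'rV[R]_n) (u v : 'rV[R]_n -> 'rV[R]_n) i k : u x = y ->
    orthant R n x ->
    (forall j, differentiable (fun z => u z 0 j) x) ->
    (forall j, differentiable (fun z => v z 0 j) y) ->
    (\forall xi \near x, orthant R n xi -> v (u xi) = xi) ->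
    \sum_l 'D_(delta_mx 0 l) (fun z => v z 0 i) y *
           'D_(delta_mx 0 k) (fun z => u z 0 l) x = (i == k)%:R.
  move=> uxy x0 du dv vu.
  have dvu : differentiable (fun z => v (u z) 0 i) x.
    apply: (@differentiable_comp _ _ _ _ u (fun y => v y 0 i)).
      exact: differentiable_rV.
    by rewrite uxy.
  have dco : differentiable (fun z : 'rV[R]_n => z 0 i) x by exact: differentiable_coord.
  have D0 (F : 'rV[R]_n -> R) : differentiable F x ->
      (\forall xi \near x, orthant R n xi -> F xi = 0) -> 0 <= 'D_(delta_mx 0 k) F x.
    move=> dF F0; apply: (derive_orthant_min k dF x0 _).1.
    have Fx : F x = 0 by exact: (nbhs_singleton F0).
    by rewrite Fx; apply: filterS F0 => xi Fxi xi0; rewrite Fxi.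
  have e : 'D_(delta_mx 0 k) (fun z => v (u z) 0 i) x =
           'D_(delta_mx 0 k) (fun z : 'rV[R]_n => z 0 i) x.
    have D1 : derivable _ x (delta_mx 0 k) := diff_derivable dvu.
    have D2 : derivable _ x (delta_mx 0 k) := diff_derivable dco.
    apply/eqP; rewrite eq_le -subr_ge0 -[X in _ && X]subr_ge0.
    rewrite -(deriveB D2 D1) -(deriveB D1 D2).
    apply/andP; split; apply: D0; try exact: differentiableB.
      by apply: filterS vu => xi vuxi xi0; rewrite !fctE vuxi// subrr.
    by apply: filterS vu => xi vuxi xi0; rewrite !fctE vuxi// subrr.
  have dvy : differentiable (fun z => v z 0 i) (u x) by rewrite uxy.
  move: e; rewrite (derive_compE (delta_mx 0 k) du dvy) uxy.
  under eq_bigr do rewrite mulrC.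
  move=> ->; rewrite -derive_coord; last exact: derivable_id.
  by rewrite derive_id mxE eqxx.
pose Mm : 'M[R]_n := \matrix_(i, k) 'D_(delta_mx 0 k) (fun z => g z 0 i) (c b).
pose Nm : 'M[R]_n := \matrix_(i, k) 'D_(delta_mx 0 k) (fun z => h z 0 i) (d b).
have c0 := chart_model Mc cb.
have d0 := chart_model Md db.
have ge0 (x : 'rV[R]_n) (u : 'rV[R]_n -> 'rV[R]_n) i k : orthant R n x ->
    (forall j, differentiable (fun z => u z 0 j) x) -> u x 0 i = 0 ->
    (\forall xi \near x, orthant R n xi -> orthant R n (u xi)) ->
    0 <= 'D_(delta_mx 0 k) (fun z => u z 0 i) x /\
    (x 0 k != 0 -> 'D_(delta_mx 0 k) (fun z => u z 0 i) x = 0).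
  move=> x0 du ux0 uo; apply: derive_orthant_min => //.
  by rewrite ux0; apply: filterS uo => xi uxi xi0; exact: uxi.
have og : \forall xi \near c b, orthant R n xi -> orthant R n (g xi).
  by apply: filterS gE => xi h0 /h0[b' [_ db' _ _ ->]]; exact: chart_model Md db'.
have oh : \forall xi \near d b, orthant R n xi -> orthant R n (h xi).
  by apply: filterS hE => xi h0 /h0[b' [_ cb' _ _ ->]]; exact: chart_model Mc cb'.
apply: (@nonneg_inverse_card _ _ Mm Nm).
- by apply/matrixP => i k; rewrite !mxE; under eq_bigr do rewrite !mxE; exact: inv1.
- by apply/matrixP => i k; rewrite !mxE; under eq_bigr do rewrite !mxE; exact: inv1.
- move=> i k /eqP di; rewrite mxE; apply: (ge0 _ _ _ _ c0 dg _ og).1.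
  by rewrite gb.
- move=> i k /eqP di ck; rewrite mxE; apply: (ge0 _ _ _ _ c0 dg _ og).2 => //.
  by rewrite gb.
- move=> i k /eqP ci; rewrite mxE; apply: (ge0 _ _ _ _ d0 dh _ oh).1.
  by rewrite hb.
Qed.

Lemma transition_zeros {R : realType} {T : topologicalType} {n}
    (c d : chart R T n) b :
  is_chart (orthant R n) c -> is_chart (orthant R n) d ->
  smooth_transition c d -> smooth_transition d c -> dom c b -> dom d b ->
  #|[set i | c b 0 i != 0]%SET| = #|[set i | d b 0 i != 0]%SET|.
Proof.
move=> Mc Md scd sdc cb db.
have e (x : 'rV[R]_n) :
    #|[set i | x 0 i != 0]%SET| = (n - #|[pred i | x 0%R i == 0%R]|)%N.
  have -> : [set i | x 0 i != 0]%SET = (~: [set i | x 0 i == 0])%SET.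
    by apply/setP => i; rewrite !inE.
  by rewrite cardsCs finset.setCK card_ord cardsE.
rewrite !e; congr (_ - _)%N; apply/eqP; rewrite eqn_leq.
by rewrite (transition_zeros_card Mc Md) // (transition_zeros_card Md Mc).
Qed.

(** * The torus, its exponential map and complex-valued monomials *)

Section TorusFacts.
Context {R : realType}.

Definition cis (x : R) : R[i] := Complex (cos (2 * pi * x)) (sin (2 * pi * x)).

Lemma cis0 : cis 0 = 1.
Proof. by rewrite /cis mulr0 cos0 sin0. Qed.

Lemma cisD x y : cis (x + y) = cis x * cis y.
Proof. by rewrite /cis mulrDr cosD sinD; apply/eqP; rewrite eq_complex /= eqxx addrC eqxx. Qed.

Lemma normc_cis x : Normc.normc (cis x) = 1.
Proof. by rewrite /= cos2Dsin2 sqrtr1. Qed.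

Lemma normc1_neq0 (z : R[i]) : Normc.normc z = 1 -> z != 0.
Proof. by move=> z1; apply/eqP => z0; move: z1; rewrite z0 Normc.normc0 => /esym/eqP; rewrite oner_eq0. Qed.

Lemma cis_neq0 x : cis x != 0.
Proof. exact: normc1_neq0 (normc_cis x). Qed.

Lemma cisN x : cis (- x) = (cis x)^-1.
Proof.
by apply: (mulIf (cis_neq0 x)); rewrite -cisD addNr cis0 mulVf// cis_neq0.
Qed.

Lemma cis_sum n (f : 'I_n -> R) : cis (\sum_j f j) = \prod_j cis (f j).
Proof. by apply: (big_morph cis cisD cis0). Qed.

Lemma cis_exprz x (m : int) : cis x ^ m = cis (m%:~R * x).
Proof.
have nat_case k : cis x ^+ k = cis (k%:R * x).
  elim: k => [|k IH]; first by rewrite mul0r cis0.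
  by rewrite exprS IH -cisD -natr1 mulrDl mul1r addrC.
case: m => k; first by rewrite -exprnP nat_case.
by rewrite NegzE mulrNz mulNr cisN -exprnN nat_case.
Qed.

(** The angle 0 is chosen for 1, so that vectors of angles vanish where the torus
    coordinates are trivial. *)
Lemma cis_surj (z : R[i]) : Normc.normc z = 1 -> exists x, cis x = z /\ (z = 1 -> x = 0).
Proof.
case: (eqVneq z 1) => [-> _|z1]; first by exists 0; split => //; exact: cis0.
case: z z1 => a b z1 /= n1.
have ab : a ^+ 2 + b ^+ 2 = 1.
  have := congr1 (fun t => t ^+ 2) n1; rewrite sqr_sqrtr ?expr1n//.
  by rewrite addr_ge0// sqr_ge0.
have a1 : -1 <= a <= 1.
  by rewrite -ler_norml -(@ler_pXn2r _ 2)// ?nnegrE// expr1n -normrX ger0_norm ?sqr_ge0// -ab lerDl sqr_ge0.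
have p0 : 2 * pi != 0 :> R by rewrite mulf_neq0// gt_eqF// pi_gt0.
have cosa : cos (acos a) = a by rewrite acosK// in_itv.
have sina : sin (acos a) = `|b|.
  by rewrite sin_acos// -ab addrAC subrr add0r sqrtr_sqr.
have [b0|b0] := leP 0 b.
  exists (acos a / (2 * pi)); split => [|h]; last by rewrite h eqxx in z1.
  by rewrite /cis mulrC divfK// cosa sina ger0_norm.
exists (- acos a / (2 * pi)); split => [|h]; last by rewrite h eqxx in z1.
by rewrite /cis mulrC divfK// cosN sinN cosa sina ltr0_norm// opprK.
Qed.

Context {n : nat}.
Implicit Types (s t : torus R n) (g h : GLZ n) (v : 'rV[R]_n).

Lemma tcoord_mk f (f1 : forall k, Normc.normc (f k) = 1) k :
  tcoord (mk_torus f1 : torus R n) k = f k.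
Proof. exact: of_zcoordK. Qed.

Lemma zcoord_inj (z w : 'rV[R]_(n + n)) : zcoord z =1 zcoord w -> z = w.
Proof.
move=> zw; apply/rowP => i; rewrite -(splitK i).
by case: (fintype.split i) => k /=; have [] := zw k.
Qed.

Lemma torus_ext s t : tcoord s =1 tcoord t -> s = t.
Proof. by move=> st; apply: val_inj; exact: zcoord_inj. Qed.

Lemma tcoord_normc t k : Normc.normc (tcoord t k) = 1.
Proof. by have /set_mem := svalP t; apply. Qed.

Lemma tcoord_neq0 t k : tcoord t k != 0.
Proof. exact: normc1_neq0 (tcoord_normc t k). Qed.

Lemma tcoord_act g t k : tcoord (torus_act g t) k = \prod_j tcoord t j ^ sval g k j.
Proof. exact: tcoord_mk. Qed.

Lemma tcoord_div s t k : tcoord (torus_div s t) k = tcoord s k / tcoord t k.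
Proof. exact: tcoord_mk. Qed.

Lemma tcoord_exp v k : tcoord (torus_exp v) k = cis (v 0 k).
Proof. exact: tcoord_mk. Qed.

Lemma torus_exp_surj t :
  exists v, torus_exp v = t /\ forall k, tcoord t k = 1 -> v 0 k = 0.
Proof.
have /choice[f fP] : forall k, exists x, cis x = tcoord t k /\ (tcoord t k = 1 -> x = 0).
  by move=> k; exact: cis_surj (tcoord_normc t k).
exists (\row_k f k); split => [|k tk]; last by rewrite mxE (fP k).2.
by apply: torus_ext => k; rewrite tcoord_exp mxE (fP k).1.
Qed.

Lemma torus_act1 t : torus_act GL1 t = t.
Proof.
apply: torus_ext => k; rewrite tcoord_act (bigD1 k)//= big1 ?mulr1.
  by rewrite mxE eqxx expr1z.
by move=> j jk; rewrite mxE eq_sym (negbTE jk) expr0z.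
Qed.

Lemma torus_act_exp g v :
  torus_act g (torus_exp v) = torus_exp (v *m (map_mx intr (sval g))^T).
Proof.
apply: torus_ext => k; rewrite tcoord_act tcoord_exp mxE cis_sum.
by apply: eq_bigr => j _; rewrite tcoord_exp cis_exprz !mxE mulrC.
Qed.

Lemma torus_actM g h t : torus_act (GLmul g h) t = torus_act g (torus_act h t).
Proof.
have [v [<- _]] := torus_exp_surj t.
by rewrite !torus_act_exp -mulmxA -trmx_mul map_mxM.
Qed.

Lemma torus_act_div g s t :
  torus_act g (torus_div s t) = torus_div (torus_act g s) (torus_act g t).
Proof.
have divE u w : torus_div (torus_exp u) (torus_exp w) = torus_exp (u - w) :> torus R n.
  apply: torus_ext => k; rewrite tcoord_div !tcoord_exp !mxE.
  by rewrite cisD cisN.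
have [v [<- _]] := torus_exp_surj t; have [w [<- _]] := torus_exp_surj s.
by rewrite divE !torus_act_exp divE mulmxBl.
Qed.

Lemma lattice_actM g h (l : 'rV[int]_n) :
  lattice_act (GLmul g h) l = lattice_act g (lattice_act h l).
Proof. by rewrite /lattice_act -mulmxA -trmx_mul. Qed.

Lemma GL_ext g h : sval g = sval h -> g = h.
Proof. by move=> gh; apply: val_inj. Qed.

Lemma GLmul1g g : GLmul GL1 g = g.
Proof. by apply: GL_ext; rewrite /= mul1mx. Qed.

Lemma GLmulg1 g : GLmul g GL1 = g.
Proof. by apply: GL_ext; rewrite /= mulmx1. Qed.

Lemma GLmulA g h k : GLmul g (GLmul h k) = GLmul (GLmul g h) k.
Proof. by apply: GL_ext; rewrite /= mulmxA. Qed.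

Definition GLinv g : GLZ n :=
  exist _ (invmx (sval g)) (etrans (unitmx_inv _) (svalP g)).

Lemma GLmulVg g : GLmul (GLinv g) g = GL1.
Proof. by apply: GL_ext; rewrite /= mulVmx// (svalP g). Qed.

Lemma GLmulgV g : GLmul g (GLinv g) = GL1.
Proof. by apply: GL_ext; rewrite /= mulmxV// (svalP g). Qed.

Lemma GLcontraM g h : GLcontra (GLmul g h) = GLmul (GLcontra g) (GLcontra h).
Proof.
apply: GL_ext => /=; rewrite -trmx_mul; congr trmx.
have ug := svalP g; have uh := svalP h.
have ugh : sval g *m sval h \in unitmx by rewrite unitmx_mul ug uh.
rewrite -[RHS]mul1mx -(mulVmx ugh) -!mulmxA -[LHS]mulmx1; congr (_ *m _).
by rewrite (mulmxA (sval h)) (mulmxV uh) mul1mx (mulmxV ug).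
Qed.

Lemma GLcontra1 : GLcontra GL1 = GL1 :> GLZ n.
Proof. by apply: GL_ext; rewrite /= invmx1 trmx1. Qed.

End TorusFacts.

Section ComplexSmooth.
Context {R : realType} {m : nat} (r : nat) (U : set 'rV[R]_m) (oU : open U).
Implicit Types F G : 'rV[R]_m -> R[i].

Definition cCr F : Prop :=
  Cr r U (fun x => complex.Re (F x)) /\ Cr r U (fun x => complex.Im (F x)).

Lemma cCr_ext F G : {in U, F =1 G} -> cCr F -> cCr G.
Proof.
by move=> FG [a b]; split; [apply: Cr_ext a|apply: Cr_ext b] => // x xU; rewrite FG.
Qed.

Lemma cCr_cst (w : R[i]) : cCr (cst w).
Proof. by split; exact: Cr_cst. Qed.

Lemma cCr_mul F G : cCr F -> cCr G -> cCr (fun x => F x * G x).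
Proof.
move=> [a b] [c d]; split.
  apply: Cr_ext (Cr_add oU (Cr_mul oU a c)
    (Cr_mul oU (Cr_cst r U (-1 : R)) (Cr_mul oU b d))) => // x _.
  by rewrite /= mulN1r; case: (F x) (G x) => ? ? [].
apply: Cr_ext (Cr_add oU (Cr_mul oU a d) (Cr_mul oU b c)) => // x _.
by case: (F x) (G x) => ? ? [].
Qed.

Lemma cCr_real (f : 'rV[R]_m -> R) : Cr r U f -> cCr (fun x => Complex (f x) 0).
Proof. by move=> Cf; split => //; exact: Cr_cst. Qed.

Lemma cCr_inv F : (forall x, U x -> F x != 0) -> cCr F -> cCr (fun x => (F x)^-1).
Proof.
move=> F0 [a b].
have CN := Cr_add oU (Cr_mul oU a a) (Cr_mul oU b b).
have N0 x : U x -> complex.Re (F x) * complex.Re (F x) + complex.Im (F x) * complex.Im (F x) != 0.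
  move=> /F0; apply: contra; rewrite -!expr2 paddr_eq0 ?sqr_ge0// !sqrf_eq0.
  by rewrite eq_complex.
have CV := Cr_inv oU N0 CN.
split.
  apply: Cr_ext (Cr_mul oU a CV) => // x _.
  by case: (F x) => u v; rewrite /= -!expr2.
apply: Cr_ext (Cr_mul oU (Cr_cst r U (-1 : R)) (Cr_mul oU b CV)) => // x _.
by case: (F x) => u v; rewrite /= -!expr2 mulN1r.
Qed.

Lemma cCr_exprn F k : cCr F -> cCr (fun x => F x ^+ k).
Proof.
move=> CF; elim: k => [|k IH].
  by apply: cCr_ext (cCr_cst 1) => x _; rewrite expr0.
by apply: cCr_ext (cCr_mul CF IH) => x _; rewrite exprS.
Qed.

Lemma cCr_exprz F (k : int) : (forall x, U x -> F x != 0) -> cCr F ->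
  cCr (fun x => F x ^ k).
Proof.
move=> F0 CF; case: k => k; first exact: cCr_exprn.
apply: cCr_inv; last exact: cCr_exprn.
by move=> x Ux; rewrite expf_neq0// F0.
Qed.

Lemma cCr_prod n (P : pred 'I_n) (F : 'I_n -> 'rV[R]_m -> R[i]) :
  (forall i, P i -> cCr (F i)) -> cCr (fun x => \prod_(i | P i) F i x).
Proof.
move=> CF; elim: (index_enum _) => [|i s IH].
  by apply: cCr_ext (cCr_cst 1) => x _; rewrite big_nil.
have [Pi|Pi] := boolP (P i).
  by apply: cCr_ext (cCr_mul (CF i Pi) IH) => x _; rewrite big_cons Pi.
by apply: cCr_ext IH => x _; rewrite big_cons (negbTE Pi).
Qed.

End ComplexSmooth.

Lemma cCr_zcoord {R : realType} {n} r (U : set 'rV[R]_(n + n)) k :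
  cCr r U (fun z => zcoord z k).
Proof. by split; exact: Cr_coord. Qed.

Lemma cCr_of_zcoord {R : realType} {m n} r (U : set 'rV[R]_m)
    (F : 'rV[R]_m -> 'I_n -> R[i]) : open U ->
  (forall k, cCr r U (fun x => F x k)) ->
  forall j, Cr r U (fun x => of_zcoord (F x) 0 j).
Proof.
move=> oU CF j; rewrite -(splitK j); case: (fintype.split j) => k /=.
  by apply: Cr_ext (CF k).1 => // x _; rewrite row_mxEl mxE.
by apply: Cr_ext (CF k).2 => // x _; rewrite row_mxEr mxE.
Qed.

(** * Quotients by generated relations *)

Section QuotientFacts.
Context {T : topologicalType} (r : T -> T -> Prop).

Lemma cls_eqP x y : cls r x = cls r y <-> clos_refl_sym_trans T r x y.
Proof.
have E : (cls r x = cls r y) <-> (x == y %[mod {eq_quot generated_equiv r}])%qT.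
  by split => [h|/eqP h]; [apply/eqP; exact: h|exact: h].
by rewrite E eqmodE; split => [/asboolP|h]//; apply/asboolP.
Qed.

Lemma cls_eq x y : r x y -> cls r x = cls r y.
Proof. by move=> h; apply/cls_eqP; exact: rst_step. Qed.

Lemma repK q : cls r (rep q) = q.
Proof. exact: reprK. Qed.

Lemma cls_continuous : continuous (cls r).
Proof. exact: pi_continuous. Qed.

Lemma cls_open (A : set (quot r)) : open A <-> open (cls r @^-1` A).
Proof. by []. Qed.

(** The generated relation only adds chains of related points, along which [f]
    is constant. *)
Lemma cls_invariant {Y : Type} (f : T -> Y) :
  (forall x y, r x y -> f x = f y) -> forall x, f (rep (cls r x)) = f x.
Proof.
move=> fr x; have /cls_eqP : cls r (rep (cls r x)) = cls r x by exact: repK.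
by move: (rep _) => w; elim => [y z /fr//|//|y z _ ->//|y z u _ -> _ ->].
Qed.

(** The form needed for local trivializations, which are functions on a
    saturated set [P] only. *)
Lemma cls_invariant_in {Y : Type} (P : set T) (f : T -> Y) :
  (forall x y, r x y -> P x <-> P y) ->
  (forall x y, P x -> r x y -> f x = f y) ->
  forall x, P x -> f (rep (cls r x)) = f x.
Proof.
move=> rP fr x Px; have /cls_eqP : cls r (rep (cls r x)) = cls r x by exact: repK.
move: (rep _) => v h; have [_ +] : (P v <-> P x) /\ (P x -> f v = f x).
  elim: h {Px} => [y z yz|y|y z _ [e1 e2]|y z w _ [e1 e2] _ [e3 e4]].
  - by split; [exact: rP|move=> /(rP _ _ yz) Py; exact: fr].
  - by [].
  - by split; [exact: iff_sym|move=> /e1 /e2].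
  - split; first exact: iff_trans e1 e3.
    by move=> Pw; rewrite e2 ?e4//; exact/e3.
by apply.
Qed.

End QuotientFacts.

Lemma continuous_pair {X Y Z : topologicalType} (f : X -> Y) (g : X -> Z) x :
  {for x, continuous f} -> {for x, continuous g} ->
  {for x, continuous (fun t => (f t, g t))}.
Proof. by move=> cf cg; apply: cvg_pair. Qed.

(** * The frame bundle and its associated bundles in local trivializations *)

(** Short rays along the coordinate axes stay in the orthant, so even at a corner
    the linear part of an affine map is determined by its values nearby. *)
Lemma affine_orthant_unique {R : realType} {n} (x0 : 'rV[R]_n) (P Q : 'M[R]_n) c d :
  orthant R n x0 ->
  (\forall xi \near x0, orthant R n xi -> xi *m P + c = xi *m Q + d) -> P = Q.
Proof.
move=> x00 PQ; apply/row_matrixP => k; rewrite !rowE.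
have [t [t0]] : exists t : R, 0 < t /\
    (orthant R n (t *: delta_mx 0 k + x0) -> (t *: delta_mx 0 k + x0) *m P + c =
       (t *: delta_mx 0 k + x0) *m Q + d).
  have h : \forall t \near (0 : R)^'+, (orthant R n (t *: delta_mx 0 k + x0) ->
      (t *: delta_mx 0 k + x0) *m P + c = (t *: delta_mx 0 k + x0) *m Q + d).
    by apply: cvg_within; exact: near_ray PQ.
  have h' : \forall t \near (0 : R)^'+, 0 < t by exact: nbhs_right_gt.
  by have [t [? ?]] := filter_ex (filterI h' h); exists t.
have /[swap] /[apply] : orthant R n (t *: delta_mx 0 k + x0).
  by move=> i; rewrite !mxE addr_ge0// ?mulr_ge0// ltW.
have := nbhs_singleton PQ x00; rewrite !mulmxDl -!addrA => -> /addIr.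
rewrite -!scalemxAl => /(congr1 (fun v => t^-1 *: v)).
by rewrite !scalerA mulVf ?scale1r// gt_eqF.
Qed.

Section Bundles.
Context {R : realType} {n : nat} {B : topologicalType}.
Context {AB : set (chart R B n)} {I : choiceType}.
Variable S : integral_affine AB I.

Local Notation phi a := (ia_chart S a).
Local Notation U a := (dom (ia_chart S a)).

Definition real_lin a b : 'M[R]_n := map_mx intr (sval (ia_lin S a b)).

Lemma ia_is_chart a : is_chart (orthant R n) (phi a).
Proof. by have [] := ia_chartP S a. Qed.

Lemma ia_open a : open (U a).
Proof. by have [] := ia_is_chart a. Qed.

Lemma ia_nbhs a x : U a x -> nbhs x (U a).
Proof. by move=> ax; apply: open_nbhs_nbhs; split => //; exact: ia_open. Qed.

Lemma ia_coverP x : exists a, U a x.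
Proof.
have [a _ ax] : (\bigcup_a U a) x by rewrite (ia_cover S).
by exists a.
Qed.

Lemma ia_affine a b x : U a x -> U b x ->
  phi a x = phi b x *m (real_lin a b)^T + ia_shift S a b.
Proof.
move=> ax bx; rewrite -(ia_overlap (i := S) (a := a) (b := b)); last by exists x.
by rewrite /= (chart_invK (ia_is_chart b)).
Qed.

Lemma GL_real_inj (g h : GLZ n) :
  map_mx intr (sval g) = map_mx intr (sval h) :> 'M[R]_n -> g = h.
Proof.
move=> gh; apply: GL_ext; apply/matrixP => i j.
by have /matrixP/(_ i j) := gh; rewrite !mxE => /intr_inj.
Qed.

Lemma ia_lin_refl a x : U a x -> ia_lin S a a = GL1.
Proof.
move=> ax; apply: GL_real_inj; apply: trmx_inj.
apply: (@affine_orthant_unique _ _ (phi a x) _ _ (ia_shift S a a) 0).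
  exact: chart_model (ia_is_chart a) ax.
have := chart_nbhs (ia_is_chart a) ax (@filterT _ _ (nbhs_filter x)).
apply: filterS => xi h /h[b' [ab' _ ->]].
by rewrite -ia_affine// map_mx1 trmx1 mulmx1 addr0.
Qed.

(** On triple overlaps the two sides are linear parts of the same affine map;
    this is what makes the gluing relations equivalences. *)
Lemma ia_lin_cocycle a b c x : U a x -> U b x -> U c x ->
  ia_lin S a c = GLmul (ia_lin S a b) (ia_lin S b c).
Proof.
move=> ax bx cx; apply: GL_real_inj; apply: trmx_inj.
apply: (@affine_orthant_unique _ _ (phi c x) _ _ (ia_shift S a c)
  (ia_shift S b c *m (real_lin a b)^T + ia_shift S a b)).
  exact: chart_model (ia_is_chart c) cx.
have nb : nbhs x (U a `&` U b) by apply: filterI; exact: ia_nbhs.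
have := chart_nbhs (ia_is_chart c) cx nb; apply: filterS => xi h /h[y [cy [ay by_] ->]].
rewrite -ia_affine// (ia_affine ay by_) (ia_affine by_ cy).
by rewrite /= map_mxM trmx_mul mulmxDl -mulmxA addrA.
Qed.

Definition glue a b : GLZ n := GLcontra (ia_lin S a b).

Lemma glue_refl a x : U a x -> glue a a = GL1.
Proof. by move=> ax; rewrite /glue (ia_lin_refl ax) GLcontra1. Qed.

Lemma glue_cocycle a b c x : U a x -> U b x -> U c x ->
  glue a c = GLmul (glue a b) (glue b c).
Proof. by move=> ax bx cx; rewrite /glue (ia_lin_cocycle ax bx cx) GLcontraM. Qed.

Definition piece_base (x : frame_pieces S) : B := set_val (projT2 x).1.

(** The frame of a point of P, read in the coordinates of U_a. *)
Definition piece_frame a (x : frame_pieces S) : GLZ n :=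
  GLmul (glue a (projT1 x)) (projT2 x).2.

Definition frame_coord a (p : frame_bundle S) : GLZ n := piece_frame a (rep p).

Lemma piece_frame_glue a x y : U a (piece_base x) ->
  frame_glue x y -> piece_frame a x = piece_frame a y.
Proof.
move=> ax [xy h]; rewrite /piece_frame h GLmulA; congr GLmul.
apply/esym/glue_cocycle; [exact: ax| exact: set_valP | ].
by rewrite /piece_base xy; exact: set_valP.
Qed.

Lemma pi_P_cls x : pi_P (cls (@frame_glue _ _ _ _ _ S) x) = piece_base x.
Proof.
by apply: (cls_invariant (f := piece_base)) => y z [].
Qed.

Lemma frame_coord_cls a x : U a (piece_base x) ->
  frame_coord a (cls (@frame_glue _ _ _ _ _ S) x) = piece_frame a x.
Proof.
apply: (cls_invariant_in (P := fun x => U a (piece_base x))) => y z.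
  by move=> [+ _]; rewrite -/(piece_base y) -/(piece_base z) => ->.
exact: piece_frame_glue.
Qed.

Lemma pi_mkP a (b : set_type (U a)) h : pi_P (mkP b h) = set_val b.
Proof. exact: pi_P_cls. Qed.

Lemma frame_coord_mkP a a' (b : set_type (U a)) h : U a' (set_val b) ->
  frame_coord a' (mkP b h) = GLmul (glue a' a) h.
Proof. by move=> a'b; rewrite /mkP frame_coord_cls. Qed.

Lemma frame_coord_mkP_same a (b : set_type (U a)) h : frame_coord a (mkP b h) = h.
Proof.
rewrite frame_coord_mkP; last exact: set_valP.
by rewrite (glue_refl (set_valP b)) GLmul1g.
Qed.

Lemma mkP_frame_coord a (b : set_type (U a)) p : set_val b = pi_P p ->
  p = mkP b (frame_coord a p).
Proof.
move=> bp; rewrite -{1}(repK p); apply: cls_eq; split; first by rewrite bp.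
have ap : U a (piece_base (rep p)) by rewrite -[piece_base _]/(pi_P p) -bp; exact: set_valP.
have pp : U (projT1 (rep p)) (piece_base (rep p)) by exact: set_valP.
rewrite /= /frame_coord /piece_frame GLmulA -/(glue _ _).
by rewrite -(glue_cocycle pp ap pp) (glue_refl pp) GLmul1g.
Qed.

Lemma frame_ext a p q : U a (pi_P p) -> pi_P p = pi_P q ->
  frame_coord a p = frame_coord a q -> p = q.
Proof.
move=> ap pq h; pose b : set_type (U a) := exist (fun x => x \in U a) _ (mem_set ap).
have bp : set_val b = pi_P p by rewrite set_valE.
by rewrite (mkP_frame_coord bp) (mkP_frame_coord (etrans bp pq)) h.
Qed.

Lemma pi_P_act (p : frame_bundle S) g : pi_P (P_act p g) = pi_P p.
Proof. exact: pi_mkP. Qed.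

Lemma frame_coord_act a p g : U a (pi_P p) ->
  frame_coord a (P_act p g) = GLmul (frame_coord a p) g.
Proof. by move=> ap; rewrite /P_act frame_coord_mkP// GLmulA. Qed.

Lemma pi_P_continuous : continuous (@pi_P _ _ _ _ _ S).
Proof.
apply/quotient_continuous; rewrite (_ : _ \o _ = piece_base).
  apply: (@sigT_continuous _ _ _ (fun a (y : set_type (U a) * discrete_topology (GLZ n)) => set_val y.1)).
  move=> a y; apply: (@continuous_comp _ _ _ fst set_val); first exact: cvg_fst.
  exact: initial_continuous.
by apply/funext => x; exact: pi_P_cls.
Qed.

Lemma frame_coord_locally_constant a p : U a (pi_P p) ->
  \forall q \near p, U a (pi_P q) /\ frame_coord a q = frame_coord a p.
Proof.
move=> ap.
apply: open_nbhs_nbhs; split => //.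
apply/cls_open/sigT_openP => a'; rewrite openE => -[b g] /=.
rewrite /preimage /= pi_P_cls /= => -[ab fab].
have {}fab : piece_frame a (existT _ a' (b, g) : frame_pieces S) = frame_coord a p
  by rewrite -fab frame_coord_cls.
exists ([set y | U a (set_val y)], [set g]).
  split => /=; last exact: discrete_set1.
  apply: open_nbhs_nbhs; split => //.
  by apply: open_comp (ia_open a) => // y _; exact: initial_continuous.
move=> [y k] /= [ay ->]; split; first by rewrite pi_P_cls.
by rewrite frame_coord_cls.
Qed.

Section Associated.
Variables (F : topologicalType) (act : GLZ n -> F -> F).
Hypothesis act1 : forall f, act GL1 f = f.
Hypothesis actM : forall g h f, act (GLmul g h) f = act g (act h f).

Definition fiber_coord a (x : associated S act) : F :=
  act (frame_coord a (rep x).1) (rep x).2.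

Lemma pi_A_cls (x : (frame_bundle S * F)%type) : pi_A (cls (@associated_rel _ _ _ _ _ S _ act) x) = pi_P x.1.
Proof.
apply: (cls_invariant (f := fun x : (frame_bundle S * F)%type => pi_P x.1)) => y z [g [-> _]].
exact: pi_P_act.
Qed.

Lemma fiber_coord_cls a (x : (frame_bundle S * F)%type) : U a (pi_P x.1) ->
  fiber_coord a (cls (@associated_rel _ _ _ _ _ S _ act) x) = act (frame_coord a x.1) x.2.
Proof.
apply: (cls_invariant_in (P := fun x : (frame_bundle S * F)%type => U a (pi_P x.1))
  (f := fun x => act (frame_coord a x.1) x.2)) => y z.
  by move=> [g [-> _]]; rewrite pi_P_act.
by move=> + [g [e ->]]; rewrite e pi_P_act => az; rewrite frame_coord_act// actM.
Qed.

Lemma pi_mkA (p : frame_bundle S) f : pi_A (mkA act p f) = pi_P p.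
Proof. exact: pi_A_cls. Qed.

Lemma fiber_coord_mkA a (p : frame_bundle S) f : U a (pi_P p) ->
  fiber_coord a (mkA act p f) = act (frame_coord a p) f.
Proof. by move=> ap; rewrite /mkA fiber_coord_cls. Qed.

(** Two pairs over the same base point differ by the element of GL_n(Z) that
    relates their frames. *)
Lemma fiber_ext a x y : U a (pi_A x) -> pi_A x = pi_A y ->
  fiber_coord a x = fiber_coord a y -> x = y.
Proof.
rewrite -(repK x) -(repK y); case: (rep x) (rep y) => [p f] [q f'] /=.
rewrite !pi_A_cls /= => ap pq; have aq : U a (pi_P q) by rewrite -pq.
rewrite !fiber_coord_cls//= => e.
apply: (@cls_eq _ (@associated_rel _ _ _ _ _ S _ act)).
exists (GLmul (GLinv (frame_coord a q)) (frame_coord a p)); split => /=.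
  apply: (frame_ext ap); first by rewrite pi_P_act.
  by rewrite frame_coord_act// GLmulA GLmulgV GLmul1g.
by rewrite actM e -actM GLmulVg act1.
Qed.

Lemma pi_A_continuous : continuous (@pi_A _ _ _ _ _ S _ act).
Proof.
apply/quotient_continuous; rewrite (_ : _ \o _ = fun x : (frame_bundle S * F)%type => pi_P x.1).
  move=> x; apply: (@continuous_comp _ _ _ fst (@pi_P _ _ _ _ _ S)); first exact: cvg_fst.
  exact: pi_P_continuous.
by apply/funext => x; exact: pi_A_cls.
Qed.

(** The frame coordinate is locally constant, so near a point of the bundle the
    trivialization is induced by (p, f) |-> (pi p, g f) for a fixed g. *)
Lemma fiber_coord_open a (Q : set (B * F)) : (forall g, continuous (act g)) ->
  open Q -> (forall x, Q x -> U a x.1) ->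
  open [set x : associated S act | Q (pi_A x, fiber_coord a x)].
Proof.
move=> cact oQ QU; apply/cls_open; rewrite openE => -[p f] /=.
rewrite /preimage /= pi_A_cls /= => Qpf.
have ap : U a (pi_P p) by exact: (QU _ Qpf).
have {}Qpf : Q (pi_P p, act (frame_coord a p) f) by move: Qpf; rewrite fiber_coord_cls.
have cont : {for (p, f), continuous (fun y : frame_bundle S * F =>
    (pi_P y.1, act (frame_coord a p) y.2))}.
  apply: cvg_pair.
    apply: (@continuous_comp _ _ _ fst (@pi_P _ _ _ _ _ S)); first exact: cvg_fst.
    exact: pi_P_continuous.
  apply: (@continuous_comp _ _ _ snd (act (frame_coord a p))); first exact: cvg_snd.
  exact: cact.
have nQ : nbhs (pi_P p, act (frame_coord a p) f) Q by exact: open_nbhs_nbhs.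
have n1 := cont _ nQ.
have n2 : \forall y \near (p, f), U a (pi_P y.1) /\ frame_coord a y.1 = frame_coord a p.
  have c1 : {for (p, f), continuous (fst : frame_bundle S * F -> frame_bundle S)}.
    exact: cvg_fst.
  exact: (c1 _ (frame_coord_locally_constant ap)).
apply: (@filterS2 _ _ (nbhs_filter (p, f)) _ _ _ _ n1 n2) => -[q f'] /= Qq [aq e].
by rewrite pi_A_cls fiber_coord_cls//= e.
Qed.

Lemma mkA_continuous a f : continuous (fun b : set_type (U a) => mkA act (mkP b GL1) f).
Proof.
move=> b.
have c1 : {for b, continuous (fun b : set_type (U a) => (b, GL1 : discrete_topology (GLZ n)))}.
  by apply: continuous_pair => //; exact: cst_continuous.
have c2 : {for b, continuous (fun b : set_type (U a) => mkP b GL1)}.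
  apply: (@continuous_comp _ _ _ (fun b : set_type (U a) => (b, GL1 : discrete_topology (GLZ n)))
    (fun y => cls (@frame_glue _ _ _ _ _ S) (existT _ a y))) => //.
  apply: (@continuous_comp _ _ _ (existT _ a) (cls (@frame_glue _ _ _ _ _ S))).
    exact: existT_continuous.
  exact: cls_continuous.
have c3 : {for b, continuous (fun b : set_type (U a) => (mkP b GL1, f))}.
  by apply: continuous_pair => //; exact: cst_continuous.
apply: (@continuous_comp _ _ _ (fun b : set_type (U a) => (mkP b GL1, f))
  (cls (@associated_rel _ _ _ _ _ S _ act))) => //.
exact: cls_continuous.
Qed.

End Associated.

End Bundles.

(** * The characteristic sublattices and the collapsing tori *)

Section Segments.
Context {R : realType} {T : topologicalType} {n : nat} (M : set 'rV[R]_n).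

(** The inverse of the chart carries the segment to a connected set. *)
Lemma connected_component_segment (c : chart R T n) (A : set T) x y :
  is_chart M c -> dom c x -> dom c y ->
  (forall t : R, 0 <= t <= 1 -> exists z,
     [/\ dom c z, A z & c z = (1 - t) *: c x + t *: c y]) ->
  connected_component A x y.
Proof.
move=> Mc cx cy seg.
pose ln (t : R) : 'rV[R]_n := (1 - t) *: c x + t *: c y.
pose g t := chart_inv c (ln t).
have ln_im t : 0 <= t <= 1 -> (c @` dom c) (ln t).
  by move=> /seg[z [cz _ e]]; exists z.
have gE t z : dom c z -> c z = ln t -> g t = z.
  by move=> cz e; rewrite /g -e (chart_invK Mc cz).
have cln : continuous ln.
  move=> t; apply: cvgD.
    apply: cvgZr_tmp; apply: cvgB; [exact: cvg_cst|exact: cvg_id].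
  by apply: cvgZr_tmp; exact: cvg_id.
have cg : {within `[0, 1]%classic, continuous g}.
  apply/subspace_continuousP => t; rewrite /= in_itv /= => t01.
  have [_ _ _ /subspace_continuousP ic _] := Mc.
  have ict := ic _ (ln_im _ t01).
  move=> P nP; have := ict P nP; rewrite /within /= => nP'.
  have := cln t _ nP'; rewrite /= => nP''.
  have {}nP'' : nbhs t [set s | (c @` dom c) (ln s) -> P (g s)] by exact: nP''.
  apply: filterS nP'' => s h; rewrite in_itv /= => /ln_im; exact: h.
have K := connected_continuous_connected (@segment_connected R 0 1) cg.
have g0 : g 0 = x by apply: gE => //; rewrite /ln subr0 scale1r scale0r addr0.
have g1 : g 1 = y by apply: gE => //; rewrite /ln subrr scale1r scale0r add0r.
apply: (connected_component_max (B := g @` `[0, 1]%classic)) => //.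
- by exists 0 => //; rewrite /= in_itv /= lexx ler01.
- move=> _ [t + <-]; rewrite /= in_itv /= => /seg[z [cz Az e]].
  by rewrite (gE t z).
- by exists 1 => //; rewrite /= in_itv /= lexx ler01.
Qed.

Lemma chart_preimage_open (c : chart R T n) (W : set 'rV[R]_n) :
  is_chart M c -> open W -> open [set x | dom c x /\ W (c x)].
Proof.
move=> Mc oW; rewrite openE => x [cx Wx].
have n1 : nbhs x (dom c) by apply: open_nbhs_nbhs; split => //; case: Mc.
have nW : nbhs (c x) W by exact: open_nbhs_nbhs.
have n2 := chart_continuous_at Mc cx nW.
have {}n2 : nbhs x [set y | W (c y)] by exact: n2.
by apply: filterS2 n1 n2.
Qed.

End Segments.

Section Facets.
Context {R : realType} {n : nat} {B : topologicalType}.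
Context {AB : set (chart R B n)} {I : choiceType}.
Hypothesis hB : is_manifold (orthant R n) AB.
Variable S : integral_affine AB I.

Local Notation phi a := (ia_chart S a).
Local Notation U a := (dom (ia_chart S a)).

(** The strata are defined by the atlas of the smooth structure; by
    [transition_zeros] every affine chart sees the same ones. *)
Lemma facetsP a b : U a b ->
  facets AB b <-> exists i, forall j, (phi a b 0 j == 0) = (j == i).
Proof.
move=> ab; have [_ _ [AC ACov _]] := hB.
have zE c : AB c -> dom c b ->
    #|[set i | c b 0 i != 0]%SET| = #|[set i | phi a b 0 i != 0]%SET|.
  move=> Ac cb; have [Ma tr] := ia_chartP S a; have [t1 t2] := tr c Ac.
  exact: (transition_zeros (AC _ Ac) Ma t2 t1).
have cE : (#|[set i | phi a b 0%R i == 0%R]%SET| + #|[set i | phi a b 0%R i != 0%R]%SET| = n)%N.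
  rewrite -[RHS]card_ord -(cardsC [set i | phi a b 0 i == 0]%SET); congr (_ + _)%N.
  by apply: eq_card => i; rewrite !inE.
split.
  move=> [k kn [c Ac [cb ck]]]; move: kn => /= kn.
  have : #|[set i | phi a b 0 i == 0]%SET| == 1%N.
    by rewrite -(eqn_add2r #|[set i | phi a b 0 i != 0]%SET|) cE -(zE c)// ck add1n kn.
  by move=> /cards1P[i /setP e]; exists i => j; have := e j; rewrite !inE.
move=> [i iP]; have [c Ac cb] : (\bigcup_(c in AB) dom c) b by rewrite ACov.
exists #|[set i | phi a b 0 i != 0]%SET|.
  rewrite /= -add1n -[RHS]cE; congr (_ + _)%N; apply/esym/eqP/cards1P; exists i.
  by apply/setP => j; rewrite !inE.
by exists c => //; split => //; exact: zE.
Qed.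

(** A piece of the i-th facet near [x0]. It is convex, hence contained in a single
    component, although the facet of a chart image need not be connected. *)
Definition facet_cell (x0 : 'rV[R]_n) (i : 'I_n) (e : R) : set 'rV[R]_n :=
  [set xi | [/\ `|xi - x0| < e, xi 0 i = 0 & forall j, j != i -> 0 < xi 0 j]].

Lemma facet_cell_local a b i (O : set B) : U a b -> phi a b 0 i = 0 -> nbhs b O ->
  exists2 e : R, 0 < e & forall xi, facet_cell (phi a b) i e xi ->
    exists b', [/\ U a b', O b', facets AB b' & phi a b' = xi].
Proof.
move=> ab bi Ob.
have /nbhs_ballP[e e0 eP] := chart_nbhs (ia_is_chart S a) ab Ob.
exists e => // xi [xie xii xij].
have xi0 : orthant R n xi.
  by move=> j; have [->|/xij/ltW//] := eqVneq j i; rewrite xii.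
have [|b' [ab' Ob' xb']] := eP xi _ xi0; first by rewrite -ball_normE /= distrC.
exists b'; split => //; apply/(facetsP ab'); exists i => j; rewrite -xb'.
by have [->|/xij] := eqVneq j i; [rewrite xii eqxx|case: ltgtP].
Qed.

Lemma facet_cell_convex x0 i e xi eta (t : R) : 0 <= t <= 1 ->
  facet_cell x0 i e xi -> facet_cell x0 i e eta ->
  facet_cell x0 i e ((1 - t) *: xi + t *: eta).
Proof.
move=> /andP[t0 t1] [xe xi0 xp] [ye yi0 yp]; split.
- have -> : (1 - t) *: xi + t *: eta - x0 = (1 - t) *: (xi - x0) + t *: (eta - x0).
    by rewrite !scalerBr addrACA -opprD -scalerDl subrK scale1r.
  apply: le_lt_trans (ler_normD _ _) _; rewrite !normrZ.
  rewrite ger0_norm ?subr_ge0// (ger0_norm t0).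
  have [->|tn0] := eqVneq t 0; first by rewrite subr0 mul1r mul0r addr0.
  have tp : 0 < t by rewrite lt_def tn0.
  have : (1 - t) * `|xi - x0| + t * `|eta - x0| < (1 - t) * e + t * e.
    by rewrite ler_ltD// ?ltr_pM2l// ler_wpM2l// ?subr_ge0// ltW.
  by rewrite -mulrDl subrK mul1r.
- by rewrite !mxE xi0 yi0 !mulr0 addr0.
- move=> j ji; rewrite !mxE.
  have [->|tn0] := eqVneq t 0; first by rewrite subr0 mul1r mul0r addr0 xp.
  rewrite ltr_wpDl// ?mulr_ge0 ?subr_ge0// ?mulr_gt0 ?yp// ?lt_def ?tn0//.
  exact/ltW/xp.
Qed.

Lemma facet_cell_connected a b i e (A : set B) : U a b ->
  (forall xi, facet_cell (phi a b) i e xi ->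
    exists b', [/\ U a b', A b' & phi a b' = xi]) ->
  forall x y, U a x -> U a y -> facet_cell (phi a b) i e (phi a x) ->
  facet_cell (phi a b) i e (phi a y) -> connected_component A x y.
Proof.
move=> ab cell x y ax ay Qx Qy.
apply: (connected_component_segment (ia_is_chart S a)) => // t t01.
by have [z [az Az e1]] := cell _ (facet_cell_convex t01 Qx Qy); exists z.
Qed.

Lemma component_eq (A C : set B) x y : is_component A C -> C x ->
  connected_component A x y -> C y.
Proof. by move=> [z Az ->] zx xy; exact: connected_component_trans zx xy. Qed.

Lemma map_mx_delta (i : 'I_n) :
  map_mx intr (delta_mx 0 i : 'rV[int]_n) = delta_mx 0 i :> 'rV[R]_n.
Proof. by apply/rowP => j; rewrite !mxE; case: (_ && _). Qed.

Lemma pairingE (xi : 'rV[R]_n) u :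
  pairing xi u = (xi *m (map_mx intr u)^T) 0 0.
Proof. by rewrite mxE; apply: eq_bigr => i _; rewrite !mxE. Qed.

Lemma pairing_delta (xi : 'rV[R]_n) i : pairing xi (delta_mx 0 i) = xi 0 i.
Proof.
rewrite /pairing (bigD1 i)//= big1 ?addr0; first by rewrite mxE !eqxx mulr1.
by move=> j ji; rewrite mxE eqxx (negbTE ji) mulr0.
Qed.

(** The cell contains small displacements of [x0] in all directions other than
    the i-th one. *)
Lemma constant_on_cell (x0 : 'rV[R]_n) i e (w : 'rV[int]_n) : 0 < e ->
  facet_cell x0 i e x0 ->
  (forall xi, facet_cell x0 i e xi -> pairing xi w = pairing x0 w) ->
  w = w 0 i *: delta_mx 0 i.
Proof.
move=> e0 Q0 wc; apply/rowP => j; rewrite !mxE eqxx /=.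
have [->|ji] := eqVneq j i; first by rewrite mulr1.
have e2 : 0 <= e / 2 by rewrite divr_ge0// ltW.
rewrite mulr0; pose xi := x0 + (e / 2) *: delta_mx 0 j.
have [_ x0i x0p] := Q0.
have Qxi : facet_cell x0 i e xi.
  split.
  - rewrite /xi addrAC subrr add0r normrZ ger0_norm//.
    apply: (@le_lt_trans _ _ (e / 2)).
      rewrite -[leRHS]mulr1 ler_wpM2l//; apply: norm_le_coord => // k.
      by rewrite mxE; case: (_ && _); rewrite ?normr1 ?normr0.
    by rewrite ltr_pdivrMr// mulr_natr mulr2n ltrDl.
  - by rewrite !mxE x0i [i == j]eq_sym (negbTE ji) andbF mulr0 addr0.
  - by move=> k ki; rewrite !mxE ltr_pwDl ?x0p// mulr_ge0//; case: (_ && _).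
have := wc _ Qxi; rewrite !pairingE /xi mulmxDl mxE.
move=> /eqP; rewrite -subr_eq0 addrAC subrr add0r -scalemxAl mxE mulf_eq0.
rewrite gt_eqF ?divr_gt0//= => /eqP h.
apply/eqP; rewrite -(intr_eq0 R); apply/eqP.
by rewrite -h -rowE !mxE.
Qed.

(** The sublattice is generated by a covector [u] of some other chart, but its
    expression [w] in the chart [a] is still constant along the facet, since the
    pairing of points and covectors is invariant up to a translation. So
    [constant_on_cell] applies to [w]. *)
Lemma char_L_coord a (l : Lambda_P S) : U a (pi_Lambda l) -> char_L l ->
  exists (i : 'I_n) (k : int), phi a (pi_Lambda l) 0 i = 0 /\
    fiber_coord a l = k *: delta_mx 0 i.
Proof.
move=> al [a' [C [u [b' [k [Cc [_ _ Cu] Cb lE]]]]]].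
move: al; rewrite {}lE /pi_Lambda /mkLambda pi_mkA pi_mkP => ab'.
have actM : forall g h l, lattice_act_discrete (GLmul g h) l =
    lattice_act_discrete g (lattice_act_discrete h l) := @lattice_actM n.
rewrite (fiber_coord_mkA actM) ?pi_mkP//.
rewrite frame_coord_mkP// GLmulg1.
set b := set_val b'.
have a'b : U a' b := set_valP b'.
have [Cfac CU] : facets AB b /\ U a' b.
  by have [z Az Ce] := Cc; move: Cb; rewrite Ce => /connected_component_sub[].
have [i iP] := (facetsP ab').1 Cfac.
pose w : 'rV[int]_n := lattice_act (glue S a a') u.
have bi : phi a b 0 i = 0 by apply/eqP; rewrite iP eqxx.
have [e e0 eP] := facet_cell_local ab' bi (ia_nbhs a'b).
have Qb : facet_cell (phi a b) i e (phi a b).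
  split => // [|j ji]; first by rewrite subrr normr0.
  rewrite lt_def (chart_model (ia_is_chart S a) ab') andbT.
  by rewrite iP.
have pairE x : U a x -> U a' x -> pairing (phi a x) w =
    pairing (phi a' x) u + pairing (ia_shift S a a') w.
  move=> ax a'x; rewrite (ia_affine ax a'x) !pairingE mulmxDl mxE; congr (_ + _).
  congr (fun_of_matrix _ 0 0); rewrite -mulmxA -trmx_mul; congr (_ *m trmx _).
  rewrite /w /lattice_act /= trmxK /real_lin -map_mxM -mulmxA mulVmx ?mulmx1//.
  exact: (svalP (ia_lin S a a')).
have Cell xi : facet_cell (phi a b) i e xi ->
    exists z, [/\ U a z, (U a' `&` facets AB) z & phi a z = xi].
  by move=> /eP[z [? ? ? ?]]; exists z.
have wE : w = w 0 i *: delta_mx 0 i.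
  apply: (constant_on_cell e0 Qb) => xi Qxi.
  have [z [az [a'z fz] zxi]] := Cell _ Qxi.
  have Cz : C z.
    apply: (component_eq Cc Cb); apply: (facet_cell_connected ab' Cell) => //.
    by rewrite zxi.
  by rewrite -zxi !pairE// !Cu.
exists i, (k * w 0 i); split => //.
rewrite -scalerA -wE /w /lattice_act.
by rewrite scalemxAl.
Qed.

(** The required component contains the cell of the i-th facet near [b]. On all
    of it the i-th coordinate vanishes, because the set where it does is open and
    closed in the union of the facets: at a point of a facet exactly one
    coordinate is zero. *)
Lemma facet_vector_delta a b i : U a b -> phi a b 0 i = 0 ->
  exists C, [/\ is_component (U a `&` facets AB) C, closure C b
    & facet_vector S a C (delta_mx 0 i)].
Proof.
move=> ab bi.
have b0 := chart_model (ia_is_chart S a) ab.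
have [e e0 eP] := facet_cell_local ab bi (@filterT _ _ (nbhs_filter b)).
have Cell xi : facet_cell (phi a b) i e xi ->
    exists z, [/\ U a z, (U a `&` facets AB) z & phi a z = xi].
  by move=> /eP[z [? ? ? ?]]; exists z.
pose pt (s : R) : 'rV[R]_n := phi a b + \row_j (if j == i then 0 else s).
have Qpt s d : 0 < s -> s < d -> facet_cell (phi a b) i d (pt s).
  move=> s0 sd; split.
  - rewrite addrAC subrr add0r; apply: le_lt_trans sd; apply: norm_le_coord => [|j].
      exact: ltW.
    by rewrite mxE; case: ifP; rewrite ?normr0 ?gtr0_norm// ltW.
  - by rewrite !mxE eqxx addr0.
  - by move=> j ji; rewrite !mxE (negbTE ji) ltr_wpDl.
have he : e / 2 < e by rewrite ltr_pdivrMr// mulr_natr mulr2n ltrDl.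
have [x1 [ax1 [_ fx1] x1E]] := Cell _ (Qpt _ _ (divr_gt0 e0 (ltr0Sn _ _)) he).
pose A := U a `&` facets AB.
exists (connected_component A x1); split.
- by exists x1.
- move=> N Nb.
  have [d d0 dP] := facet_cell_local ab bi Nb.
  pose m := Num.min d e.
  have m0 : 0 < m by rewrite lt_min d0.
  have hm : m / 2 < m by rewrite ltr_pdivrMr// mulr_natr mulr2n ltrDl.
  have mm := divr_gt0 m0 (ltr0Sn _ 1).
  have md : m <= d by rewrite ge_min lexx.
  have [z [az Nz fz zE]] := dP _ (Qpt _ d mm (lt_le_trans hm md)).
  exists z; split => //; apply: (facet_cell_connected ab Cell) => //.
    by rewrite x1E; apply: Qpt => //; exact: divr_gt0.
  rewrite zE; apply: Qpt => //; apply: lt_le_trans hm _.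
  by rewrite ge_min lexx orbT.
- split.
  + move=> k v /rowP/(_ i); rewrite !mxE !eqxx /= => kv.
    by apply/unitrPr; exists (v 0 i).
  + by move=> x ax; rewrite pairing_delta; exact: (chart_model (ia_is_chart S a) ax).
  + pose D := connected_component A x1 `&` [set x | phi a x 0 i = 0].
    have cl (j : 'I_n) : open [set x : 'rV[R]_n | x 0 j != 0].
      apply: open_comp (@open_neq R 0) => x _; exact: coord_continuous.
    have oV : open [set x : 'rV[R]_n | forall j, j != i -> x 0 j != 0].
      rewrite openE => x xP; rewrite /interior.
      have Q j : nbhs x [set y : 'rV[R]_n | j != i -> y 0 j != 0].
        have [->|ji] := eqVneq j i; first by apply: (@filterE _ _ (nbhs_filter x)) => y /eqP.
        have : nbhs x [set y : 'rV[R]_n | y 0 j != 0].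
          by apply: open_nbhs_nbhs; split => //=; exact: xP.
        by apply: filterS => y yj _.
      exact: (filter_forall (nbhs_filter x) Q).
    have inA x : connected_component A x1 x -> A x := @connected_component_sub _ A x1 x.
    have DE : D = connected_component A x1.
      apply: (@component_connected _ A x1).
      * exists x1; split; first exact: connected_component_refl.
        by rewrite /= x1E !mxE eqxx addr0.
      * exists [set x | U a x /\ forall j, j != i -> phi a x 0 j != 0].
          exact: (chart_preimage_open (ia_is_chart S a) oV).
        apply/seteqP; split => x [Cx] /=.
          move=> xi; split => //; have [ax fx] := inA _ Cx; split => // j ji.
          have [i' i'P] := (facetsP ax).1 fx.
          rewrite i'P; have := i'P i; rewrite xi eqxx => /esym/eqP <-.
          by [].
        move=> [ax xj]; split => //; have [_ fx] := inA _ Cx.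
        have [i' i'P] := (facetsP ax).1 fx.
        apply/eqP; rewrite i'P; apply/negPn/negP; rewrite eq_sym => ii'.
        by have := xj _ ii'; rewrite i'P eqxx.
      * exists (~` [set x | U a x /\ phi a x 0 i != 0]).
          apply: open_closedC.
          exact: (chart_preimage_open (ia_is_chart S a) (cl i)).
        apply/seteqP; split => x [Cx] /=.
          by move=> xi; split => // -[_]; rewrite xi eqxx.
        move=> h; split => //; have [ax _] := inA _ Cx.
        by apply/eqP/negPn/negP => h'; apply: h.
    by move=> x; rewrite -DE => -[_ /=]; rewrite pairing_delta.
Qed.

End Facets.

Lemma discrete_map_continuous {X : choiceType} {Y : topologicalType}
  (f : discrete_topology X -> Y) : continuous f.
Proof.
move=> x A /nbhs_singleton Ax; apply: (@filterS _ _ (nbhs_filter x) [set x]).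
  by move=> y ->.
exact: discrete_set1.
Qed.

Section Subtori.
Context {R : realType} {n : nat} {B : topologicalType}.
Context {AB : set (chart R B n)} {I : choiceType}.
Hypothesis hB : is_manifold (orthant R n) AB.
Variable S : integral_affine AB I.

Local Notation phi a := (ia_chart S a).
Local Notation U a := (dom (ia_chart S a)).

Let lattM : forall g h l, lattice_act_discrete (GLmul g h) l =
    lattice_act_discrete g (@lattice_act_discrete n h l) := @lattice_actM n.

(** An element [l] of the fibre over [b] is a limit of elements of the
    sublattices over nearby points, and their fibre coordinates are eventually
    equal to that of [l]. A coordinate that vanishes at points arbitrarily near
    [b] vanishes at [b]. *)
Lemma local_sublattice_coord a b (L : set (Lambda_P S)) (l : Lambda_P S) : U a b ->
  local_sublattice b L -> L l ->
  pi_Lambda l = b /\ exists (i : 'I_n) (k : int), phi a b 0 i = 0 /\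
    fiber_coord a l = k *: delta_mx 0 i.
Proof.
move=> ab [a' [C [_ _ _ ->]]] [lcl lb]; split => //.
pose V := [set x | U a x /\ forall j, phi a b 0 j != 0 -> phi a x 0 j != 0].
have oV : open V.
  apply: (chart_preimage_open (ia_is_chart S a)
    (W := [set x | forall j, phi a b 0 j != 0 -> x 0 j != 0])).
  rewrite openE => x xP; rewrite /interior.
  have Q j : nbhs x [set y : 'rV[R]_n | phi a b 0 j != 0 -> y 0 j != 0].
    have [bj|bj] := boolP (phi a b 0 j != 0); last by apply: (@filterE _ _ (nbhs_filter x)) => y h; case/negP: bj.
    have : nbhs x [set y : 'rV[R]_n | y 0 j != 0].
      apply: open_nbhs_nbhs; split => /=; last exact: xP.
      by apply: open_comp (@open_neq R 0) => y _; exact: coord_continuous.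
    by apply: filterS => y yj _.
  exact: (filter_forall (nbhs_filter x) Q).
pose Q : set (B * discrete_topology 'rV[int]_n) := V `*` [set fiber_coord a l].
have oQ : open Q.
  rewrite openE => -[x l'] [/= Vx ->]; exists (V, [set fiber_coord a l]) => //.
  by split => /=; [apply: open_nbhs_nbhs|exact: discrete_set1].
have oN := fiber_coord_open lattM (fun g => @discrete_map_continuous _ _ _) oQ
  (fun x Qx => Qx.1.1).
have Nl : nbhs l [set x | Q (pi_A x, fiber_coord a x)].
  apply: open_nbhs_nbhs; split => //; split => //=.
  by rewrite -[pi_A l]/(pi_Lambda l) lb.
have [x [[xL _] [[/= ax xj] <-]]] := lcl _ Nl.
have [i [k [xi xk]]] := char_L_coord hB ax xL.
exists i, k; split => //; apply/eqP/negPn/negP => /xj.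
by rewrite -[pi_A x]/(pi_Lambda x) xi eqxx.
Qed.

(** The section of Lambda_P over U_a with constant coordinate e_i is continuous
    and lies in the sublattices along the i-th facet, which has [b] in its
    closure. *)
Lemma local_sublattice_delta a (b : set_type (U a)) i :
  phi a (set_val b) 0 i = 0 ->
  exists2 L : set (Lambda_P S), local_sublattice (set_val b) L &
    L (mkLambda (mkP b GL1) (delta_mx 0 i)).
Proof.
move=> bi; have ab : U a (set_val b) := set_valP b.
have [C [Cc Cb Cv]] := facet_vector_delta hB ab bi.
exists (closure (@char_L _ _ _ _ _ S `&` @pi_Lambda _ _ _ _ _ S @^-1` C) `&`
  @pi_Lambda _ _ _ _ _ S @^-1` [set set_val b]); first by exists a, C.
split; last by rewrite /= /pi_Lambda /mkLambda pi_mkA pi_mkP.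
move=> N Nb.
pose m (y : set_type (U a)) := mkLambda (mkP y GL1) (delta_mx 0 i : 'rV[int]_n).
have cm : continuous m by exact: mkA_continuous.
have := cm b N Nb; rewrite /= nbhs_simpl /= => -[W [[V oV VW] Wb WN]].
have nV : nbhs (set_val b) V.
  by apply: open_nbhs_nbhs; split => //; rewrite -VW in Wb.
have [y [Cy Vy]] := Cb _ nV.
have ay : U a y.
  by have [z Az Ce] := Cc; move: Cy; rewrite Ce => /connected_component_sub[].
pose y' : set_type (U a) := exist (fun x => x \in U a) y (mem_set ay).
have y'E : set_val y' = y by rewrite set_valE.
exists (m y'); split.
  split; last by rewrite /preimage /mkset /m /pi_Lambda /mkLambda pi_mkA pi_mkP; exact: Cy.
  exists a, C, (delta_mx 0 i), y', 1; split => //.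
  by rewrite scale1r.
by apply: WN; rewrite -VW; exact: Vy.
Qed.

Lemma pi_mkT (p : frame_bundle S) t : pi_T (mkT p t) = pi_P p.
Proof. exact: pi_mkA. Qed.

Lemma fiber_coord_mkT a (p : frame_bundle S) t : U a (pi_P p) ->
  fiber_coord a (mkT p t) = torus_act (frame_coord a p) t.
Proof. exact: (fiber_coord_mkA (@torus_actM R n)). Qed.

Lemma mkT_fiber_coord a (b : set_type (U a)) (t : T_P S) : pi_T t = set_val b ->
  t = mkT (mkP b GL1) (fiber_coord a t).
Proof.
move=> tb; have pb : pi_P (mkP b GL1) = set_val b := pi_mkP b GL1.
have ab : U a (pi_P (mkP b GL1)) by rewrite pb; exact: set_valP.
apply: (fiber_ext (@torus_act1 R n) (@torus_actM R n) (a := a)).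
- by rewrite -[pi_A t]/(pi_T t) tb; exact: set_valP.
- by rewrite -[pi_A t]/(pi_T t) tb -[RHS]/(pi_T _) pi_mkT.
by rewrite (fiber_coord_mkT _ ab) frame_coord_mkP_same torus_act1.
Qed.

(** By [local_sublattice_coord] and [local_sublattice_delta] the local
    sublattices at [b] are spanned by the e_k with [phi a b 0 k = 0]. *)
Lemma subtorusP a b (t : T_P S) : U a b ->
  subtorus b t <-> pi_T t = b /\ exists v : 'rV[R]_n,
    (forall k, phi a b 0 k != 0 -> v 0 k = 0) /\ fiber_coord a t = torus_exp v.
Proof.
move=> ab; split.
  move=> [p [N [s [l [pb lL ->]]]]]; split; first by rewrite pi_mkT.
  have ap : U a (pi_P p) by rewrite pb.
  rewrite (fiber_coord_mkT _ ap) torus_act_exp.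
  exists ((\sum_i s i *: map_mx intr (l i)) *m (map_mx intr (sval (frame_coord a p)))^T).
  split => // k bk; rewrite mulmx_suml summxE big1// => i _.
  have [L Lb Ll] := lL i.
  have [_ [j [m [bj]]]] := local_sublattice_coord ab Lb Ll.
  rewrite (fiber_coord_mkA lattM)// => lE.
  rewrite -scalemxAl mxE matrix.map_trmx -map_mxM -[l i *m _]/(lattice_act_discrete _ (l i)).
  rewrite lE !mxE eqxx /=; case: eqVneq => [kj|_]; last by rewrite mulr0 mulr0.
  by move: bk; rewrite kj bj eqxx.
move=> [tb [v [v0 tv]]].
pose b' : set_type (U a) := exist (fun x => x \in U a) b (mem_set ab).
have b'E : set_val b' = b by rewrite set_valE.
pose Z : pred 'I_n := fun k => phi a b 0 k == 0.
pose e (i : 'I_#|Z|) : 'I_n := enum_val i.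
exists (mkP b' GL1), #|Z|, (fun i => v 0 (e i)), (fun i => delta_mx 0 (e i)); split.
- by rewrite pi_mkP.
- move=> i; have := local_sublattice_delta (b := b') (i := e i).
  rewrite b'E; apply; apply/eqP.
  exact: (enum_valP i).
have vE : \sum_i v 0 (e i) *: map_mx intr (delta_mx 0 (e i) : 'rV[int]_n) = v.
  under eq_bigr do rewrite map_mx_delta.
  rewrite -(big_enum_val (A := Z) (fun k => v 0 k *: (delta_mx 0 k : 'rV[R]_n))) /=.
  rewrite [RHS]row_sum_delta [RHS](bigID (mem Z)) /= [X in _ + X]big1 ?addr0//.
  by move=> k /v0 ->; rewrite scale0r.
by rewrite vE -tv; apply: mkT_fiber_coord.
Qed.

End Subtori.

(** * Toric coordinates on the canonical model *)

(** The point of C^n with actions [xi] and angles [t]. *)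
Definition polar {R : realType} {n} (xi : 'rV[R]_n) (t : torus R n) : 'rV[R]_(n + n) :=
  of_zcoord (fun k => Complex (Num.sqrt (xi 0 k)) 0 * tcoord t k).

Lemma torus_div_exp_coord {R : realType} {n} (s t : torus R n) v k :
  torus_div s t = torus_exp v -> v 0 k = 0 -> tcoord s k = tcoord t k.
Proof.
move=> e v0; have : tcoord (torus_div s t) k = 1 by rewrite e tcoord_exp v0 cis0.
by rewrite tcoord_div => /divr1_eq.
Qed.

Section Polar.
Context {R : realType} {n : nat}.
Implicit Types (xi : 'rV[R]_n) (t : torus R n).

Lemma zcoord_polar xi t k : zcoord (polar xi t) k = Complex (Num.sqrt (xi 0 k)) 0 * tcoord t k.
Proof. exact: of_zcoordK. Qed.

Lemma normc_sqrE (z : R[i]) :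
  Normc.normc z ^+ 2 = complex.Re z ^+ 2 + complex.Im z ^+ 2.
Proof. by case: z => x y /=; rewrite sqr_sqrtr// addr_ge0// sqr_ge0. Qed.

Lemma mu_polar xi t : orthant R n xi -> mu_C (polar xi t) = xi.
Proof.
move=> xi0; apply/rowP => k; rewrite mxE zcoord_polar Normc.normcM tcoord_normc mulr1.
by rewrite normc_sqrE /= expr0n addr0 sqr_sqrtr.
Qed.

(** Angles matter only where the radius is not zero; this is the relation that
    defines X, by [subtorusP]. *)
Lemma polar_eqP xi t t' : orthant R n xi ->
  polar xi t = polar xi t' <-> forall k, xi 0 k != 0 -> tcoord t k = tcoord t' k.
Proof.
move=> xi0; split => [e k xik|e].
  have := congr1 (fun z => zcoord z k) e; rewrite !zcoord_polar; apply: mulfI.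
  by rewrite eq_complex /= eqxx andbT sqrtr_eq0 -ltNge lt_def xik xi0.
apply: zcoord_inj => k; rewrite !zcoord_polar; have [xik|/e -> //] := eqVneq (xi 0 k) 0.
by rewrite xik sqrtr0 -[Complex 0 0]/(0 : R[i]) !mul0r.
Qed.

(** A vanishing coordinate gets the angle 1. *)
Lemma polar_surj (z : 'rV[R]_(n + n)) : exists t, polar (mu_C z) t = z.
Proof.
pose f k : R[i] := if zcoord z k == 0 then 1 else
  zcoord z k / Complex (Normc.normc (zcoord z k)) 0.
have norm_real (r : R) : 0 <= r -> Normc.normc (Complex r 0) = r.
  by move=> r0; rewrite /= expr0n addr0 sqrtr_sqr ger0_norm.
have nz (w : R[i]) : 0 <= Normc.normc w by case: w => x y; exact: sqrtr_ge0.
have f1 k : Normc.normc (f k) = 1.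
  rewrite /f; case: eqVneq => [_|zk]; first exact: Normc.normc1.
  rewrite Normc.normcM Normc.normcV norm_real// mulfV//.
  by apply: contra_neq zk; exact: Normc.eq0_normc.
exists (mk_torus f1); apply: zcoord_inj => k; rewrite zcoord_polar tcoord_mk mxE.
rewrite sqrtr_sqr ger0_norm// /f; case: eqVneq => [->|zk].
  by rewrite Normc.normc0 mulr1.
rewrite mulrC divfK//; apply: contra_neq zk => e.
exact: Normc.eq0_normc (congr1 (@complex.Re R) e).
Qed.

End Polar.

Section Coordinates.
Context {R : realType} {n : nat} {B : topologicalType}.
Context {AB : set (chart R B n)} {I : choiceType}.
Hypothesis hB : is_manifold (orthant R n) AB.
Variable S : integral_affine AB I.

Local Notation phi a := (ia_chart S a).
Local Notation U a := (dom (ia_chart S a)).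

Definition T_coord a (t : T_P S) : 'rV[R]_(n + n) :=
  polar (phi a (pi_T t)) (fiber_coord a t).

Lemma phi_orthant a b : U a b -> orthant R n (phi a b).
Proof. exact: chart_model (ia_is_chart S a). Qed.

Lemma X_rel_pi (t t' : T_P S) : X_rel t t' -> pi_T t = pi_T t'.
Proof. by move=> [p [s [s' [-> -> _]]]]; rewrite !pi_mkT. Qed.

Lemma X_rel_coord a (t t' : T_P S) : U a (pi_T t) -> X_rel t t' ->
  T_coord a t = T_coord a t'.
Proof.
move=> at_ tt'; have e := X_rel_pi tt'; move: at_.
have [p [s [s' [tE t'E sub]]]] := tt'.
have pE : pi_T t = pi_P p by rewrite tE pi_mkT.
rewrite /T_coord -e pE => ap; apply/(polar_eqP _ _ (phi_orthant ap)) => k bk.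
have [_ [v [v0 vE]]] := (subtorusP hB _ ap).1 sub; move: vE.
rewrite tE t'E !(fiber_coord_mkT _ ap) torus_act_div.
by move=> vE; exact/esym/(torus_div_exp_coord vE)/v0.
Qed.

Lemma T_coord_inj a (t t' : T_P S) : U a (pi_T t) -> pi_T t = pi_T t' ->
  T_coord a t = T_coord a t' -> X_rel t t'.
Proof.
move=> at_ tt'; rewrite /T_coord -tt' => /(polar_eqP _ _ (phi_orthant at_)) h.
set b := pi_T t in at_ h *.
pose b' : set_type (U a) := exist (fun x => x \in U a) b (mem_set at_).
have b'E : set_val b' = b by rewrite set_valE.
have mkE (x : T_P S) : pi_T x = b -> x = mkT (mkP b' GL1) (fiber_coord a x).
  by move=> xb; apply: mkT_fiber_coord.
have pb : pi_P (mkP b' GL1) = b by rewrite pi_mkP.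
have ab : U a (pi_P (mkP b' GL1)) by rewrite pb.
exists (mkP b' GL1), (fiber_coord a t), (fiber_coord a t'); split.
- exact: mkE.
- by apply: mkE; rewrite -tt'.
rewrite pb; apply/(subtorusP hB _ at_); split; first by rewrite pi_mkT.
rewrite (fiber_coord_mkT _ ab) frame_coord_mkP_same torus_act1.
have [v [vE v0]] := torus_exp_surj (torus_div (fiber_coord a t') (fiber_coord a t)).
exists v; split => // k bk; apply: v0; rewrite tcoord_div h// divff//.
exact: tcoord_neq0.
Qed.

Definition X_coord a (x : X_PL S) : 'rV[R]_(n + n) := T_coord a (rep x).

Lemma mu_X_cls t : mu_X (cls (@X_rel _ _ _ _ _ S) t) = pi_T t.
Proof. exact: (cls_invariant (f := @pi_T _ _ _ _ _ S) X_rel_pi). Qed.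

Lemma X_coord_cls a t : U a (pi_T t) ->
  X_coord a (cls (@X_rel _ _ _ _ _ S) t) = T_coord a t.
Proof.
apply: (cls_invariant_in (P := fun t => U a (pi_T t))) => x y.
  by move=> /X_rel_pi ->.
exact: X_rel_coord.
Qed.

Lemma mu_X_coord a x : U a (mu_X x) -> mu_C (X_coord a x) = phi a (mu_X x).
Proof. by move=> ax; rewrite /X_coord /T_coord mu_polar//; exact: phi_orthant. Qed.

Lemma X_coord_inj a x y : U a (mu_X x) -> U a (mu_X y) ->
  X_coord a x = X_coord a y -> x = y.
Proof.
move=> ax ay e; have m : mu_X x = mu_X y.
  apply: (chart_inj (ia_is_chart S a) ax ay).
  by rewrite -(mu_X_coord ax) -(mu_X_coord ay) e.
have := cls_eq (T_coord_inj ax m e).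
by rewrite (repK x) (repK y).
Qed.

End Coordinates.

(** * Topology of the canonical model *)

Section TorusTopology.
Context {R : realType} {n : nat}.

Lemma mu_C_coord (z : 'rV[R]_(n + n)) k :
  mu_C z 0 k = z 0 (lshift n k) * z 0 (lshift n k) + z 0 (rshift n k) * z 0 (rshift n k).
Proof. by rewrite mxE normc_sqrE /= -!expr2. Qed.

Lemma mu_C_orthant (z : 'rV[R]_(n + n)) : orthant R n (mu_C z).
Proof. by move=> k; rewrite mu_C_coord -!expr2 addr_ge0// sqr_ge0. Qed.

Lemma mu_C_Cr r U k : open U -> Cr r U (fun z : 'rV[R]_(n + n) => mu_C z 0 k).
Proof.
move=> oU; apply: Cr_ext (Cr_add oU
  (Cr_mul oU (Cr_coord r U (lshift n k)) (Cr_coord r U (lshift n k)))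
  (Cr_mul oU (Cr_coord r U (rshift n k)) (Cr_coord r U (rshift n k)))) => // z _.
by rewrite mu_C_coord.
Qed.

Lemma mu_C_smooth : smooth_open setT (@mu_C R n).
Proof.
apply/(smooth_open_rVP _ openT) => k; apply/smooth_openP => r.
exact: mu_C_Cr openT.
Qed.

Lemma mu_C_continuous : continuous (@mu_C R n).
Proof. by move=> z; exact: (smooth_open_continuous mu_C_smooth). Qed.

Lemma mu_C_eq0 (z : 'rV[R]_(n + n)) k : (mu_C z 0 k == 0) = (zcoord z k == 0).
Proof.
rewrite mxE sqrf_eq0; apply/eqP/eqP => [/Normc.eq0_normc//|->].
exact: Normc.normc0.
Qed.

Lemma open_nonzero (P : pred 'I_n) :
  open [set z : 'rV[R]_(n + n) | forall k, P k -> zcoord z k != 0].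
Proof.
rewrite openE => z zP; rewrite /interior.
have Q k : nbhs z [set w : 'rV[R]_(n + n) | P k -> zcoord w k != 0].
  have [Pk|Pk] := boolP (P k); last first.
    by apply: (@filterE _ _ (nbhs_filter z)) => w h; case/negP: Pk.
  have : nbhs z [set w : 'rV[R]_(n + n) | mu_C w 0 k != 0].
    apply: open_nbhs_nbhs; split => /=; last by rewrite mu_C_eq0; exact: zP.
    apply: open_comp (@open_neq R 0) => w _.
    exact: (Cr_continuous (mu_C_Cr 0 k openT)).
  by apply: filterS => w /= + _; rewrite mu_C_eq0.
exact: (filter_forall (nbhs_filter z) Q).
Qed.

Lemma torus_act_continuous (g : GLZ n) : continuous (@torus_act R n g).
Proof.
apply: continuous_comp_initial => t.
pose W := [set z : 'rV[R]_(n + n) | forall k, true -> zcoord z k != 0].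
pose f (z : 'rV[R]_(n + n)) : 'rV[R]_(n + n) :=
  of_zcoord (fun i => \prod_j zcoord z j ^ sval g i j).
have oW : open W := @open_nonzero xpredT.
have Wt : W (set_val t) by move=> k _; exact: tcoord_neq0.
have cf : {for set_val t, continuous f}.
  apply: continuous_rV => i.
  suff Cf : Cr 0 W (fun z => f z 0 i) by exact: Cr_continuous Cf Wt.
  apply: cCr_of_zcoord => // k; apply: cCr_prod => // j _.
  by apply: cCr_exprz => //; [move=> z Wz; exact: Wz|exact: cCr_zcoord].
apply: (@continuous_comp _ _ _ set_val f); first exact: initial_continuous.
exact: cf.
Qed.

Lemma torus_set_compact : compact (torus_set R n).
Proof.
have tE (z : 'rV[R]_(n + n)) : torus_set R n z <-> mu_C z = const_mx 1.
  split => [tz|/rowP h k]; first by apply/rowP => k; rewrite !mxE tz expr1n.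
  have := h k; rewrite !mxE => /eqP; rewrite sqrp_eq1 => [/eqP//|].
  by case: (zcoord z k) => x y; exact: sqrtr_ge0.
apply: bounded_closed_compact.
  exists 1; split => // x x1 z /tE h; apply: le_trans (ltW x1).
  have b (u v : R) : u * u + v * v = 1 -> `|u| <= 1.
    move=> e; rewrite -(@ler_pXn2r _ 2)// ?nnegrE// expr1n -normrX ger0_norm ?sqr_ge0//.
    by rewrite -e expr2 lerDl -expr2 sqr_ge0.
  have h' k := congr1 (fun v : 'rV[R]_n => v 0 k) h.
  apply: norm_le_coord => // j; rewrite -(splitK j).
  by case: (fintype.split j) => k /=; have := h' k; rewrite mu_C_coord mxE;
    [|rewrite addrC] => /b.
have -> : torus_set R n = \bigcap_(k in [set: 'I_n]) [set z | mu_C z 0 k = 1].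
  apply/seteqP; split => z.
    by move=> /tE h k _; rewrite /= h mxE.
  by move=> h; apply/tE/rowP => k; rewrite [RHS]mxE; exact: (h k).
apply: closed_bigI => k _.
have -> : [set z : 'rV[R]_(n + n) | mu_C z 0 k = 1] =
    (fun z : 'rV[R]_(n + n) => mu_C z 0 k) @^-1` [set 1] by [].
apply: closed_comp; last exact: closed_eq.
by move=> z _; exact: (Cr_continuous (mu_C_Cr 0 k openT)).
Qed.

Lemma torus_compact : compact [set: torus R n].
Proof.
move=> F PF _; pose G := set_val @ F.
have GK : G (torus_set R n).
  by rewrite /G /=; apply: filterE => t; exact: set_valP.
have [p [Kp clp]] := torus_set_compact (fmap_proper_filter set_val PF) GK.
pose q : torus R n := exist (fun x => x \in torus_set R n) p (mem_set Kp).
exists q; split => // A N FA [_ [[V oV <-] Vq VN]].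
have GA : G (set_val @` A) by rewrite /G /=; apply: filterS FA => t At; exists t.
have nV : nbhs p V by apply: open_nbhs_nbhs.
have [_ [[t At <-] Vt]] := clp _ _ GA nV.
by exists t; split => //; exact: VN.
Qed.

Lemma polar_continuous :
  continuous (fun p : 'rV[R]_n * torus R n => polar p.1 p.2).
Proof.
move=> [xi t]; apply: continuous_rV => j.
pose idx := match fintype.split j with inl k => k | inr k => k end.
have -> : (fun p : 'rV[R]_n * torus R n => polar p.1 p.2 0 j) =
    (fun p => Num.sqrt (p.1 0 idx) * set_val p.2 0 j).
  apply/funext => -[eta s] /=; rewrite /idx -{1 3}(splitK j).
  case: (fintype.split j) => k /=.
    by have /(congr1 (@complex.Re R)) := zcoord_polar eta s k;
      rewrite /= mul0r subr0.
  by have /(congr1 (@complex.Im R)) := zcoord_polar eta s k;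
      rewrite /= mul0r addr0.
have c1 : {for (xi, t), continuous (fun p : 'rV[R]_n * torus R n => Num.sqrt (p.1 0 idx))}.
  apply: (@continuous_comp _ _ _ (fun p : 'rV[R]_n * torus R n => p.1 0 idx) Num.sqrt).
    apply: (@continuous_comp _ _ _ fst (fun x : 'rV[R]_n => x 0 idx)); first exact: cvg_fst.
    exact: coord_continuous.
  exact: sqrt_continuous.
have c2 : {for (xi, t), continuous (fun p : 'rV[R]_n * torus R n => set_val p.2 0 j : R)}.
  apply: (@continuous_comp _ _ _ (fun p : 'rV[R]_n * torus R n => set_val p.2)
    (fun x : 'rV[R]_(n + n) => x 0 j)); last exact: coord_continuous.
  apply: (@continuous_comp _ _ _ snd set_val); first exact: cvg_snd.
  exact: initial_continuous.
exact: (cvgM c1 c2).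
Qed.

End TorusTopology.

Unset Implicit Arguments.
Section XTopology.
Context {R : realType} {n : nat} {B : topologicalType}.
Context {AB : set (chart R B n)} {I : choiceType}.
Hypothesis hB : is_manifold (orthant R n) AB.
Variable S : integral_affine AB I.

Local Notation phi a := (ia_chart S a).
Local Notation U a := (dom (ia_chart S a)).
Local Notation X := (X_PL S).

Lemma mu_X_continuous : continuous (@mu_X R n B AB I S).
Proof.
apply/quotient_continuous; rewrite (_ : _ \o _ = @pi_T _ _ _ _ _ S).
  exact: pi_A_continuous.
by apply/funext => t; exact: mu_X_cls.
Qed.

Lemma X_dom_open a : open [set x : X | U a (mu_X x)].
Proof.
have /continuousP h := mu_X_continuous.
exact: (h _ (ia_open S a)).
Qed.

Lemma X_coord_open a (W : set 'rV[R]_(n + n)) : open W ->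
  open [set x : X | U a (mu_X x) /\ W (X_coord a x)].
Proof.
move=> oW.
pose Q : set (B * torus R n) := [set p | U a p.1 /\ W (polar (phi a p.1) p.2)].
have oQ : open Q.
  rewrite openE => -[b t] [/= ab Wb].
  have c1 : {for (b, t), continuous (fun p : B * torus R n => (phi a p.1, p.2))}.
    apply: continuous_pair; last exact: cvg_snd.
    apply: (@continuous_comp _ _ _ fst (phi a)); first exact: cvg_fst.
    exact: (chart_continuous_at (ia_is_chart S a)).
  have c2 : {for (b, t), continuous (fun p : B * torus R n => polar (phi a p.1) p.2)}.
    apply: (@continuous_comp _ _ _ (fun p : B * torus R n => (phi a p.1, p.2))
      (fun p : 'rV[R]_n * torus R n => polar p.1 p.2)) => //.
    exact: polar_continuous.
  have c3 : {for (b, t), continuous (fst : B * torus R n -> B)} by exact: cvg_fst.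
  have nW : nbhs (polar (phi a b) t) W by exact: open_nbhs_nbhs.
  exact: (@filterI _ _ (nbhs_filter (b, t)) _ _ (c3 _ (ia_nbhs ab)) (c2 _ nW)).
have oT := fiber_coord_open (@torus_actM R n) (@torus_act_continuous R n) oQ (fun x Qx => Qx.1).
have e : cls (@X_rel _ _ _ _ _ S) @^-1` [set x : X | U a (mu_X x) /\ W (X_coord a x)] =
    [set t : T_P S | Q (pi_A t, fiber_coord a t)].
  apply/seteqP; split => t.
    rewrite /preimage /mkset mu_X_cls => -[at_].
    by rewrite (X_coord_cls hB at_).
  move=> [at_ Wt]; rewrite /preimage /mkset mu_X_cls; split; first exact: at_.
  by rewrite (X_coord_cls hB at_).
rewrite -e in oT.
exact: (proj2 (@cls_open (T_P S) (@X_rel _ _ _ _ _ S) _) oT).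
Qed.

Lemma X_class_continuous a :
  continuous (fun p : set_type (U a) * torus R n =>
    cls (@X_rel _ _ _ _ _ S) (mkT (mkP p.1 GL1) p.2)).
Proof.
move=> [b t].
have c1 : {for (b, t), continuous (fun p : set_type (U a) * torus R n =>
    (p.1, GL1 : discrete_topology (GLZ n)))}.
  by apply: continuous_pair; [exact: cvg_fst|exact: cst_continuous].
have c2 : {for (b, t), continuous (fun p : set_type (U a) * torus R n => mkP p.1 GL1)}.
  apply: (@continuous_comp _ _ _ (fun p : set_type (U a) * torus R n =>
      (p.1, GL1 : discrete_topology (GLZ n)))
    (fun y => cls (@frame_glue _ _ _ _ _ S) (existT _ a y))) => //.
  apply: (@continuous_comp _ _ _ (existT _ a) (cls (@frame_glue _ _ _ _ _ S))).
    exact: existT_continuous.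
  exact: cls_continuous.
have c3 : {for (b, t), continuous (fun p : set_type (U a) * torus R n => (mkP p.1 GL1, p.2))}.
  by apply: continuous_pair; [exact: c2|exact: cvg_snd].
apply: (@continuous_comp _ _ _ (fun p : set_type (U a) * torus R n => mkT (mkP p.1 GL1) p.2)
  (cls (@X_rel _ _ _ _ _ S))); last exact: cls_continuous.
apply: (@continuous_comp _ _ _ (fun p : set_type (U a) * torus R n => (mkP p.1 GL1, p.2))
  (cls (@associated_rel _ _ _ _ _ S _ (@torus_act R n)))) => //.
exact: cls_continuous.
Qed.

Lemma mu_X_mk a (b : set_type (U a)) t :
  mu_X (cls (@X_rel _ _ _ _ _ S) (mkT (mkP b GL1) t)) = set_val b.
Proof. by rewrite mu_X_cls pi_mkT pi_mkP. Qed.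

Lemma X_coord_mk a (b : set_type (U a)) t :
  X_coord a (cls (@X_rel _ _ _ _ _ S) (mkT (mkP b GL1) t)) =
  polar (phi a (set_val b)) t.
Proof.
have pb : pi_P (mkP b GL1) = set_val b := pi_mkP b GL1.
have ab : U a (pi_P (mkP b GL1)) by rewrite pb; exact: set_valP.
have ab' : U a (pi_T (mkT (mkP b GL1) t)) by rewrite pi_mkT.
rewrite (X_coord_cls hB ab') /T_coord pi_mkT pb (fiber_coord_mkT _ ab).
by rewrite frame_coord_mkP_same torus_act1.
Qed.

(** A value z near the coordinate of [x0] determines a base point near that of
    [x0], but its angles may be far from any chosen angles [t0] of [x0]. Near each
    [t0] in the torus, either [t0] represents [x0], and continuity of the quotient
    map gives the claim, or no angles near [t0] are those of a value z near the
    coordinate of [x0]. Compactness of the torus makes the choice of neighbourhoods finite. *)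
Lemma X_coord_inverse_near a x0 (N : set X) : U a (mu_X x0) -> nbhs x0 N ->
  \forall z \near X_coord a x0, forall x, U a (mu_X x) -> X_coord a x = z -> N x.
Proof.
move=> ax0 Nx0; set z0 := X_coord a x0; set b0 := mu_X x0 in ax0.
have mz0 : mu_C z0 = phi a b0 by exact: mu_X_coord.
pose q (p : set_type (U a) * torus R n) := cls (@X_rel _ _ _ _ _ S) (mkT (mkP p.1 GL1) p.2).
pose P (z : 'rV[R]_(n + n)) (t : torus R n) := forall b : set_type (U a),
  phi a (set_val b) = mu_C z -> polar (mu_C z) t = z -> N (q (b, t)).
have cov : \forall z \near z0, [set: torus R n] `<=` P z.
  have /compact_near_coveringP := @torus_compact R n.
  move=> /(_ _ (nbhs z0) P (nbhs_filter z0)); apply => t0 _.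
  have cpol : {for (t0, z0), continuous
      (fun p : torus R n * 'rV[R]_(n + n) => polar (mu_C p.2) p.1 - p.2)}.
    apply: cvgB; last exact: cvg_snd.
    apply: (@continuous_comp _ _ _ (fun p : torus R n * 'rV[R]_(n + n) => (mu_C p.2, p.1))
      (fun p : 'rV[R]_n * torus R n => polar p.1 p.2)); last exact: polar_continuous.
    apply: continuous_pair; last exact: cvg_fst.
    apply: (@continuous_comp _ _ _ snd (@mu_C R n)); first exact: cvg_snd.
    exact: mu_C_continuous.
  have [e0|ne0] := eqVneq (polar (mu_C z0) t0) z0; last first.
    have := cvgr_neq0 _ cpol; rewrite /= subr_eq0 => /(_ (nbhs_filter (t0, z0)) ne0).
    apply: (@filterS _ _ (nbhs_filter (t0, z0))) => -[t z] /= h b _ e.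
    by rewrite e subrr eqxx in h.
  pose b0' : set_type (U a) := exist (fun x => x \in U a) b0 (mem_set ax0).
  have b0E : set_val b0' = b0 by rewrite set_valE.
  have qx0 : q (b0', t0) = x0.
    have aq : U a (mu_X (q (b0', t0))) by rewrite mu_X_mk; exact: set_valP.
    have e : X_coord a (q (b0', t0)) = X_coord a x0.
      by rewrite X_coord_mk b0E -mz0; exact: e0.
    exact: (X_coord_inj hB aq ax0 e).
  have nN : nbhs (q (b0', t0)) N by rewrite qx0; exact: Nx0.
  have cN : nbhs (b0', t0) [set p | N (q p)] := X_class_continuous a (b0', t0) N nN.
  case: cN => -[V O] [nVV nO] VO.
  case: nVV => _ [[V' oV' <-] V'b VV].
  have nV : nbhs b0 V' by apply: open_nbhs_nbhs; split => //.
  have nz : \forall z \near z0, forall b, U a b -> phi a b = mu_C z -> V' b.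
    have nb := chart_nbhs (ia_is_chart S a) ax0 nV.
    rewrite -/b0 -mz0 in nb.
    have := @mu_C_continuous R n z0 _ nb.
    apply: (@filterS _ _ (nbhs_filter z0)) => z h b ab bz.
    have [b' [ab' Vb' e]] := h (mu_C_orthant z).
    by rewrite (chart_inj (ia_is_chart S a) ab ab')// bz.
  exists (O, [set z | forall b, U a b -> phi a b = mu_C z -> V' b]) => //.
  move=> [t z] /= [Ot Vz] b bz _.
  by apply: (VO (b, t)); split => //=; apply: VV; exact: (Vz _ (set_valP b) bz).
apply: (@filterS _ _ (nbhs_filter z0)) cov => z cov x ax xz.
pose b' : set_type (U a) := exist (fun x => x \in U a) (mu_X x) (mem_set ax).
have b'E : set_val b' = mu_X x by rewrite set_valE.
have bz : phi a (set_val b') = mu_C z by rewrite b'E -mu_X_coord// xz.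
have [t tz] := polar_surj z.
have := cov t Logic.I b' bz tz.
have aq : U a (mu_X (q (b', t))) by rewrite mu_X_mk; exact: set_valP.
have e : X_coord a (q (b', t)) = X_coord a x by rewrite X_coord_mk bz tz xz.
by rewrite (X_coord_inj hB aq ax e).
Qed.

End XTopology.
Set Implicit Arguments.

Section RationalBoxes.
Context {R : realType} {m : nat}.

Definition rational_box (q : {ffun 'I_m -> rat * rat}) : set 'rV[R]_m :=
  [set x | forall i, ratr (q i).1 < x 0 i < ratr (q i).2].

Lemma rational_box_open q : open (rational_box q).
Proof.
rewrite openE => x xq; rewrite /interior.
have Q i : nbhs x [set y : 'rV[R]_m | ratr (q i).1 < y 0 i < ratr (q i).2].
  apply: open_nbhs_nbhs; split; last exact: xq.
  have -> : [set y : 'rV[R]_m | ratr (q i).1 < y 0 i < ratr (q i).2] =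
      (fun y : 'rV[R]_m => y 0 i) @^-1` [set` `]ratr (q i).1, ratr (q i).2[%R].
    by apply/seteqP; split => y; rewrite /= in_itv.
  apply: open_comp; last exact: interval_open.
  by move=> y _; exact: coord_continuous.
exact: (filter_forall (nbhs_filter x) Q).
Qed.

Lemma rational_box_nbhs x (N : set 'rV[R]_m) : nbhs x N ->
  exists2 q, rational_box q x & rational_box q `<=` N.
Proof.
move=> /nbhs_ballP[e e0 eN].
have /choice[f fP] : forall i, exists p : rat * rat,
    x 0 i - e / 2 < ratr p.1 < x 0 i /\ x 0 i < ratr p.2 < x 0 i + e / 2.
  move=> i; have e2 : 0 < e / 2 by rewrite divr_gt0.
  have /rat_in_itvoo[p1 h1] : x 0 i - e / 2 < x 0 i by rewrite ltrBlDr ltrDl.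
  have /rat_in_itvoo[p2 h2] : x 0 i < x 0 i + e / 2 by rewrite ltrDl.
  by exists (p1, p2); split => /=; [move: h1|move: h2]; rewrite in_itv.
exists [ffun i => f i] => [i|y yq].
  by rewrite ffunE; have [/andP[_ ->] /andP[->]] := fP i.
apply: eN; rewrite -ball_normE /=; apply: (@le_lt_trans _ _ (e / 2)).
  apply: norm_le_coord => [|i]; first by rewrite divr_ge0// ltW.
  have := yq i; rewrite ffunE !mxE ler_norml => /andP[h1 h2].
  by have [/andP[h3 h4] /andP[h5 h6]] := fP i; apply/andP; split; lra.
by rewrite ltr_pdivrMr// mulr_natr mulr2n ltrDl.
Qed.

End RationalBoxes.

Unset Implicit Arguments.
Section XManifold.
Context {R : realType} {n : nat} {B : topologicalType}.
Context {AB : set (chart R B n)} {I : choiceType}.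
Hypothesis hB : is_manifold (orthant R n) AB.
Variable S : integral_affine AB I.

Local Notation phi a := (ia_chart S a).
Local Notation U a := (dom (ia_chart S a)).
Local Notation X := (X_PL S).

Definition X_chart_inv a (x0 : X) (z : 'rV[R]_(n + n)) : X :=
  if pselect (exists x : X, U a (mu_X x) /\ X_coord a x = z) is left h
  then sval (cid h) else x0.

(** The point [x0] is the value of the inverse off the image of the chart. *)
Definition X_chart a (x0 : X) : chart R X (n + n) :=
  Chart [set x : X | U a (mu_X x)] (X_coord a) (X_chart_inv a x0).

Lemma X_chart_invK a x0 x : U a (mu_X x) -> X_chart_inv a x0 (X_coord a x) = x.
Proof.
move=> ax; rewrite /X_chart_inv; case: pselect => [h|]; last by case; exists x.
have [ay e] := svalP (cid h).
exact: (X_coord_inj hB ay ax e).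
Qed.

Lemma X_coord_image a :
  @X_coord _ _ _ _ _ S a @` [set x : X | U a (mu_X x)] =
  @mu_C R n @^-1` (phi a @` U a).
Proof.
apply/seteqP; split => z.
  by move=> [x ax <-]; rewrite /preimage /= (mu_X_coord ax); exists (mu_X x).
move=> [b ab bz]; have [t tz] := polar_surj z.
pose b' : set_type (U a) := exist (fun x => x \in U a) b (mem_set ab).
have b'E : set_val b' = b by rewrite set_valE.
exists (cls (@X_rel _ _ _ _ _ S) (mkT (mkP b' GL1) t)).
  by rewrite /mkset mu_X_mk b'E.
by rewrite (X_coord_mk hB) b'E bz.
Qed.

Lemma X_coord_continuous_at a x : U a (mu_X x) -> {for x, continuous (@X_coord _ _ _ _ _ S a)}.
Proof.
move=> ax W; rewrite nbhsE => -[W' [oW' Wx] WW'].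
have N : nbhs x [set y : X | U a (mu_X y) /\ W' (X_coord a y)].
  by apply: open_nbhs_nbhs; split; [exact: (X_coord_open hB)|split].
by apply: (@filterS _ _ (nbhs_filter x)) N => y [_ Wy]; exact: WW'.
Qed.

Lemma X_chart_inv_continuous a x0 :
  {within @X_coord _ _ _ _ _ S a @` [set x : X | U a (mu_X x)],
    continuous (X_chart_inv a x0)}.
Proof.
apply/subspace_continuousP => z [x ax <-] N Nx.
have {}Nx : nbhs x N.
  by have := X_chart_invK a x0 x ax => <-; exact: Nx.
have Nz := X_coord_inverse_near hB S a x N ax Nx.
apply: (@filterS _ _ (nbhs_filter (X_coord a x)) _ _ _ Nz) => w h [y ay yw].
have e : X_chart_inv a x0 w = y by rewrite -yw; exact: X_chart_invK.
have := h y ay yw; rewrite -e; exact.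
Qed.

Lemma X_chart_is_chart a x0 : is_chart setT (X_chart a x0).
Proof.
split.
- exact: X_dom_open.
- by move=> x /set_mem ax; exact: X_chart_invK.
- apply/subspace_continuousP => x ax W Wx.
  have N := X_coord_continuous_at a x ax W Wx.
  have {}N : nbhs x [set y | W (X_coord a y)] by exact: N.
  by apply: (@filterS _ _ (nbhs_filter x)) N => y Wy _.
- exact: X_chart_inv_continuous.
have [_ _ _ _ [W oW cW]] := ia_is_chart S a.
exists (@mu_C R n @^-1` W).
  by apply: open_comp oW => z _; exact: mu_C_continuous.
rewrite setIT -[LHS]/(@X_coord _ _ _ _ _ S a @` [set x : X | U a (mu_X x)]).
rewrite X_coord_image cW; apply/seteqP; split => z; first by case.
by move=> Wz; split => //; exact: mu_C_orthant.
Qed.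

(** Points over distinct base points are separated by mu; otherwise one chart
    contains both. *)
Lemma X_hausdorff : hausdorff_space X.
Proof.
have [hausB _ _] := hB.
move=> x y xy; have m : mu_X x = mu_X y.
  apply: hausB => A C Ax Cy.
  have [z [Az Cz]] := xy _ _ (mu_X_continuous S x A Ax) (mu_X_continuous S y C Cy).
  by exists (mu_X z).
have [a ax] := ia_coverP S (mu_X x).
have ay : U a (mu_X y) by rewrite -m.
apply: (X_coord_inj hB ax ay); apply: (@norm_hausdorff R 'rV[R]_(n + n)) => A C Ax Cy.
have [z [Az Cz]] := xy _ _ (X_coord_continuous_at a x ax A Ax) (X_coord_continuous_at a y ay C Cy).
by exists (X_coord a z).
Qed.

(** A basis of the base refines the cover by affine charts; each of its sets is
    assigned one such chart. *)
Lemma X_second_countable : @second_countable X.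
Proof.
have [_ [BB cBB [oBB BBP]] _] := hB.
pose f (p : set B * {ffun 'I_(n + n) -> rat * rat}) : set X :=
  if pselect (exists a, p.1 `<=` U a) is left h then
    [set x : X | p.1 (mu_X x)] `&` [set x : X | U (sval (cid h)) (mu_X x) /\
      rational_box p.2 (X_coord (sval (cid h)) x)]
  else set0.
have cf : countable (f @` (BB `*` setT)).
  exact: (sub_countable (card_image_le _ _) (countableX cBB (countableP _))).
exists (f @` (BB `*` setT)); first exact: cf.
split => [_ [[V q] [BV _] <-]|x N Nx].
  rewrite /f; case: pselect => [h|_]; last exact: open0.
  have o2 := X_coord_open hB S (sval (cid h)) (rational_box q) (@rational_box_open _ _ q).
  apply: openI; last exact: o2.
  have /continuousP c := mu_X_continuous S.
  exact: (c _ (oBB _ BV)).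
have [a ax] := ia_coverP S (mu_X x).
have [V [BV Vx] VU] := BBP _ _ (ia_nbhs ax).
have h : exists a, V `<=` U a by exists a.
pose a' := sval (cid h).
have VU' : V `<=` U a' := svalP (cid h).
have [q qx qN] := rational_box_nbhs (X_coord_inverse_near hB S a' x N (VU' _ Vx) Nx).
have fE : f (V, q) = [set x : X | V (mu_X x)] `&` [set x : X | U a' (mu_X x) /\
      rational_box q (X_coord a' x)].
  rewrite /f; case: pselect => [h'|nh]; last by case: (nh h).
  by rewrite (Prop_irrelevance h' h).
exists (f (V, q)).
  split; first by exists (V, q).
  rewrite fE; split; first exact: Vx.
  by split; [exact: VU'|exact: qx].
rewrite fE => y [_ [ay qy]]; exact: (qN _ qy y ay erefl).
Qed.

End XManifold.
Set Implicit Arguments.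

(** * Smoothness of the coordinate changes *)

(** [derive_orthant_min] for affine functions, whose partial derivatives are
    their coefficients. *)
Lemma affine_orthant_cone {R : realType} {n} (x0 : 'rV[R]_n) (w : 'rV[R]_n) (c : R) :
  orthant R n x0 -> \sum_k x0 0 k * w 0 k + c = 0 ->
  (\forall xi \near x0, orthant R n xi -> 0 <= \sum_k xi 0 k * w 0 k + c) ->
  forall k, 0 <= w 0 k /\ (x0 0 k != 0 -> w 0 k = 0).
Proof.
move=> x00 e near0 k; pose f (xi : 'rV[R]_n) : R := \sum_k xi 0 k * w 0 k + c.
have Cf : Cr 1 setT f.
  apply: (Cr_add openT); last exact: Cr_cst.
  by apply: (Cr_sum openT) => l; apply: (Cr_mul openT); [exact: Cr_coord|exact: Cr_cst].
have df : differentiable f x0 := Cr_differentiable openT Cf Logic.I.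
have Df : 'D_(delta_mx 0 k) f x0 = w 0 k.
  have H t : f (t *: delta_mx 0 k + x0) - f x0 = t *: w 0 k.
    rewrite /f opprD addrACA subrr addr0 -sumrB (bigD1 k)//= big1 ?addr0 => [|l lk].
      by rewrite !mxE !eqxx mulr1 mulrDl addrK.
    by rewrite !mxE (negbTE lk) mulr0 add0r subrr.
  by have [_ ->] := derive_line H.
rewrite -Df; apply: derive_orthant_min df x00 _.
by apply: filterS near0 => xi h /h; rewrite /f e.
Qed.

Section TransitionStructure.
Context {R : realType} {n : nat} {B : topologicalType}.
Context {AB : set (chart R B n)} {I : choiceType}.
Variable S : integral_affine AB I.

Local Notation phi a := (ia_chart S a).
Local Notation U a := (dom (ia_chart S a)).

Lemma ia_coordE a b x i : U a x -> U b x ->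
  phi a x 0 i = \sum_k phi b x 0 k * (sval (ia_lin S a b) i k)%:~R + ia_shift S a b 0 i.
Proof.
move=> ax bx; rewrite (ia_affine ax bx) !mxE; congr (_ + _).
by apply: eq_bigr => k _; rewrite !mxE.
Qed.

(** The i-th coordinate in the chart [a] is an affine function of the coordinates
    in the chart [b], and is minimal at [x]. *)
Lemma transition_cone a b x i k : U a x -> U b x -> phi a x 0 i = 0 ->
  0 <= sval (ia_lin S a b) i k /\ (phi b x 0 k != 0 -> sval (ia_lin S a b) i k = 0).
Proof.
move=> ax bx xi.
pose w : 'rV[R]_n := \row_k (sval (ia_lin S a b) i k)%:~R.
have wE xi' : \sum_k xi' 0 k * w 0 k = \sum_k xi' 0 k * (sval (ia_lin S a b) i k)%:~R.
  by apply: eq_bigr => l _; rewrite mxE.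
have := @affine_orthant_cone _ _ (phi b x) w (ia_shift S a b 0 i)
  (chart_model (ia_is_chart S b) bx).
rewrite wE -ia_coordE// => /(_ xi) H.
have {H} : 0 <= w 0 k /\ (phi b x 0 k != 0 -> w 0 k = 0).
  apply: H; have := chart_nbhs (ia_is_chart S b) bx (ia_nbhs ax).
  apply: filterS => xi' h /h[y [by_ ay ->]].
  rewrite wE -ia_coordE//; exact: (chart_model (ia_is_chart S a) ay).
rewrite mxE ler0z => -[? h]; split => // /h /eqP; rewrite intr_eq0; exact: eqP.
Qed.

Lemma ia_lin_inv a b x : U a x -> U b x ->
  sval (ia_lin S a b) *m sval (ia_lin S b a) = 1%:M.
Proof.
move=> ax bx; have := ia_lin_cocycle ax bx ax; rewrite (ia_lin_refl ax).
by move=> /(congr1 sval).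
Qed.

Lemma glueE a b x : U a x -> U b x -> sval (glue S a b) = (sval (ia_lin S b a))^T.
Proof.
move=> ax bx; rewrite /glue /=; congr trmx.
have ua : sval (ia_lin S a b) \in unitmx := svalP (ia_lin S a b).
by rewrite -[LHS]mulmx1 -(ia_lin_inv ax bx) mulmxA mulVmx// mul1mx.
Qed.

(** By [transition_cone] the two linear parts satisfy the hypotheses of
    [nonneg_inverse_monomial]; the entries at matched positions are nonnegative
    integers with product 1, hence 1. *)
Lemma transition_facets a b x i : U a x -> U b x -> phi a x 0 i = 0 ->
  exists j, [/\ phi b x 0 j = 0,
    forall k, sval (ia_lin S a b) i k = (k == j)%:R
    & forall k, phi b x 0 k = 0 -> sval (glue S a b) i k = (k == j)%:R].
Proof.
move=> ax bx xi.
pose Z c : pred 'I_n := fun k => phi c x 0 k == 0.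
have mono c d : U c x -> U d x -> forall i, Z c i -> exists j,
    [/\ Z d j, forall k, sval (ia_lin S c d) i k = (k == j)%:R
      & forall k, sval (ia_lin S d c) j k = (k == i)%:R].
  move=> cx dx i' Zi.
  have [||||| j [Zj h1 h2 h3]] := @nonneg_inverse_monomial _ _ (sval (ia_lin S c d))
    (sval (ia_lin S d c)) (Z d) (Z c) _ _ _ _ _ i' Zi.
  - exact: ia_lin_inv cx dx.
  - exact: ia_lin_inv dx cx.
  - by move=> l k /eqP Zl; exact: (transition_cone k cx dx Zl).1.
  - by move=> l k /eqP Zl; exact: (transition_cone k cx dx Zl).2.
  - by move=> l k /eqP Zl; exact: (transition_cone k dx cx Zl).1.
  have p1 : 0 <= sval (ia_lin S c d) i' j by exact: (transition_cone _ cx dx (eqP Zi)).1.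
  have p2 : 0 <= sval (ia_lin S d c) j i' by exact: (transition_cone _ dx cx (eqP Zj)).1.
  have [e1 e2] : sval (ia_lin S c d) i' j = 1 /\ sval (ia_lin S d c) j i' = 1.
    move: h3 p1 p2; case: (sval (ia_lin S c d) i' j) => u; case: (sval (ia_lin S d c) j i') => v //= h _ _.
    have : (u * v = 1)%N by move: h; rewrite -PoszM => -[].
    by move=> /eqP; rewrite muln_eq1 => /andP[/eqP-> /eqP->].
  exists j; split => // k.
    by have [->|/h1] := eqVneq k j; [rewrite e1|].
  by have [->|/h2] := eqVneq k i'; [rewrite e2|].
have [j [Zj r1 r1']] := mono a b ax bx i (introT eqP xi).
exists j; split => // [|k xk]; first exact/eqP.
have [i' [_ r2 r3]] := mono b a bx ax k (introT eqP xk).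
rewrite (glueE ax bx) mxE.
have [->|kj] := eqVneq k j; first by rewrite r1' eqxx.
rewrite r2; have [ii'|//] := eqVneq i i'.
by have := r3 k; rewrite -ii' r1 eqxx (negbTE kj).
Qed.

Lemma transition_nonfacets a b x i k : U a x -> U b x -> phi a x 0 i != 0 ->
  phi b x 0 k = 0 -> sval (glue S a b) i k = 0.
Proof.
move=> ax bx xi xk; rewrite (glueE ax bx) mxE.
exact: (transition_cone i bx ax xk).2.
Qed.

Lemma fiber_coord_change a b (t : T_P S) : U a (pi_T t) -> U b (pi_T t) ->
  fiber_coord a t = torus_act (glue S a b) (fiber_coord b t).
Proof.
move=> at_ bt; pose b' : set_type (U b) := exist (fun x => x \in U b) (pi_T t) (mem_set bt).
have b'E : set_val b' = pi_T t by rewrite set_valE.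
rewrite {1}(mkT_fiber_coord (esym b'E)) fiber_coord_mkT ?pi_mkP ?b'E//.
by rewrite frame_coord_mkP ?b'E// GLmulg1.
Qed.

End TransitionStructure.

Unset Implicit Arguments.
Section TransitionSmooth.
Context {R : realType} {n : nat} {B : topologicalType}.
Context {AB : set (chart R B n)} {I : choiceType}.
Hypothesis hB : is_manifold (orthant R n) AB.
Variable S : integral_affine AB I.

Local Notation phi a := (ia_chart S a).
Local Notation U a := (dom (ia_chart S a)).
Local Notation X := (X_PL S).

Definition affine_mu a b i (z : 'rV[R]_(n + n)) : R :=
  \sum_k mu_C z 0 k * (sval (ia_lin S a b) i k)%:~R + ia_shift S a b 0 i.

Lemma affine_mu_Cr r W a b i : open W -> Cr r W (affine_mu a b i).
Proof.
move=> oW; apply: Cr_add => //; last exact: Cr_cst.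
apply: Cr_sum => // k; apply: Cr_mul => //; [exact: mu_C_Cr|exact: Cr_cst].
Qed.

Lemma affine_mu_coord a b (y : X) i : U a (mu_X y) -> U b (mu_X y) ->
  affine_mu a b i (X_coord b y) = phi a (mu_X y) 0 i.
Proof. by move=> ay by_; rewrite /affine_mu (mu_X_coord by_) -ia_coordE. Qed.

Lemma open_affine_mu_gt0 a b (P : pred 'I_n) :
  open [set z | forall i, P i -> 0 < affine_mu a b i z].
Proof.
rewrite openE => z zP; rewrite /interior.
have Q i : nbhs z [set w | P i -> 0 < affine_mu a b i w].
  have [Pi|Pi] := boolP (P i); last first.
    by apply: (@filterE _ _ (nbhs_filter z)) => w h; case/negP: Pi.
  have : nbhs z [set w | 0 < affine_mu a b i w].
    apply: open_nbhs_nbhs; split => /=; last exact: zP.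
    apply: open_comp (@open_gt R 0) => w _.
    exact: (Cr_continuous (affine_mu_Cr 0 setT a b i openT)).
  by apply: filterS => w h _.
exact: (filter_forall (nbhs_filter z) Q).
Qed.

(** The coordinate change near a point [x]. A coordinate vanishing at [x] is
    carried to the matching one, multiplied by a monomial in the phases of the
    coordinates that do not vanish at [x]; this is smooth across the locus where
    the angles are undefined. *)
Lemma X_coord_change_near a b (x : X) : U a (mu_X x) -> U b (mu_X x) ->
  exists W f, [/\ open W, W (X_coord b x), smooth_open W f &
    forall y : X, U a (mu_X y) -> U b (mu_X y) -> W (X_coord b y) ->
      f (X_coord b y) = X_coord a y :> 'rV[R]_(n + n)].
Proof.
move=> ax bx; set xa := phi a (mu_X x); set xb := phi b (mu_X x).
have /choice[s sP] : forall i, exists j, xa 0 i = 0 -> [/\ xb 0 j = 0,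
    forall k, sval (ia_lin S a b) i k = (k == j)%:R
    & forall k, xb 0 k = 0 -> sval (glue S a b) i k = (k == j)%:R].
  move=> i; have [xi|xi] := eqVneq (xa 0 i) 0; last first.
    by exists i => e; rewrite e eqxx in xi.
  by have [j h] := transition_facets ax bx xi; exists j.
pose W1 := [set z : 'rV[R]_(n + n) | forall k, xb 0 k != 0 -> zcoord z k != 0].
pose W2 := [set z : 'rV[R]_(n + n) | forall i, xa 0 i != 0 -> 0 < affine_mu a b i z].
pose W := W1 `&` W2.
have oW : open W.
  apply: openI; first exact: (@open_nonzero R n (fun k => xb 0 k != 0)).
  exact: (open_affine_mu_gt0 a b (fun i => xa 0 i != 0)).
pose phase (z : 'rV[R]_(n + n)) k := zcoord z k * Complex ((Num.sqrt (mu_C z 0 k))^-1) 0.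
pose radial (z : 'rV[R]_(n + n)) i := if xa 0 i == 0 then zcoord z (s i)
  else Complex (Num.sqrt (affine_mu a b i z)) 0.
pose f (z : 'rV[R]_(n + n)) : 'rV[R]_(n + n) := of_zcoord (fun i =>
  radial z i * \prod_(k | xb 0 k != 0) phase z k ^ sval (glue S a b) i k).
have mu0 z k : W z -> xb 0 k != 0 -> 0 < mu_C z 0 k.
  by move=> [Wz _] xk; rewrite lt_def mu_C_eq0 mu_C_orthant andbT Wz.
exists W, f; split => //.
- split => [k xk|i xi].
    by rewrite -mu_C_eq0 (mu_X_coord bx).
  rewrite affine_mu_coord// lt_def xi /=.
  exact: (chart_model (ia_is_chart S a) ax).
- apply/smooth_openP => r; apply/(Cr_rVP _ _ oW) => j.
  apply: cCr_of_zcoord => // i; apply: cCr_mul => //.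
    rewrite /radial; have [xi|xi] := boolP (xa 0 i == 0); first exact: cCr_zcoord.
    apply: cCr_real => //; apply: Cr_sqrt => //; last exact: affine_mu_Cr.
    by move=> z [_ Wz]; exact: Wz.
  apply: cCr_prod => // k xk; apply: cCr_exprz => //.
    move=> z Wz; rewrite mulf_neq0//; first exact: Wz.1.
    by rewrite eq_complex /= eqxx andbT invr_eq0 gt_eqF// sqrtr_gt0 mu0.
  apply: cCr_mul => //; first exact: cCr_zcoord.
  apply: cCr_real => //; apply: Cr_inv => //.
    by move=> z Wz; rewrite gt_eqF// sqrtr_gt0 mu0.
  by apply: Cr_sqrt => //; [move=> z Wz; exact: mu0|exact: mu_C_Cr].
move=> y ay by_ Wy; set z := X_coord b y in Wy *.
pose t := fiber_coord b (rep y).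
have zE k : zcoord z k = Complex (Num.sqrt (phi b (mu_X y) 0 k)) 0 * tcoord t k.
  exact: zcoord_polar.
have muz k : mu_C z 0 k = phi b (mu_X y) 0 k by rewrite (mu_X_coord by_).
have yE i : zcoord (X_coord a y) i = Complex (Num.sqrt (phi a (mu_X y) 0 i)) 0 *
    \prod_k tcoord t k ^ sval (glue S a b) i k.
  rewrite -tcoord_act /t -(fiber_coord_change (t := rep y) ay by_).
  exact: zcoord_polar.
have affE i : affine_mu a b i z = phi a (mu_X y) 0 i by exact: affine_mu_coord.
clearbody t z.
have phaseE k : xb 0 k != 0 -> phase z k = tcoord t k.
  move=> xk; rewrite /phase zE muz.
  have h : Num.sqrt (phi b (mu_X y) 0 k) != 0.
    by rewrite gt_eqF// sqrtr_gt0 -muz mu0.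
  rewrite mulrAC -[RHS]mul1r; congr (_ * _).
  by apply/eqP; rewrite eq_complex /= !mulr0 !mul0r subr0 addr0 mulfV// !eqxx.
(* It remains to compare the factors of the angle at the coordinates that vanish
   at x: there the exponents are 0 or, at the matching coordinate, 1. *)
apply: zcoord_inj => i; rewrite of_zcoordK yE.
transitivity (radial z i * \prod_(k | xb 0 k != 0) tcoord t k ^ sval (glue S a b) i k).
  apply: (congr1 (fun p => radial z i * p)); apply: eq_bigr => k xk.
  exact: (congr1 (fun p => p ^ sval (glue S a b) i k) (phaseE k xk)).
rewrite [in RHS](bigID (fun k => xb 0 k != 0)) /=.
rewrite [X in _ = _ * X]mulrC mulrA; congr (_ * _).
rewrite /radial; case: eqVneq => xi; last first.
  rewrite affE big1 ?mulr1// => k; rewrite negbK => /eqP xk.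
  by rewrite (transition_nonfacets ax bx xi xk) expr0z.
have [sj r1 r2] := sP i xi.
rewrite (bigD1 (s i))/= ?sj ?eqxx// big1 ?mulr1; last first.
  by move=> k /andP[/negPn/eqP xk ks]; rewrite r2// (negbTE ks) expr0z.
rewrite r2// eqxx expr1z zE; congr (Complex (Num.sqrt _) 0 * _).
have shift0 : ia_shift S a b 0 i = 0.
  have := ia_coordE i ax bx; rewrite -/xa -/xb xi (bigD1 (s i))//= sj mul0r add0r.
  by rewrite big1 ?add0r// => k ks; rewrite r1 (negbTE ks) mulr0.
rewrite (ia_coordE i ay by_) shift0 addr0 (bigD1 (s i))//= r1 eqxx mulr1.
by rewrite big1 ?addr0// => k ks; rewrite r1 (negbTE ks) mulr0.
Qed.

Lemma X_transition_smooth a b x0 y0 :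
  smooth_transition (X_chart S b x0) (X_chart S a y0).
Proof.
move=> z0 [x [bx ax] <-].
have [W [f [oW Wx sf fE]]] := X_coord_change_near a b x ax bx.
exists W, f; split => // z Wz [y [by_ ay] yz].
have yz' : X_coord b y = z := yz.
rewrite -yz' in Wz *; rewrite (fE y ay by_ Wz).
by rewrite -[RHS]/(X_coord a (X_chart_inv S b x0 (X_coord b y))) (X_chart_invK hB).
Qed.

(** By [X_coord_inverse_near]; smoothness in the sense of extensions is then
    smoothness in the sense of open sets, see [smooth_on_open]. *)
Lemma X_overlap_open a b :
  open (@X_coord _ _ _ _ _ S b @` [set x : X | U b (mu_X x) /\ U a (mu_X x)]).
Proof.
rewrite openE => z0 [x [bx ax] <-]; rewrite /interior.
have nU : nbhs x [set y : X | U a (mu_X y)].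
  by apply: open_nbhs_nbhs; split; [exact: X_dom_open|].
have h1 := X_coord_inverse_near hB S b x _ bx nU.
have [_ _ _ _ [V oV cV]] := X_chart_is_chart hB S b x.
have Vx : V (X_coord b x).
  have : (V `&` setT) (X_coord b x) by rewrite -cV; exists x.
  by case.
have h2 : nbhs (X_coord b x) V by exact: open_nbhs_nbhs.
apply: (@filterS2 _ _ (nbhs_filter (X_coord b x)) _ _ _ _ h1 h2) => z hz Vz.
have : (V `&` setT) z by split.
rewrite -cV => -[y by_ yz]; exists y => //; split; first exact: by_.
exact: (hz y by_ yz).
Qed.

End TransitionSmooth.
Set Implicit Arguments.

Lemma smooth_on_open {R : realType} {m k} (D : set 'rV[R]_m)
    (f : 'rV[R]_m -> 'rV[R]_k) : open D -> smooth_on D f -> smooth_open D f.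
Proof.
move=> oD sf s x Dx; have [U [g [oU Ux sg gf]]] := sf x Dx.
suff : smooth_open (U `&` D) f by apply.
have oUD : open (U `&` D) by exact: openI.
apply/smooth_openP => r.
have Cg : Cr r (U `&` D) g by apply: Cr_sub ((smooth_openP _ _).1 sg r); exact: subIsetl.
by apply: Cr_ext Cg => // y /set_mem[Uy Dy]; rewrite gf.
Qed.

(** * Invariance of the symplectic form *)

Section SymplecticForm.
Context {R : realType} {n : nat}.
Local Notation V := 'rV[R]_(n + n).

Lemma pi_neq0 : pi != 0 :> R.
Proof. by rewrite gt_eqF// pi_gt0. Qed.

Lemma omega_C_formE (v w : V) : complex.Re (omega_C_form v w) =
  pi^-1 * \sum_(k < n) (v 0 (rshift n k) * w 0 (lshift n k)
                        - v 0 (lshift n k) * w 0 (rshift n k)).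
Proof.
rewrite /omega_C_form.
pose s : R := \sum_(k < n) (v 0 (rshift n k) * w 0 (lshift n k)
                            - v 0 (lshift n k) * w 0 (rshift n k)).
have -> : \sum_(k < n) (zcoord v k * (zcoord w k)^*%C - zcoord w k * (zcoord v k)^*%C) =
    Complex 0 (2 * s).
  rewrite /s mulr_sumr.
  rewrite (big_morph (fun x => Complex 0 x : R[i]) (id1 := 0) (op1 := +%R)) //.
    apply: eq_bigr => k _; apply/eqP; rewrite eq_complex /=.
    by apply/andP; split; apply/eqP; ring.
  by move=> x y; apply/eqP; rewrite eq_complex /= addr0 !eqxx.
have p0 := pi_neq0.
rewrite -/s /= !mul0r sub0r expr0n add0r.
by move: p0; generalize (pi : R) => P P0; field.
Qed.

(** The form is 1/pi times the standard one, up to sign, since dz /\ d(conj z) is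
    -2i dx /\ dy. *)
Lemma omega_C_block :
  omega_C = block_mx 0 (- pi^-1)%:M (pi^-1)%:M 0 :> 'M[R]_(n + n).
Proof.
have d (i j : 'I_(n + n)) : (delta_mx 0 i : V) 0 j = (j == i)%:R by rewrite mxE eqxx.
apply/matrixP => i j; rewrite mxE omega_C_formE.
under eq_bigr do rewrite !d.
rewrite -(splitK i) -(splitK j).
case: (fintype.split i) (fintype.split j) => i' [j'|j'] /=.
- rewrite block_mxEul mxE big1 ?mulr0// => k _.
  by rewrite ?eq_rlshift ?mul0r ?mulr0 subrr.
- rewrite block_mxEur !mxE (bigD1 i')//= big1 => [|k ki].
    rewrite ?eq_rlshift ?eq_lrshift ?eq_lshift ?eq_rshift eqxx mul0r mul1r sub0r addr0.
    by case: eqVneq; rewrite ?mulrN1 ?mulr1n ?mulr0n ?oppr0 ?mulr0.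
  by rewrite ?eq_rlshift ?eq_lrshift ?eq_lshift (negbTE ki) !mul0r subrr.
- rewrite block_mxEdl !mxE (bigD1 i')//= big1 => [|k ki].
    rewrite ?eq_rlshift ?eq_lrshift ?eq_lshift ?eq_rshift eqxx mul0r mul1r subr0 addr0.
    by case: eqVneq; rewrite ?mulr1 ?mulr1n ?mulr0n ?mulr0.
  by rewrite ?eq_rlshift ?eq_lrshift ?eq_rshift (negbTE ki) !mul0r subrr.
- rewrite block_mxEdr mxE big1 ?mulr0// => k _.
  by rewrite ?eq_lrshift ?mul0r ?mulr0 subrr.
Qed.

Lemma omega_C_antisym : (omega_C : 'M[R]_(n + n))^T = - omega_C.
Proof.
rewrite omega_C_block tr_block_mx !tr_scalar_mx !trmx0 opp_block_mx !oppr0.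
by rewrite -!raddfN /= opprK.
Qed.

Lemma omega_C_unit : (omega_C : 'M[R]_(n + n)) \in unitmx.
Proof.
have p0 := pi_neq0.
have h : omega_C *m block_mx 0 pi%:M (- pi)%:M 0 = 1%:M :> 'M[R]_(n + n).
  rewrite omega_C_block mulmx_block !mul0mx !mulmx0 !add0r !addr0 -!scalar_mxM.
  by rewrite mulrNN mulVf// -scalar_mx_block.
by have [] := mulmx1_unit h.
Qed.

Lemma omega_C_pairing (v w : V) : (v *m omega_C *m w^T) 0 0 =
  pi^-1 * \sum_(k < n) (v 0 (rshift n k) * w 0 (lshift n k)
                        - v 0 (lshift n k) * w 0 (rshift n k)).
Proof.
rewrite omega_C_block -[v]hsubmxK -[w]hsubmxK mul_row_block !mulmx0 add0r addr0.
rewrite tr_row_mx mul_row_col mxE !mul_mx_scalar -!scalemxAl !mxE !mulr_sumr.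
rewrite -big_split /=; apply: eq_bigr => k _.
by rewrite !row_mxEl !row_mxEr !mxE; ring.
Qed.

Lemma bilinear_mx_ext m (A A' : 'M[R]_m) :
  (forall v w : 'rV[R]_m, (v *m A *m w^T) 0 0 = (v *m A' *m w^T) 0 0) -> A = A'.
Proof.
move=> h; apply/matrixP => i j; have := h (delta_mx 0 i) (delta_mx 0 j).
by rewrite trmx_delta -!rowE -!colE !mxE.
Qed.

(** [polar] with angles in R instead of the circle, so that it is a map between
    vector spaces and has a Jacobian. *)
Definition action_angle (q : V) : V :=
  of_zcoord (fun k => Complex (Num.sqrt (q 0 (lshift n k))) 0 * cis (q 0 (rshift n k))).

Lemma action_angle_polar q :
  action_angle q = polar (lsubmx q) (torus_exp (rsubmx q)).
Proof.
apply: zcoord_inj => k; rewrite of_zcoordK zcoord_polar tcoord_exp.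
by rewrite !mxE.
Qed.

Lemma action_angle_l q k : action_angle q 0 (lshift n k) =
  Num.sqrt (q 0 (lshift n k)) * cos (2 * pi * q 0 (rshift n k)).
Proof. by rewrite row_mxEl mxE /= mul0r subr0. Qed.

Lemma action_angle_r q k : action_angle q 0 (rshift n k) =
  Num.sqrt (q 0 (lshift n k)) * sin (2 * pi * q 0 (rshift n k)).
Proof. by rewrite row_mxEr mxE /= mul0r addr0. Qed.

Lemma derive_comp1 {W : normedModType R} (h : R -> R) (L : W -> R) (dh : R) q v :
  differentiable L q -> is_derive (L q) (1 : R) h dh ->
  differentiable (fun q => h (L q)) q /\
  'D_v (fun q => h (L q)) q = 'D_v L q * dh.
Proof.
move=> dL [/derivable1_diffP d1 d2].
have dcomp : differentiable (h \o L) q by exact: differentiable_comp.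
split; first exact: dcomp.
rewrite [LHS](_ : _ = 'D_v (h \o L) q)//.
by rewrite deriveE// diff_comp//= diff1E// derive1E d2 -deriveE.
Qed.

Lemma derive_linear_coord {m} (a : R) (q v : 'rV[R]_m) l :
  differentiable (fun q : 'rV[R]_m => a * q 0 l) q /\
  'D_v (fun q : 'rV[R]_m => a * q 0 l) q = a * v 0 l.
Proof.
have dc : differentiable (fun q : 'rV[R]_m => q 0 l) q by exact: differentiable_coord.
have dv : 'D_v (fun q : 'rV[R]_m => q 0 l) q = v 0 l.
  by rewrite -derive_coord; [rewrite derive_id|exact: derivable_id].
have -> : (fun q : 'rV[R]_m => a * q 0 l) = a *: (fun q : 'rV[R]_m => q 0 l) by [].
split; first exact: differentiableZ.
by rewrite deriveZ ?dv//; exact: diff_derivable.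
Qed.

Lemma derive_action_angle (q v : V) k : 0 < q 0 (lshift n k) ->
  let s := Num.sqrt (q 0 (lshift n k)) in
  let c := cos (2 * pi * q 0 (rshift n k)) in
  let d := sin (2 * pi * q 0 (rshift n k)) in
  [/\ differentiable (fun q => action_angle q 0 (lshift n k)) q,
      differentiable (fun q => action_angle q 0 (rshift n k)) q,
      'D_v (fun q => action_angle q 0 (lshift n k)) q =
        v 0 (lshift n k) * (2 * s)^-1 * c - s * (2 * pi) * d * v 0 (rshift n k)
    & 'D_v (fun q => action_angle q 0 (rshift n k)) q =
        v 0 (lshift n k) * (2 * s)^-1 * d + s * (2 * pi) * c * v 0 (rshift n k)].
Proof.
move=> q0 s c d.
have [d1 e1] := derive_linear_coord 1 q v (lshift n k).
have [d2 e2] := derive_linear_coord (2 * pi) q v (rshift n k).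
have q0' : 0 < 1 * q 0 (lshift n k) by rewrite mul1r.
have [ds es] := derive_comp1 v d1 (is_derive1_sqrt q0').
have [dc ec] := derive_comp1 v d2 (is_derive_cos (2 * pi * q 0 (rshift n k))).
have [dd ed] := derive_comp1 v d2 (is_derive_sin (2 * pi * q 0 (rshift n k))).
have -> : (fun q : V => action_angle q 0 (lshift n k)) =
    (fun q : V => Num.sqrt (1 * q 0 (lshift n k))) *
    (fun q : V => cos (2 * pi * q 0 (rshift n k))).
  by apply/funext => x; rewrite action_angle_l -[X in Num.sqrt X]mul1r.
have -> : (fun q : V => action_angle q 0 (rshift n k)) =
    (fun q : V => Num.sqrt (1 * q 0 (lshift n k))) *
    (fun q : V => sin (2 * pi * q 0 (rshift n k))).
  by apply/funext => x; rewrite action_angle_r -[X in Num.sqrt X]mul1r.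
split; [exact: differentiableM|exact: differentiableM| |].
  rewrite deriveM; [|exact: diff_derivable|exact: diff_derivable].
  by rewrite es ec e1 e2 !mul1r /GRing.scale /= -/s -/c -/d; ring.
rewrite deriveM; [|exact: diff_derivable|exact: diff_derivable].
by rewrite es ed e1 e2 !mul1r /GRing.scale /= -/s -/c -/d; ring.
Qed.

Lemma action_angle_differentiable (q : V) : (forall k, 0 < q 0 (lshift n k)) ->
  differentiable action_angle q.
Proof.
move=> q0; apply: differentiable_rV => j; rewrite -(splitK j).
by case: (fintype.split j) => k /=; have [] := derive_action_angle 0 (q0 k).
Qed.

(** For z = sqrt xi * cis theta one has dx /\ dy = (1/2) d(r^2) /\ d(2 pi theta) =
    pi dxi /\ dtheta, where r^2 = xi. *)
Lemma action_angle_pullback (q : V) : (forall k, 0 < q 0 (lshift n k)) ->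
  'J action_angle q *m omega_C *m ('J action_angle q)^T = pi *: omega_C.
Proof.
move=> q0; have dq := action_angle_differentiable q0.
have p0 := pi_neq0.
have dv u : derivable action_angle q u by exact: diff_derivable dq.
have Dv u k : ('D_u action_angle q) 0 k = 'D_u (fun y => action_angle y 0 k) q.
  by rewrite (derive_coord k (dv u)).
apply: bilinear_mx_ext => v w.
rewrite -scalemxAr -scalemxAl [RHS]mxE omega_C_pairing.
rewrite !mulmxA -mulmxA -trmx_mul -!deriveEjacobian// omega_C_pairing.
rewrite mulrCA; congr (_ * _); rewrite mulr_sumr; apply: eq_bigr => k _.
have [_ _ l1 r1] := derive_action_angle v (q0 k).
have [_ _ l2 r2] := derive_action_angle w (q0 k).
move: (Dv v (lshift n k)) (Dv v (rshift n k)) (Dv w (lshift n k)) (Dv w (rshift n k)).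
rewrite l1 r1 l2 r2; move: ('D_v action_angle q) ('D_w action_angle q) => a b -> -> -> ->.
have s0 : Num.sqrt (q 0 (lshift n k)) != 0 by rewrite gt_eqF// sqrtr_gt0.
have cs := cos2Dsin2 (2 * pi * q 0 (rshift n k)).
move: cs s0; move: (cos _) (sin _) (Num.sqrt _) => c d s cs s0.
move: p0; generalize (pi : R) => P P0.
transitivity (P * (c ^+ 2 + d ^+ 2) * (v 0 (rshift n k) * w 0 (lshift n k) -
  v 0 (lshift n k) * w 0 (rshift n k))); last by rewrite cs mulr1.
by field.
Qed.

Lemma derive_compJ {m l p} (g : 'rV[R]_m -> 'rV[R]_l) (f : 'rV[R]_l -> 'rV[R]_p) x v :
  differentiable g x -> differentiable f (g x) ->
  'D_v (f \o g) x = 'D_v g x *m 'J f (g x).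
Proof.
move=> dg df; have dfg : differentiable (f \o g) x by exact: differentiable_comp.
rewrite (deriveE v dfg) (diff_comp dg df) /= -(deriveE v dg).
by rewrite -(deriveE _ df) (deriveEjacobian _ df).
Qed.

Lemma mulmx_ext {m l} (A C : 'M[R]_m) (B D : 'M[R]_(m, l)) :
  (forall v : 'rV[R]_m, v *m A *m B = v *m C *m D) -> A *m B = C *m D.
Proof. by move=> h; apply/row_matrixP => i; rewrite !rowE !mulmxA. Qed.

(** With [J] and [J1] the Jacobians of polar coordinates at a point and at its
    image, [F] that of a map and [M] its expression in polar coordinates: the
    common factor [c] cancels. *)
Lemma congruence_cancel {m} (J F M J1 Om : 'M[R]_m) (c : R) :
  c != 0 -> Om \in unitmx -> J *m Om *m J^T = c *: Om ->
  J1 *m Om *m J1^T = c *: Om -> J *m F = M *m J1 -> M *m Om *m M^T = Om ->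
  F *m Om *m F^T = Om.
Proof.
move=> c0 uOm E0 E1 JJ MO.
have Ju : J \in unitmx.
  suff : J *m (Om *m J^T *m invmx (c *: Om)) = 1%:M by case/mulmx1_unit.
  by rewrite !mulmxA E0 mulmxV// unitmxZ// unitfE.
have JtU : J^T \in unitmx by rewrite unitmx_tr.
apply: (can_inj (mulKmx Ju)); apply: (can_inj (mulmxK JtU)).
rewrite /= E0; transitivity ((J *m F) *m Om *m (J *m F)^T).
  by rewrite trmx_mul !mulmxA.
rewrite JJ trmx_mul; transitivity (M *m (J1 *m Om *m J1^T) *m M^T).
  by rewrite !mulmxA.
by rewrite E1 -scalemxAr -scalemxAl MO.
Qed.

(** By the chain rule the Jacobians of polar coordinates intertwine [M] and the
    Jacobian of [f], and they rescale the form by the same constant at all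
    points. *)
Lemma symplectic_of_action_angle (f : V -> V) (q0 : V) (M : 'M[R]_(n + n)) (c : V) :
  (forall k, 0 < q0 0 (lshift n k)) ->
  (forall k, 0 < (q0 *m M + c) 0 (lshift n k)) ->
  M *m omega_C *m M^T = omega_C ->
  differentiable f (action_angle q0) ->
  (\forall q \near q0, f (action_angle q) = action_angle (q *m M + c)) ->
  pullback f (action_angle q0) omega_C = omega_C.
Proof.
move=> p0 p1 MO df fE; rewrite /pullback.
set q1 := q0 *m M + c.
have d0 := action_angle_differentiable p0.
have d1 := action_angle_differentiable p1.
pose aff (q : V) : V := q *m M + c.
have affS : smooth_open setT aff.
  apply/(smooth_open_rVP _ openT) => j; apply/smooth_openP => r.
  have CS : Cr r setT (fun q : V => \sum_k q 0 k * M k j + c 0 j).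
    apply: (Cr_add openT); last exact: Cr_cst.
    apply: (Cr_sum openT) => k; apply: (Cr_mul openT); [exact: Cr_coord|exact: Cr_cst].
  by apply: (Cr_ext openT _ CS) => q _; rewrite !mxE.
have daff : differentiable aff q0.
  by apply: differentiable_rV => j; exact: (smooth_open_differentiable j openT affS).
have Daff v : 'D_v aff q0 = v *m M.
  have H t : aff (t *: v + q0) - aff q0 = t *: (v *m M).
    by rewrite /aff mulmxDl -scalemxAl -(addrA (t *: (v *m M))) addrK.
  by have [_ ->] := derive_line H.
have JJ : 'J action_angle q0 *m 'J f (action_angle q0) = M *m 'J action_angle q1.
  apply: mulmx_ext => v.
  have e : 'D_v (f \o action_angle) q0 = 'D_v (action_angle \o aff) q0.
    exact: near_eq_derive fE.
  move: e; rewrite (derive_compJ v d0 df) (derive_compJ v daff d1) Daff.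
  by rewrite (deriveEjacobian v d0).
exact: (congruence_cancel pi_neq0 omega_C_unit (action_angle_pullback p0)
  (action_angle_pullback p1) JJ MO).
Qed.

(** The points at which no coordinate vanishes are dense, and the pullback of
    the form along a smooth map is continuous. *)
Lemma symplectic_of_dense (f : V -> V) (D : set V) :
  open D -> smooth_open D f ->
  (forall z, D z -> (forall k, zcoord z k != 0) -> pullback f z omega_C = omega_C) ->
  forall z, D z -> pullback f z omega_C = omega_C.
Proof.
move=> oD sf H z0 Dz0; apply/matrixP => i j.
have Cf r k : Cr r D (fun z => f z 0 k).
  by have /smooth_openP := (smooth_open_rVP _ oD).1 sf k.
have dfk z k : D z -> differentiable (fun z => f z 0 k) z.
  by move=> Dz; exact: Cr_differentiable oD (Cf 1%N k) Dz.
have df z : D z -> differentiable f z.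
  by move=> Dz; apply: differentiable_rV => k; exact: dfk.
pose h z := \sum_k \sum_l 'D_(delta_mx 0 i) (fun z => f z 0 k) z * omega_C k l *
  'D_(delta_mx 0 j) (fun z => f z 0 l) z.
have hE z : D z -> pullback f z omega_C i j = h z.
  move=> Dz; have JE p k : 'J f z p k = 'D_(delta_mx 0 p) (fun z => f z 0 k) z.
    have dv : derivable f z (delta_mx 0 p) by exact: diff_derivable (df z Dz).
    by rewrite -(derive_coord k dv) (deriveEjacobian _ (df z Dz)) -rowE [RHS]mxE.
  rewrite /pullback mxE /h exchange_big /=; apply: eq_bigr => l _.
  rewrite mxE [X in _ * X]mxE JE mulr_suml; apply: eq_bigr => k _.
  by rewrite JE.
have hC : {for z0, continuous h}.
  have Ch : Cr 0 D h.
    apply: (Cr_sum oD) => k; apply: (Cr_sum oD) => l.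
    have C1 : Cr 0 D ('D_(delta_mx 0 i) (fun z => f z 0 k)) := ((Cf 1%N k).2 i).2.
    have C2 : Cr 0 D ('D_(delta_mx 0 j) (fun z => f z 0 l)) := ((Cf 1%N l).2 j).2.
    apply: (Cr_mul oD _ C2); apply: (Cr_mul oD C1); exact: Cr_cst.
  exact: Cr_continuous Ch Dz0.
(* Moving the real parts of the vanishing coordinates leaves the locus where some
   coordinate is zero. *)
pose v : V := row_mx (\row_k (zcoord z0 k == 0)%:R) 0.
have vl k : v 0 (lshift n k) = (zcoord z0 k == 0)%:R by rewrite row_mxEl mxE.
have vr k : v 0 (rshift n k) = 0 by rewrite row_mxEr mxE.
clearbody v.
have nD : nbhs z0 D by exact: open_nbhs_nbhs.
have ev : \forall t \near (0 : R)^'+, h (t *: v + z0) = omega_C i j.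
  have h1 : \forall t \near (0 : R)^'+, D (t *: v + z0).
    by apply: cvg_within; exact: (near_ray v nD).
  have h2 : \forall t \near (0 : R)^'+, 0 < t by exact: nbhs_right_gt.
  apply: filterS2 h1 h2 => t Dt t0; rewrite -(hE _ Dt) H// => k.
  rewrite eq_complex /= !mxE vl vr mulr0 add0r.
  have [e|e] := eqVneq (zcoord z0 k) 0; last first.
    by rewrite mulr0 add0r; move: e; rewrite eq_complex.
  by have [e1 e2] := e; rewrite e1 addr0 mulr1 (gt_eqF t0).
rewrite (hE _ Dz0).
have c1 : h (t *: v + z0) @[t --> (0 : R)^'+] --> h z0.
  have cr : continuous_at (0 : R) (fun t : R => t *: v + z0).
    apply: cvgD; last exact: cvg_cst.
    exact: (@scalel_continuous _ _ v 0).
  have ch : continuous_at (0 : R) (fun t : R => h (t *: v + z0)).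
    apply: (@continuous_comp _ _ _ (fun t : R => t *: v + z0) h) => //.
    by rewrite scale0r add0r.
  have := ch; rewrite /continuous_at scale0r add0r.
  exact: cvg_at_right_filter.
have c2 : h (t *: v + z0) @[t --> (0 : R)^'+] --> omega_C i j by exact: cvg_near_cst.
by rewrite -(cvg_lim (@Rhausdorff R) c1) (cvg_lim (@Rhausdorff R) c2).
Qed.

End SymplecticForm.

Unset Implicit Arguments.
Section TransitionSymplectic.
Context {R : realType} {n : nat} {B : topologicalType}.
Context {AB : set (chart R B n)} {I : choiceType}.
Hypothesis hB : is_manifold (orthant R n) AB.
Variable S : integral_affine AB I.

Local Notation phi a := (ia_chart S a).
Local Notation U a := (dom (ia_chart S a)).
Local Notation X := (X_PL S).

(** The linear part of a change of charts in action-angle coordinates: the linear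
    part of the affine structure on the actions and its contragredient on the
    angles. *)
Definition angle_mx a b : 'M[R]_(n + n) :=
  block_mx (real_lin S a b)^T 0 0 (map_mx intr (sval (glue S a b)))^T.

Definition angle_shift a b : 'rV[R]_(n + n) := row_mx (ia_shift S a b) 0.

Lemma angle_mxE a b (q : 'rV[R]_(n + n)) : q *m angle_mx a b + angle_shift a b =
  row_mx (lsubmx q *m (real_lin S a b)^T + ia_shift S a b)
         (rsubmx q *m (map_mx intr (sval (glue S a b)))^T).
Proof.
rewrite -{1}[q]hsubmxK mul_row_block !mulmx0 addr0 add0r add_row_mx addr0.
by [].
Qed.

Lemma angle_mx_symplectic a b x : U a x -> U b x ->
  angle_mx a b *m omega_C *m (angle_mx a b)^T = omega_C.
Proof.
move=> ax bx; rewrite /angle_mx (glueE ax bx) map_trmx trmxK.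
have NA : map_mx intr (sval (ia_lin S b a)) *m real_lin S a b = 1%:M :> 'M[R]_n.
  by rewrite /real_lin -map_mxM (ia_lin_inv bx ax) map_mx1.
rewrite omega_C_block tr_block_mx !trmx0 trmxK !mulmx_block.
rewrite ?mul0mx ?mulmx0 ?add0r ?addr0 ?mul0mx ?mulmx0 ?add0r ?addr0 ?mul_mx_scalar.
rewrite -!scalemxAl NA -trmx_mul NA trmx1 !scalemx1.
by [].
Qed.

Lemma X_coord_action_angle b (x : X) : exists v : 'rV[R]_n,
  X_coord b x = action_angle (row_mx (phi b (mu_X x)) v).
Proof.
have [v [vE _]] := torus_exp_surj (fiber_coord b (rep x)).
by exists v; rewrite action_angle_polar row_mxKl row_mxKr vE.
Qed.

Lemma X_coord_change_action_angle a b (y : X) (q : 'rV[R]_(n + n)) :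
  U a (mu_X y) -> U b (mu_X y) -> (forall k, 0 < q 0 (lshift n k)) ->
  X_coord b y = action_angle q ->
  X_coord a y = action_angle (q *m angle_mx a b + angle_shift a b).
Proof.
move=> ay by_ q0 e.
have l0 k : 0 < lsubmx q 0 k by rewrite mxE.
have lo : orthant R n (lsubmx q) by move=> k; exact/ltW.
have pE : phi b (mu_X y) = lsubmx q.
  by rewrite -(mu_X_coord by_) e action_angle_polar mu_polar.
have tE : fiber_coord b (rep y) = torus_exp (rsubmx q).
  apply: torus_ext => k.
  have e' : polar (lsubmx q) (fiber_coord b (rep y)) = polar (lsubmx q) (torus_exp (rsubmx q)).
    by rewrite -action_angle_polar -e -pE.
  by apply: ((polar_eqP _ _ lo).1 e'); rewrite gt_eqF.
rewrite action_angle_polar angle_mxE row_mxKl row_mxKr.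
rewrite -torus_act_exp -tE -(fiber_coord_change (t := rep y) ay by_).
rewrite -pE -ia_affine//.
Qed.

(** Where no coordinate vanishes the change of charts is [angle_mx] up to a
    translation in action-angle coordinates; density gives the other points. *)
Lemma X_transition_symplectic a b x0 z :
  (@X_coord _ _ _ _ _ S b @` [set x : X | U b (mu_X x) /\ U a (mu_X x)]) z ->
  pullback (@X_coord _ _ _ _ _ S a \o X_chart_inv S b x0) z omega_C = omega_C.
Proof.
set D := image _ _; set f := _ \o _.
have oD : open D := X_overlap_open hB S a b.
have sf : smooth_open D f.
  apply: smooth_on_open oD _; exact: (X_transition_smooth hB S a b x0 x0).
have fE (y : X) : U b (mu_X y) -> f (X_coord b y) = X_coord a y.
  by move=> by_; rewrite /f /comp (X_chart_invK hB).
clearbody f; move: z; apply: (symplectic_of_dense oD sf) => z Dz z0.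
case: (Dz) => x [bx ax] xz.
have [v vE] := X_coord_action_angle b x.
pose q0 : 'rV[R]_(n + n) := row_mx (phi b (mu_X x)) v.
have bx0 k : 0 < phi b (mu_X x) 0 k.
  rewrite lt_def (chart_model (ia_is_chart S b) bx) andbT.
  by rewrite -(mu_X_coord bx) mu_C_eq0 xz.
have p0 k : 0 < q0 0 (lshift n k) by rewrite row_mxEl.
have zq : z = action_angle q0 by rewrite -xz vE.
(* The actions in the other chart do not vanish either, since the facets through
   a point are matched. *)
have p1 k : 0 < (q0 *m angle_mx a b + angle_shift a b) 0 (lshift n k).
  rewrite angle_mxE row_mxEl row_mxKl -ia_affine// lt_def.
  rewrite (chart_model (ia_is_chart S a) ax) andbT; apply/eqP => h.
  have [j [xj _ _]] := transition_facets ax bx h.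
  by have := bx0 j; rewrite xj ltxx.
have df : differentiable f (action_angle q0).
  rewrite -zq; apply: differentiable_rV => j.
  exact: (smooth_open_differentiable j oD sf Dz).
rewrite zq; apply: (symplectic_of_action_angle p0 p1 (angle_mx_symplectic a b _ ax bx) df).
have cE : {for q0, continuous (@action_angle R n)}.
  exact/differentiable_continuous/action_angle_differentiable.
have nD : nbhs (action_angle q0) D by rewrite -zq; exact: open_nbhs_nbhs.
have h1 : \forall q \near q0, D (action_angle q) := cE D nD.
have h2 : nbhs q0 [set q : 'rV[R]_(n + n) | forall k, 0 < q 0 (lshift n k)].
  have Q k : nbhs q0 [set q : 'rV[R]_(n + n) | 0 < q 0 (lshift n k)].
    apply: open_nbhs_nbhs; split; last exact: p0.
    by apply: open_comp (@open_gt R 0) => w _; exact: coord_continuous.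
  exact: (filter_forall (nbhs_filter q0) Q).
apply: (@filterS2 _ _ (nbhs_filter q0) _ _ _ _ h1 h2) => q [y [by_ ay] yq] q0'.
rewrite -(X_coord_change_action_angle a b y q ay by_ q0' yq) -yq.
exact: fE.
Qed.

End TransitionSymplectic.
Set Implicit Arguments.

(** * The canonical model as a locally toric Lagrangian fibration *)

Lemma smooth_on_cst {R : realType} {m} {W : normedModType R} (D : set 'rV[R]_m) (w : W) :
  smooth_on D (fun=> w).
Proof.
move=> x _; exists setT, (cst w); split => //; first exact: openT.
by apply/smooth_openP => r; exact: Cr_cst.
Qed.

Theorem lemma7p3 (R : realType) (n : nat) (B : topologicalType)
    (AB : set (chart R B n)) (hB : is_manifold (orthant R n) AB)
    (I : choiceType) (S : integral_affine AB I) :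
  exists (AX : set (chart R (X_PL S) (n + n)))
         (om : chart R (X_PL S) (n + n) -> 'rV[R]_(n + n) -> 'M[R]_(n + n)),
    [/\ is_manifold setT AX,
        symplectic_form AX om
      & locally_toric_Lagrangian_fibration AB AX om (@mu_X R n B AB I S)].
Proof.
pose AX : set (chart R (X_PL S) (n + n)) :=
  [set c | exists a x0, c = X_chart S a x0].
exists AX, (fun _ _ => omega_C).
have chartAX c : AX c -> is_chart setT c.
  by move=> [a [x0 ->]]; exact: (X_chart_is_chart hB).
have transAX c d : AX c -> AX d -> smooth_transition c d.
  move=> [a [x0 ->]] [b [y0 ->]]; exact: (X_transition_smooth hB).
have sympAX c d : AX c -> AX d -> forall z, (c @` (dom c `&` dom d)) z ->
    omega_C = pullback (d \o chart_inv c) z omega_C.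
  move=> [a [x0 ->]] [b [y0 ->]] z zD.
  exact: (esym (X_transition_symplectic hB S b a x0 z zD)).
split.
- split; [exact: (X_hausdorff hB)|exact: (X_second_countable hB)|split => //].
  apply/seteqP; split => // x _; have [a ax] := ia_coverP S (mu_X x).
  by exists (X_chart S a x); [exists a, x|exact: ax].
- split => [c Ac|//]; split; first exact: smooth_on_cst.
  move=> z _; split; [exact: omega_C_antisym|exact: omega_C_unit|].
  by move=> i j k; rewrite !derive_cst !addr0.
split.
  split; first exact: mu_X_continuous.
  move=> _ d [a [x0 ->]] Ad.
  have sd : smooth_transition (ia_chart S a) d by have [_ /(_ d Ad)[]] := ia_chartP S a.
  apply: (smooth_on_comp (@mu_C_smooth R n) sd) => z [x [ax dx] <-].
    rewrite -[X_chart S a x0 x]/(X_coord a x) (mu_X_coord ax).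
    by exists (mu_X x).
  rewrite -[X_chart S a x0 x]/(X_coord a x) (mu_X_coord ax) /=.
  by rewrite (X_chart_invK hB S a x0 x ax) (chart_invK (ia_is_chart S a) ax).
move=> b; have [a ab] := ia_coverP S b.
pose b' : set_type (dom (ia_chart S a)) := exist (fun x => x \in dom (ia_chart S a)) b (mem_set ab).
(* The charts of X need a point of X for the default value of their inverse. *)
pose x0 : X_PL S := cls (@X_rel _ _ _ _ _ S) (mkT (mkP b' GL1) (torus_exp 0)).
have AF : AX (X_chart S a x0) by exists a, x0.
exists (ia_chart S a), (X_chart S a x0); split.
- by split => //; exact: ia_chartP.
- by split => [|d Ad]; [exact: chartAX|split; exact: transAX].
- by split => //; exact: (X_coord_image hB).
- by move=> d z Ad zD; exact: (sympAX d _ Ad AF).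
- by move=> x ax; exact: (mu_X_coord ax).
Qed.
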